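(* Let $d\ge2$, let $X$ be $S^d$, $\mathbb{R}^d$ or $H^d$, and let $K,L\subsetneq X$ be closed convex sets with interior points; for $X=S^d$ let each of $K$ and $L$ lie in some open hemisphere. Assume that both $K$ and $L$ have supporting spheres at each of their boundary points (for $S^d$ of radii less than $\pi/2$). Below, $\varphi,\psi:X\to X$ always denote orientation preserving congruences; for $X=S^d$ they are in addition such that $(\varphi K)\cup(\psi L)$ lies in an open hemisphere $S$ of $S^d$. Write $M=\operatorname{conv}[(\varphi K)\cup(\psi L)]$. For $x\in\operatorname{bd}K$, $y\in\operatorname{bd}L$ consider the hypotheses: (A) for $S^d$, $\operatorname{diam}M$ is sufficiently close to $\pi$; for $\mathbb{R}^d$ and $H^d$, $\operatorname{diam}M$ is sufficiently large; (B) $M$ has $D:=[\varphi x,\psi y]$ as its unique diametral segment. Then the following statements are equivalent. (1) For all $\varphi,\psi$, the set $M$ is centrally symmetric. (2) For all $\varphi,\psi$, if $M$ has a unique diametral segment $D$, then $M$ is symmetric with respect to the orthogonal bisector hyperplane of $D$. (3) For all $\varphi,\psi$ and $x\in\operatorname{bd}K$, $y\in\operatorname{bd}L$ satisfying (A) and (B), $M$ is centrally symmetric. (4) For all $\varphi,\psi$ and $x\in\operatorname{bd}K$, $y\in\operatorname{bd}L$ satisfying (A) and (B), $M$ is symmetric with respect to the orthogonal bisector hyperplane of $D$. (5) For all $\varphi,\psi$ and $x\in\operatorname{bd}K$, $y\in\operatorname{bd}L$ satisfying (A) and (B), there exists $\varepsilon_0=\varepsilon_0(K,L,x,y,\varphi,\psi)>0$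 (for $S^d$: $\varepsilon_0=\varepsilon_0(K,L,x,y,\varphi,\psi,S)>0$, admissible in the sense that $D(\varepsilon_0)\subset S$) such that for all $0<\varepsilon<\varepsilon_0$ the set $M\cap D(\varepsilon)$ is centrally symmetric. (6) The same as (5), with ''centrally symmetric'' replaced by ''symmetric with respect to the orthogonal bisector hyperplane of $D$''. (7) $K$ and $L$ are congruent balls (for $S^d$ of radius less than $\pi/2$).
   Context: $S^d$, $\mathbb{R}^d$, $H^d$ are the spherical, Euclidean and hyperbolic spaces (curvatures $1,0,-1$). Convexity in $H^d$ is defined as in $\mathbb{R}^d$; a set $Y\subset S^d$ with nonempty interior is convex if for any two non-antipodal points of $Y$ the shorter great circle arc connecting them lies in $Y$. Congruences are isometries. Convex hulls in $\mathbb{R}^d$, $H^d$ are as usual; for a set lying in an open hemisphere $S$ of $S^d$, its convex hull is the minimal convex set in $S$ containing it. Segments in $S^d$ are shorter great circle arcs. A convex body $Y\subset X$ has a supporting sphere at $y\in\operatorname{bd}Y$ if there is a ball (for $S^d$ of radius less than $\pi/2$) containing $Y$ and having $y$ on its boundary; the boundary of this ball is the supporting sphere. A set is centrally symmetric if it is invariant under the point reflection in some point of $X$. A diametral segment of a compact set $M$ is a segment with endpoints in $M$ whose length is $\operatorname{diam}M$. ''Sufficiently close/large'' in (A) means beyond some threshold that may depend on $K$ and $L$: the statements (3)–(6) assert the existence of such a threshold ($<\pi$ for $S^d$, finite for $\mathbb{R}^d$, $H^d$). For a closed segment $D\subset X$ ($D\subset S$ for $S^d$) and $\varepsilon>0$,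 $D(\varepsilon)$ denotes the closed convex hull of the union of the two closed $(d-1)$-balls of radius $\varepsilon$ centred at the two endpoints of $D$ and lying in the hyperplanes orthogonal to $D$ at these endpoints. For $S^d$, $\varepsilon$ is chosen so small that these two $(d-1)$-balls lie in $S$ (equivalently $D(\varepsilon)\subset S$). *)

(* Defs.v *)
From HB Require Import structures.
From mathcomp Require Import all_boot all_order all_algebra.
From mathcomp Require Import all_classical all_reals all_analysis.

Set Implicit Arguments.
Unset Strict Implicit.
Unset Printing Implicit Defensive.

Import Order.TTheory GRing.Theory Num.Theory.

Local Open Scope classical_set_scope.
Local Open Scope ring_scope.

Inductive geometry := Spherical | Euclidean | Hyperbolic.

(* S^d is the unit sphere of R^(d+1), R^d is itself, and H^d is the upper
   sheet of the hyperboloid x_0^2 - x_1^2 - ... - x_d^2 = 1 in R^(d+1).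
   Functions and sets below live on the ambient vector space; only what they
   do on [model R X d] is ever constrained. *)
Definition adim (X : geometry) (d : nat) : nat :=
  match X with Euclidean => d | _ => d.+1 end.

Notation ambient R X d := 'rV[R]_(adim X d).

Definition dot (R : realType) (n : nat) (x y : 'rV[R]_n) : R :=
  \sum_(i < n) x 0 i * y 0 i.

Definition lorentz (R : realType) (n : nat) (x y : 'rV[R]_n.+1) : R :=
  x 0 0 * y 0 0 - \sum_(i < n) x 0 (lift ord0 i) * y 0 (lift ord0 i).

(* For H^d, the signature is (+,-,...,-), so that points of H^d, like those of
   S^d, satisfy [form x x = 1]; [form] is then negative definite on tangent
   spaces. *)
Definition form (R : realType) (X : geometry) (d : nat) :
    ambient R X d -> ambient R X d -> R :=
  match X return ambient R X d -> ambient R X d -> R with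
  | Spherical => @dot R d.+1
  | Euclidean => @dot R d
  | Hyperbolic => @lorentz R d
  end.

Definition model (R : realType) (X : geometry) (d : nat) :
    set (ambient R X d) :=
  match X return set (ambient R X d) with
  | Spherical => [set x : 'rV[R]_d.+1 | dot x x = 1]
  | Euclidean => setT
  | Hyperbolic => [set x : 'rV[R]_d.+1 | lorentz x x = 1 /\ 0 < x 0 0]
  end.
Arguments model : clear implicits.

(* arcosh, for t >= 1 *)
Definition arcosh (R : realType) (t : R) : R := ln (t + Num.sqrt (t ^+ 2 - 1)).

Definition dist (R : realType) (X : geometry) (d : nat) :
    ambient R X d -> ambient R X d -> R :=
  match X return ambient R X d -> ambient R X d -> R with
  | Spherical => fun x y : 'rV[R]_d.+1 => acos (dot x y)
  | Euclidean => fun x y : 'rV[R]_d => Num.sqrt (dot (x - y) (x - y))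
  | Hyperbolic => fun x y : 'rV[R]_d.+1 => arcosh (lorentz x y)
  end.

Section Geometry.
Context {R : realType} {X : geometry} {d : nat}.
Implicit Types (x y z p q c v : ambient R X d).
Implicit Types (A K L S M Y : set (ambient R X d)).
Implicit Types (f g : ambient R X d -> ambient R X d).

Definition geo_closure A : set (ambient R X d) :=
  [set x | model R X d x /\
           forall e : R, 0 < e -> exists2 y, A y & dist x y < e].

Definition geo_interior A : set (ambient R X d) :=
  [set x | model R X d x /\
           exists2 e : R, 0 < e &
             forall y, model R X d y -> dist x y < e -> A y].

Definition geo_boundary A : set (ambient R X d) :=
  geo_closure A `\` geo_interior A.

Definition geo_closed A : Prop := geo_closure A `<=` A.

(* In S^d and H^d this is the part of the space in the convex cone spanned by
   x and y: the shorter great circle arc for non-antipodal x, y in S^d, and the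
   geodesic segment in H^d. *)
Definition segment x y : set (ambient R X d) :=
  match X with
  | Euclidean =>
      [set z | exists t : R, [/\ 0 <= t, t <= 1 & z = (1 - t) *: x + t *: y]]
  | _ =>
      [set z | model R X d z /\
               exists a b : R, [/\ 0 <= a, 0 <= b & z = a *: x + b *: y]]
  end.

Definition geo_convex Y : Prop :=
  Y `<=` model R X d /\
  forall x y, Y x -> Y y -> (X = Spherical -> y <> - x) -> segment x y `<=` Y.

(* The role of S: an open hemisphere of S^d, and the whole space for R^d and
   H^d. *)
Definition region S : Prop :=
  match X with
  | Spherical =>
      exists2 u, model R X d u & S = [set z | model R X d z /\ 0 < form u z]
  | _ => S = model R X d
  end.

(* Minimal convex set in S containing A; meaningful when A `<=` S. *)
Definition hull S A : set (ambient R X d) :=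
  [set z | forall Y, geo_convex Y -> A `<=` Y -> Y `<=` S -> Y z].

Definition geo_ball c (r : R) : set (ambient R X d) :=
  [set z | model R X d z /\ dist c z <= r].

Definition radius_ok (r : R) : Prop := 0 < r /\ (X = Spherical -> r < pi / 2).

Definition has_supporting_sphere Y y : Prop :=
  exists c r,
    [/\ model R X d c, radius_ok r, Y `<=` geo_ball c r & dist c y = r].

Definition is_geo_ball K : Prop :=
  exists c r, [/\ model R X d c, radius_ok r & K = geo_ball c r].

Definition congruence f : Prop :=
  set_bij (model R X d) (model R X d) f /\
  forall x y, model R X d x -> model R X d y -> dist (f x) (f y) = dist x y.

(* An isometry is the restriction of a unique affine map of the ambient space
   (linear for S^d and H^d); it preserves orientation iff the linear part has
   positive determinant. *)
Definition orientation_preserving f : Prop :=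
  exists (B : 'M[R]_(adim X d)) (b : ambient R X d),
    0 < \det B /\ forall x, model R X d x -> f x = x *m B + b.

Definition congruent K L : Prop := exists2 f, congruence f & f @` K = L.

Definition point_reflection c z : ambient R X d :=
  match X with
  | Euclidean => 2 *: c - z
  | _ => (2 * form c z) *: c - z
  end.

Definition centrally_symmetric A : Prop :=
  exists2 c, model R X d c & point_reflection c @` A = A.

(* A tangent vector at p pointing towards q (not normalised). *)
Definition tangent p q : ambient R X d :=
  match X with
  | Euclidean => q - p
  | _ => q - form p q *: p
  end.

(* The hyperplane through p orthogonal to the tangent vector v at p; in S^d and
   H^d, [form p v = 0], so the equation reads [form z v = 0]. *)
Definition hyperplane p v : set (ambient R X d) :=
  [set z | model R X d z /\ form (z - p) v = 0].

(* The reflection in [hyperplane p v]. *)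
Definition hyperplane_reflection p v z : ambient R X d :=
  z - (2 * form (z - p) v / form v v) *: v.

(* Midpoint of the segment [p, q], for p, q not antipodal. *)
Definition midpoint p q : ambient R X d :=
  match X with
  | Euclidean => 2^-1 *: (p + q)
  | _ => (Num.sqrt (form (p + q) (p + q)))^-1 *: (p + q)
  end.

(* Symmetry in the hyperplane orthogonal to [p, q] at its midpoint. *)
Definition bisector_symmetric p q A : Prop :=
  let m := midpoint p q in
  hyperplane_reflection m (tangent m q) @` A = A.

Definition diam A : R := sup [set t | exists x y, [/\ A x, A y & t = dist x y]].

Definition diametral A p q : Prop := [/\ A p, A q & dist p q = diam A].

Definition unique_diametral A p q : Prop :=
  diametral A p q /\
  forall p' q', diametral A p' q' -> segment p' q' = segment p q.

(* The (d-1)-ball of radius e centred at p in the hyperplane through p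
   orthogonal to [p, q]. *)
Definition orthogonal_ball p q (e : R) : set (ambient R X d) :=
  hyperplane p (tangent p q) `&` geo_ball p e.

Definition thickening S p q (e : R) : set (ambient R X d) :=
  geo_closure (hull S (orthogonal_ball p q e `|` orthogonal_ball q p e)).

Definition admissible S f g K L : Prop :=
  [/\ congruence f /\ orientation_preserving f,
      congruence g /\ orientation_preserving g,
      region S
    & f @` K `|` g @` L `<=` S].

Definition joint_hull S f g K L : set (ambient R X d) :=
  hull S (f @` K `|` g @` L).

(* P S f g x y holds for all configurations and boundary points such that
   joint_hull has [f x, g y] as its unique diametral segment and its diameter
   exceeds some threshold depending on K and L only. *)
Definition for_all_far K L
    (P : set (ambient R X d) -> (ambient R X d -> ambient R X d) ->
         (ambient R X d -> ambient R X d) ->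
         ambient R X d -> ambient R X d -> Prop) : Prop :=
  exists2 T : R, (X = Spherical -> T < pi) &
    forall S f g x y, admissible S f g K L -> geo_boundary K x -> geo_boundary L y ->
      T < diam (joint_hull S f g K L) ->
      unique_diametral (joint_hull S f g K L) (f x) (g y) ->
      P S f g x y.

End Geometry.

(* Main.v *)
(* All three geometries share one linear model: a point of S^d or H^d is itself,
   a point x of R^d is (1, x).  Convex sets become convex cones, congruences
   linear maps, and the hull of two sets the sum of their cones.

   (7) => the rest: if K and L are balls of radius r with centres at distance
   2t, then M lies in the ball of radius t + r about the midpoint of the centres,
   so the unique diametral segment, if any, lies on the line of centres; both
   symmetries are linear and exchange the two balls.

   (3)-(6) => (7): supporting spheres at x and y let one place x and y at
   opposite points of an arbitrarily large ball containing the hull M and touching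
   M only there.  Each hypothesis makes the germs of M at x and y correspond under
   one fixed linear symmetry S.  At a smooth point x of K the germ of M is that of
   K, so by symmetry and strict convexity the germ at y is that of L, and L is
   smooth at y.  Hence K and L are smooth everywhere and, for every tight
   placement, S carries the germ of K at x to that of L at y.  Fixing one placement
   gives a congruence H such that K H and L agree near y; the set of boundary
   points where they agree is open and, since normals of smooth bodies pass to
   the limit, closed, hence K H = L.  As y was arbitrary, congruences act
   transitively on the boundary of L; they fix its circumcentre, so L is a ball. *)
Require Import Defs.
From HB Require Import structures.
From mathcomp Require Import all_boot all_order all_algebra.
From mathcomp Require Import all_classical all_reals all_analysis.
From mathcomp Require Import ring lra.

Set Implicit Arguments.
Unset Strict Implicit.
Unset Printing Implicit Defensive.

Import Order.TTheory GRing.Theory Num.Theory.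
Import numFieldNormedType.Exports.

Local Open Scope classical_set_scope.
Local Open Scope ring_scope.

(** The symmetry hypotheses only see the hull, and near an end of its diameter the hull may exceed
    the body touching there; this is why smoothness has to come first. One smooth point always
    exists: the non-interior point nearest to a given interior point. Supporting spheres give the
    rest. Balls (of radius below pi/2 on the sphere) are strictly convex, hence so are the bodies;
    and a supporting ball placed inside a larger ball tangent to it touches that ball in one point,
    so the ends of the diameter are exactly the images of x and y. The sets D(eps) lose nothing near
    these ends, because M lies on the inner side of both end hyperplanes. In normalised position the
    symmetry S is the same matrix for all placements, so a placement of K and one of L combine
    through S into one congruence H. At a limit of agreement points H is already fixed, so the
    placement of K there is prescribed and must be shown to be tight; this is where the two normals
    have to correspond. S may reverse orientation, but the prescribed placement contains it twice.
    Dimension at least 2 makes the boundary connected and leaves a direction transverse to the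
    axis. *)

Lemma sum_continuous (R : realType) (T : topologicalType) (W : normedModType R)
    (I : Type) (r : seq I) (F : I -> T -> W) :
  (forall i, continuous (F i)) -> continuous (fun x => \sum_(i <- r) F i x).
Proof.
move=> cF; elim: r => [|i r IHr] x.
  by under eq_fun do rewrite big_nil; exact: cvg_cst.
by under eq_fun do rewrite big_cons; apply: cvgD; [exact: cF|exact: IHr].
Qed.

(** * Dot products and topology of row vectors *)

Section Dot.
Context {R : realType} {n : nat}.
Implicit Types u v w : 'rV[R]_n.

Lemma dotC u v : dot u v = dot v u.
Proof. by apply: eq_bigr => i _; rewrite mulrC. Qed.

Lemma dotDr u v w : dot u (v + w) = dot u v + dot u w.
Proof. by rewrite -big_split; apply: eq_bigr => i _; rewrite mxE mulrDr. Qed.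

Lemma dotZr a u v : dot u (a *: v) = a * dot u v.
Proof. by rewrite mulr_sumr; apply: eq_bigr => i _; rewrite mxE mulrCA. Qed.

Lemma dotDl u v w : dot (v + w) u = dot v u + dot w u.
Proof. by rewrite ![dot _ u]dotC dotDr. Qed.

Lemma dotZl a u v : dot (a *: v) u = a * dot v u.
Proof. by rewrite ![dot _ u]dotC dotZr. Qed.

Lemma dotNr u v : dot u (- v) = - dot u v.
Proof. by rewrite -scaleN1r dotZr mulN1r. Qed.

Lemma dotNl u v : dot (- v) u = - dot v u.
Proof. by rewrite dotC dotNr dotC. Qed.

Lemma dot0r u : dot u 0 = 0.
Proof. by rewrite -(scale0r 0) dotZr mul0r. Qed.

Lemma dot0l u : dot 0 u = 0.
Proof. by rewrite dotC dot0r. Qed.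

Definition dotE := (dotDl, dotDr, dotNl, dotNr, dotZl, dotZr, dot0l, dot0r).

Lemma dot_ge0 u : 0 <= dot u u.
Proof. by apply: sumr_ge0 => i _; rewrite -expr2 sqr_ge0. Qed.

Lemma dot_eq0 u : dot u u = 0 -> u = 0.
Proof.
move=> /eqP; rewrite psumr_eq0 => [/allP u0|i _]; last by rewrite -expr2 sqr_ge0.
apply/rowP => i; rewrite mxE; apply/eqP.
by have := u0 i (mem_index_enum _); rewrite -expr2 sqrf_eq0.
Qed.

Lemma dot_gt0 u : u != 0 -> 0 < dot u u.
Proof. by move=> u0; rewrite lt_def dot_ge0 andbT; apply: contra u0 => /eqP/dot_eq0 ->. Qed.

Lemma dot_delta u i : dot u (delta_mx 0 i) = u 0 i.
Proof.
rewrite /dot (bigD1 i) //= big1 ?addr0 => [|j ji]; rewrite mxE eqxx ?eqxx ?mulr1//=.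
by rewrite (negPf ji) mulr0.
Qed.

Lemma dot_mulmx u v (F : 'M[R]_n) : dot u (v *m F) = dot (u *m F^T) v.
Proof.
have dotm x y : dot x y = (x *m y^T) 0 0.
  by rewrite mxE; apply: eq_bigr => i _; rewrite mxE.
by rewrite !dotm trmx_mul mulmxA.
Qed.

Lemma dot_CS u v : dot u v ^+ 2 <= dot u u * dot v v.
Proof.
have [->|/dot_gt0 v0] := eqVneq v 0; first by rewrite !dotE expr0n mulr0.
have := dot_ge0 (dot v v *: u - dot u v *: v); rewrite !dotE (dotC v u) => H.
rewrite -subr_ge0 -(pmulr_rge0 _ v0); apply: le_trans H _.
by rewrite le_eqVlt; apply/orP; left; apply/eqP; ring.
Qed.

Lemma dot_continuous u : continuous (dot u).
Proof.
apply: (@sum_continuous R _ R^o _ _ (fun i v => u 0 i * v 0 i)) => i v.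
by apply: continuousM; [exact: cst_continuous|exact: coord_continuous].
Qed.

Lemma dotxx_continuous : continuous (fun u => dot u u).
Proof.
apply: (@sum_continuous R _ R^o _ _ (fun i v => v 0 i * v 0 i)) => i v.
by apply: continuousM; exact: coord_continuous.
Qed.

Lemma exists_orthogonal u v : (3 <= n)%N ->
  exists2 w, w != 0 & dot u w = 0 /\ dot v w = 0.
Proof.
move=> n3; set A := col_mx u v.
have /rowV0Pn[w /sub_kermxP wA w0] : kermx A^T != 0.
  rewrite -mxrank_eq0 mxrank_ker mxrank_tr -lt0n subn_gt0.
  by apply: leq_ltn_trans n3; rewrite (leq_trans (rank_leq_row _)).
exists w => //.
have dotm x : (w *m x^T) 0 0 = dot x w.
  by rewrite mxE; apply: eq_bigr => i _; rewrite mxE mulrC.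
rewrite -!dotm; move: wA; rewrite tr_col_mx mul_mx_row -row_mx0.
by move=> /eq_row_mx[-> ->]; rewrite mxE.
Qed.

End Dot.

Section Continuity.
Context {R : realType} {n : nat}.
Local Notation V := 'rV[R]_n.
Implicit Types u v w : V.

Lemma mulmx_continuous (F : 'M[R]_n) : continuous (fun w : V => w *m F).
Proof.
have -> : (fun w : V => w *m F) = (fun w => \sum_i w 0 i *: row i F).
  by apply/funext => w; rewrite mulmx_sum_row.
apply: (@sum_continuous R _ 'rV[R]_n _ _ (fun i w => w 0 i *: row i F)) => i w.
apply: (@continuousZr_tmp R _ _ (fun w : V => w 0 i) (row i F)).
exact: coord_continuous.
Qed.

Lemma near_comp (T U : topologicalType) (f : T -> U) x (P : set U) :
  {for x, continuous f} -> (\forall y \near f x, P y) -> \forall y \near x, P (f y).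
Proof. by move=> cf Pf; exact: cf. Qed.

Lemma near_pos (T : topologicalType) (f : T -> R) x :
  {for x, continuous f} -> 0 < f x -> \forall y \near x, 0 < f y.
Proof.
by move=> cf f0; apply: (cf [set t | 0 < t]); exact: lt_nbhsr.
Qed.

Lemma nearP w (P : set V) :
  (\forall v \near w, P v) <-> exists2 e : R, 0 < e & forall v : V, `|v - w| < e -> P v.
Proof.
split=> [/nbhs_ballP[e e0 eP]|[e e0 eP]].
  by exists e => // v vw; apply: eP; rewrite mx_norm_ball /ball_ /= distrC.
apply/nbhs_ballP; exists e => // v; rewrite mx_norm_ball /ball_ /= distrC.
exact: eP.
Qed.

Lemma near_line w z (P : set V) : (\forall v \near w, P v) ->
  exists2 e : R, 0 < e & forall t : R, `|t| < e -> P (w + t *: z).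
Proof.
move=> /nearP[e e0 eP]; exists (e / (1 + `|z|)) => [|t te].
  by rewrite divr_gt0// ltr_wpDr.
apply: eP; rewrite addrAC subrr add0r normrZ.
have z1 : 0 < 1 + `|z| by rewrite ltr_wpDr.
apply: le_lt_trans (_ : `|t| * (1 + `|z|) < e).
  by rewrite ler_wpM2l// lerDr.
by rewrite -ltr_pdivlMr.
Qed.

Lemma near_mulmx (F : 'M[R]_n) w (P : set V) :
  (\forall v \near w *m F, P v) -> \forall v \near w, P (v *m F).
Proof. exact: (@mulmx_continuous F w P). Qed.

Lemma sphere_compact : compact [set u : V | dot u u = 1].
Proof.
apply: bounded_closed_compact; last first.
  have -> : [set u : V | dot u u = 1] = (fun u => dot u u) @^-1` [set x | x = 1] by [].
  by apply: preimage_closed; [move=> ? _; exact: dotxx_continuous|exact: closed_eq].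
exists 1; split=> // x x1 u /= u1; apply: le_trans (ltW x1).
rewrite -[`|u|]/(mx_norm u) mx_normrE.
apply/bigmax_leP; split => //= -[i j] _ /=; rewrite ord1.
rewrite -(@expr_le1 _ 2)// real_normK ?num_real// -u1 /dot (bigD1 j)//= expr2 lerDl.
by apply: sumr_ge0 => k _; rewrite -expr2 sqr_ge0.
Qed.

Lemma cluster_point (A : set V) (f : nat -> V) : compact A -> (forall k, A (f k)) ->
  exists2 u, A u & forall P : set V, (\forall v \near u, P v) ->
    forall m, exists2 k, (m <= k)%N & P (f k).
Proof.
move=> cA fA; have [|u [Au cu]] := cA (f @ \oo) _.
  by exists 0%N => // k _; exact: fA.
exists u => // P Pu m.
have [|_ [[k mk <-] Pk]] := cu (f @` [set k | (m <= k)%N]) P _ Pu; last by exists k.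
by exists m => // k mk; exists k.
Qed.

End Continuity.

(** * Convex cones and their germs *)

Section Cones.
Context {R : realType} {n : nat}.
Local Notation V := 'rV[R]_n.
Implicit Types (A B C D : set V) (e h p q u v w z : V).

Definition inner C w : Prop := \forall v \near w, C v.

Definition frontier C w : Prop := C w /\ ~ inner C w.

(* Convex cones with compact base and interior points; the apex is excluded. *)
Record good_cone C : Prop := GoodCone {
  cone_add : forall v w, C v -> C w -> C (v + w);
  cone_scale : forall a w, 0 < a -> C w -> C (a *: w);
  cone_base : exists (L : set V) (h : V),
    [/\ compact L, forall l, L l -> 0 < dot h l
      & forall w, C w <-> exists a l, [/\ 0 < a, L l & w = a *: l]];
  cone_inner : exists c, inner C c }.

(** [m] is the outer normal at [p]: every direction strictly inside the tangent half-space enters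
    the interior. This form compares directly with nearby points of another cone; uniqueness of the
    supporting form is derived from it. *)
Definition smooth_at C p : Prop :=
  exists2 m : V, m != 0 &
    forall z, dot m z < 0 -> exists2 t, 0 < t & inner C (p + t *: z).

Definition supports e C q : Prop :=
  [/\ e != 0, dot e q = 0 & forall w, C w -> dot e w <= 0].

Lemma innerW C w : inner C w -> C w.
Proof. exact: nbhs_singleton. Qed.

Lemma inner_inner C w : inner C w -> \forall v \near w, inner C v.
Proof. by move=> Cw; exact: (nbhs_interior Cw). Qed.

Lemma inner_scale C a w : good_cone C -> 0 < a -> inner C w -> inner C (a *: w).
Proof.
move=> gC a0 Cw; have ca : {for a *: w, continuous (fun v : V => a^-1 *: v)}.
  by apply: scaler_continuous.
have : \forall v \near a *: w, C (a^-1 *: v).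
  by apply: (near_comp ca); rewrite scalerA mulVf ?gt_eqF// scale1r.
apply: filterS => v /(cone_scale gC a0).
by rewrite scalerA mulfV ?gt_eqF// scale1r.
Qed.

Lemma inner_add C c w : good_cone C -> inner C c -> C w -> inner C (c + w).
Proof.
move=> gC Cc Cw; have ca : {for c + w, continuous (fun v : V => v - w)}.
  by apply: continuousB; [exact: cvg_id|exact: cst_continuous].
have : \forall v \near c + w, C (v - w) by apply: (near_comp ca); rewrite addrK.
by apply: filterS => v Cv; rewrite -(subrK w v); exact: cone_add.
Qed.

Lemma cone_pos C : good_cone C -> exists h, forall w, C w -> 0 < dot h w.
Proof.
move=> gC; have [L [h [_ hL LC]]] := cone_base gC; exists h => w /LC[a [l [a0 Ll ->]]].
by rewrite dotZr mulr_gt0// hL.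
Qed.

Lemma cone_neq0 C w : good_cone C -> C w -> w != 0.
Proof.
move=> /cone_pos[h hC] /hC; apply: contraTneq => ->.
by rewrite dot0r ltxx.
Qed.

Lemma cone_opp C w : good_cone C -> C w -> ~ C (- w).
Proof.
move=> /cone_pos[h hC] /hC hw /hC; rewrite dotNr => ?; lra.
Qed.

(** The cone is closed away from its apex. Rescaling by [dot h] sends the base to a compact slice,
    which settles the points with [0 < dot h w]. On the cone the norm is at most a constant times
    [dot h], and near a nonzero [w] with [dot h w <= 0] this bound fails. *)
Lemma cone_closed C w : good_cone C -> w != 0 -> ~ C w -> \forall v \near w, ~ C v.
Proof.
move=> gC w0 nCw; have [L [h [cL hL LC]]] := cone_base gC.
pose f l := (dot h l)^-1 *: l.
have cf l : dot h l != 0 -> {for l, continuous f}.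
  move=> hl; apply: (@continuousZ R _ _ (fun x : V => (dot h x)^-1) id).
    by apply: continuousV => //; exact: dot_continuous.
  exact: cvg_id.
have cfL : compact (f @` L).
  apply: continuous_compact => //; apply: continuous_in_subspaceT => l.
  by rewrite inE => /hL hl; apply: cf; rewrite gt_eqF.
have fC v : C v -> 0 < dot h v /\ (f @` L) (f v).
  move=> /LC[a [l [a0 Ll ->]]]; have hl := hL _ Ll.
  rewrite dotZr mulr_gt0//; split => //; exists l => //.
  rewrite /f dotZr scalerA; congr (_ *: _); field.
  by rewrite !gt_eqF.
have [hw|hw] := ltP 0 (dot h w).
  have nfw : ~ (f @` L) (f w).
    move=> [l Ll]; have hl := hL _ Ll => fl; apply: nCw; apply/LC.
    exists (dot h w / dot h l), l; rewrite divr_gt0//; split => //.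
    by rewrite -scalerA -/(f l) fl scalerA mulfV ?gt_eqF// scale1r.
  have cl : closed (f @` L) by apply: compact_closed => //; exact: norm_hausdorff.
  have : \forall v \near w, ~ (f @` L) (f v).
    have hw0 : dot h w != 0 by rewrite gt_eqF.
    apply: (@near_comp _ _ f w (~` (f @` L)) (cf w hw0)).
    apply: open_nbhs_nbhs; split => //.
    exact: closed_openC.
  by apply: filterS => v nfv /fC[].
have [M [_ fM]] := compact_bounded cfL.
have {}fM v : C v -> `|v| <= (`|M| + 1) * dot h v.
  move=> /fC[hv fv].
  have /fM/(_ _ fv) : M < `|M| + 1 by rewrite ltr_pwDr// ler_norm.
  by rewrite /= /f normrZ normfV (gtr0_norm hv) mulrC ler_pdivrMr.
have : \forall v \near w, 0 < `|v| - (`|M| + 1) * dot h v.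
  apply: (@near_pos R V (fun v => `|v| - (`|M| + 1) * dot h v)).
    apply: continuousB; first exact: norm_continuous.
    by apply: continuousM; [exact: cst_continuous|exact: dot_continuous].
  rewrite subr_gt0; apply: le_lt_trans (_ : 0 < _); last by rewrite normr_gt0.
  by rewrite mulr_ge0_le0// addr_ge0.
by apply: filterS => v + /fM; lra.
Qed.

Lemma cone_limit C w : good_cone C -> w != 0 ->
  (forall P : set V, (\forall v \near w, P v) -> exists2 v, P v & C v) -> C w.
Proof.
move=> gC w0 H; apply: contrapT => /(cone_closed gC w0)/H[v]; exact.
Qed.

(* As the cone has interior points, a linear form that is nonpositive on a
   smooth cone and vanishes at the smooth point is a positive multiple of the
   form witnessing smoothness. *)
Lemma smooth_supports_unique C q m e : m != 0 ->
  (forall z, dot m z < 0 -> exists2 t, 0 < t & inner C (q + t *: z)) ->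
  supports e C q -> exists2 a, 0 < a & e = a *: m.
Proof.
move=> m0 sm [e0 eq eC].
have le0 z : dot m z < 0 -> dot e z <= 0.
  move=> /sm[t t0 /innerW/eC]; rewrite dotDr eq add0r dotZr.
  by rewrite pmulr_rle0.
have mm := dot_gt0 m0; have ee := dot_gt0 e0.
have le0' z : dot m z = 0 -> dot e z <= 0.
  move=> mz; rewrite leNgt; apply/negP => ez.
  pose x := dot e z / (1 + `|dot e m|).
  have d0 : 0 < 1 + `|dot e m| by rewrite ltr_wpDr.
  have x0 : 0 < x by rewrite divr_gt0.
  have := le0 (z - x *: m); rewrite !dotE mz sub0r oppr_lt0 mulr_gt0// => /(_ isT).
  have : x * dot e m < dot e z.
    rewrite -ltr_pdivlMl// /x invfM mulrAC mulVf ?gt_eqF// mul1r invrK.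
    by rewrite (le_lt_trans (ler_norm _))// ltrDr.
  lra.
have e0' z : dot m z = 0 -> dot e z = 0.
  move=> mz; apply: le_anti; rewrite le0'//=.
  by have := le0' (- z); rewrite !dotE mz oppr0 oppr_le0 => /(_ erefl).
pose a := dot e m / dot m m.
have ea : e = a *: m.
  apply/eqP; rewrite -subr_eq0; apply/eqP/dot_eq0.
  have mz : dot m (e - a *: m) = 0.
    by rewrite !dotE /a dotC; field; rewrite gt_eqF.
  by rewrite {1}dotDl dotNl dotZl e0'// mz mulr0 subrr.
exists a => //; rewrite lt_def; apply/andP; split.
  by apply: contra_neq e0 => a0; rewrite ea a0 scale0r.
have := le0 (- m); rewrite dotNr oppr_lt0 mm dotNr oppr_le0 => /(_ isT) em.
by rewrite divr_ge0// ltW.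
Qed.

(** Take a non-interior point [w0] nearest to an interior point [c]. The open ball about [c] through
    [w0] lies in the interior, and an inscribed ball forces smoothness at [w0] with normal [w0 - c].
    The nearest point could be the apex; that is where [n] at least 2 is used. *)
Lemma exists_smooth C : (2 <= n)%N -> good_cone C ->
  exists2 w, frontier C w & smooth_at C w.
Proof.
move=> n2 gC; have [c Cc] := cone_inner gC; have [h hC] := cone_pos gC.
have c0 : c != 0 by apply: (cone_neq0 gC); exact: innerW.
pose f w := dot (w - c) (w - c).
have cf : continuous f.
  move=> w; apply: (@continuous_comp _ _ _ (fun w : V => w - c) (fun u => dot u u)).
    by apply: continuousB; [exact: cvg_id|exact: cst_continuous].
  exact: dotxx_continuous.
pose D := [set w | ~ inner C w /\ f w <= dot c c].
have D0 : D !=set0.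
  exists 0; split; first by move=> /innerW/(cone_neq0 gC); rewrite eqxx.
  by rewrite /f sub0r dotNl dotNr opprK.
have cD : compact D.
  apply: bounded_closed_compact.
    exists (1 + dot c c + `|c|); split; first exact: num_real.
    move=> x xM w [_ wc]; apply: le_trans (ltW xM).
    rewrite -(subrK c w); apply: le_trans (ler_normD _ _) _; rewrite lerD2r.
    rewrite -[`|w - c|]/(mx_norm (w - c)) mx_normrE.
    apply/bigmax_leP; split => [|[i j] _] /=; first by rewrite addr_ge0// dot_ge0.
    rewrite ord1; set x1 := (w - c) 0 j.
    have : x1 ^+ 2 <= dot c c.
      apply: le_trans wc; rewrite /f /dot (bigD1 j)//= expr2 lerDl.
      by apply: sumr_ge0 => k _; rewrite -expr2 sqr_ge0.
    have := dot_ge0 c; have := sqr_ge0 (`|x1| - 1).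
    rewrite sqrrB real_normK ?num_real//= mulr1 expr1n; lra.
  apply: closedI.
    apply: (@open_closedC _ [set w | inner C w]).
    exact: open_interior.
  have -> : (fun w => f w <= dot c c : Prop) = f @^-1` [set x | x <= dot c c] by [].
  by apply: preimage_closed; [move=> ? _; exact: cf|exact: closed_le].
have [w0] := EVT_min_rV D0 cD (continuous_subspaceT cf).
rewrite inE => -[nw0 w0c] w0min.
have ballC w : f w < f w0 -> inner C w.
  move=> ww; apply: contrapT => nw.
  have : w \in D by rewrite inE; split => //; rewrite (le_trans (ltW ww)).
  by move=> /w0min; rewrite leNgt ww.
(* If the apex were nearest, the ball about [c] of radius |c| would lie in the cone, hence so would
   the half-space [0 < dot c w], and by closedness both [e] and [- e] for some [e] orthogonal to
   [c]. *)
have w0N0 : w0 != 0.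
  apply/negP => /eqP w00.
  have pos w : 0 < dot c w -> C w.
    (* [t *: w] is the foot of the perpendicular from [c], at squared distance less than
       [dot c c]. *)
    move=> cw; pose t := dot c w / dot w w.
    have w_neq0 : w != 0 by apply: contraTneq cw => ->; rewrite dot0r ltxx.
    have ww := dot_gt0 w_neq0.
    have t0 : 0 < t by rewrite divr_gt0.
    have : inner C (t *: w).
      apply: ballC; rewrite w00 /f sub0r !dotE opprK.
      have -> : t * (t * dot w w) = t * dot c w by rewrite /t; field; rewrite gt_eqF.
      by rewrite (dotC w c); have := mulr_gt0 t0 cw; lra.
    move=> /innerW/(cone_scale gC (_ : 0 < t^-1)); rewrite invr_gt0 => /(_ t0).
    by rewrite scalerA mulVf ?gt_eqF// scale1r.
  have [e e0 ce] : exists2 e : V, e != 0 & dot c e = 0.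
    have /rowV0Pn[e /sub_kermxP ec e0] : kermx c^T != 0.
      rewrite -mxrank_eq0 mxrank_ker mxrank_tr -lt0n subn_gt0.
      by apply: leq_ltn_trans n2; exact: rank_leq_row.
    exists e => //; have -> : dot c e = (e *m c^T) 0 0.
      by rewrite mxE; apply: eq_bigr => i _; rewrite mxE mulrC.
    by rewrite ec mxE.
  have Cpm x : x != 0 -> dot c x = 0 -> C x.
    move=> x0 cx; apply: (cone_limit gC x0) => P /(near_line c)[d d0 dP].
    exists (x + (d / 2) *: c).
      by apply: dP; rewrite gtr0_norm ?divr_gt0//; lra.
    by apply: pos; rewrite !dotE cx add0r mulr_gt0 ?divr_gt0// dot_gt0.
  apply: (@cone_opp C e) => //; apply: Cpm => //; first by rewrite oppr_eq0.
  by rewrite dotNr ce oppr0.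
have w0Nc : w0 - c != 0.
  by rewrite subr_eq0; apply: contra_not_neq nw0 => ->.
have Cw0 : C w0.
  apply: (cone_limit gC w0N0) => P /(near_line (c - w0))[d d0 dP].
  pose t := Num.min (d / 2) (1 / 2).
  have t0 : 0 < t by rewrite lt_min; lra.
  have t1 : t <= 1 / 2 by rewrite ge_min lexx orbT.
  have td : t <= d / 2 by rewrite ge_min lexx.
  exists (w0 + t *: (c - w0)); first by apply: dP; rewrite gtr0_norm//; lra.
  apply: innerW; apply: ballC; rewrite /f.
  have -> : w0 + t *: (c - w0) - c = (1 - t) *: (w0 - c).
    by apply/rowP => i; rewrite !mxE; ring.
  rewrite dotZl dotZr mulrA -[ltRHS]mul1r ltr_pM2r ?dot_gt0//; nra.
exists w0 => //; exists (w0 - c) => // z mz.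
have z0 : z != 0 by apply: contraTneq mz => ->; rewrite dot0r ltxx.
have zz := dot_gt0 z0.
have [m mE] : exists m, m = w0 - c by exists (w0 - c).
rewrite -mE in mz w0Nc *.
(* This [t] minimises the distance from [w0 + t *: z] to [c]. *)
pose t := - dot m z / dot z z.
have t0 : 0 < t by rewrite divr_gt0// oppr_gt0.
exists t => //; apply: ballC; rewrite /f -mE.
have -> : w0 + t *: z - c = m + t *: z by rewrite mE addrAC.
rewrite !dotE (dotC z).
have -> : t * (t * dot z z) = - t * dot m z.
  by rewrite /t; field; rewrite gt_eqF.
have : t * dot m z < 0 by rewrite pmulr_rlt0.
lra.
Qed.

End Cones.

(** * Germs of joins of cones and inclusion of cones *)

Section ConeGerms.
Context {R : realType} {n : nat}.
Local Notation V := 'rV[R]_n.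
Implicit Types (A B C D : set V) (e h p q u v w z : V).

(** The sum of two cones; as the apex is excluded, [A] and [B] themselves have to be added to the
    set of sums. *)
Definition join A B : set V :=
  [set w | [\/ A w, B w | exists a b, [/\ A a, B b & w = a + b]]].

Lemma join_sym A B : join A B = join B A.
Proof.
apply/seteqP; split => w [?|?|[a [b [? ? ->]]]];
  by [constructor 2|constructor 1|constructor 3; exists b, a; rewrite addrC].
Qed.

(** By smoothness, moving from near [p] in any direction of the base of [B] stays in [A], and
    compactness of the base gives one step length [s] for all of them. A sum [w] near [p] has
    [dot e w] near 0, while [dot e] is bounded away from 0 on the base, so the [B]-part of [w] is
    short and [w] lies between [k] and [k + s *: l]. *)
Lemma join_germ_smooth A B p e : good_cone A -> good_cone B -> A p ->
  smooth_at A p -> supports e A p -> (forall w, B w -> dot e w < 0) ->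
  \forall w \near p, join A B w -> A w.
Proof.
move=> gA gB Ap [m m0 sm] eA eB; have [_ ep eAle] := eA.
have [r r0 em] := smooth_supports_unique m0 sm eA.
have [L [h [cL hL LB]]] := cone_base gB.
have LsubB l : L l -> B l.
  by move=> Ll; apply/LB; exists 1, l; rewrite scale1r.
have [s s0 sP] : exists2 s : R, 0 < s & forall l, L l ->
    forall k, `|k - p| < s -> A k -> A (k + s *: l).
  apply: contrapT => nE.
  have bad (j : nat) : exists l : V, L l /\ exists k : V,
      [/\ `|k - p| < j.+1%:R^-1, A k & ~ A (k + j.+1%:R^-1 *: l)].
    apply: contrapT => nj; apply: nE; exists j.+1%:R^-1; first by rewrite invr_gt0.
    by move=> l Ll k kp Ak; apply: contrapT => nA; apply: nj; exists l; split => //; exists k.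
  have [f fP] := choice bad.
  have [l Ll lP] := cluster_point cL (fun j => (fP j).1).
  have [t t0 /nearP[d d0 dA]] : exists2 t, 0 < t & inner A (p + t *: l).
    apply: sm; have := eB _ (LsubB _ Ll); rewrite em dotZl.
    by rewrite pmulr_rlt0.
  have [N Nd] : exists N : nat, forall j, (N <= j)%N -> j.+1%:R^-1 < Num.min (d / 2) t.
    have x0 : 0 < Num.min (d / 2) t by rewrite lt_min t0 divr_gt0.
    exists (Num.truncn (Num.min (d / 2) t)^-1) => j Nj.
    rewrite -[ltRHS]invrK ltf_pV2 ?posrE ?invr_gt0//.
    apply: lt_le_trans (truncnS_gt _) _.
    by rewrite ler_nat.
  have nl : \forall v \near l, `|v - l| < d / (2 * t).
    by apply/nearP; exists (d / (2 * t)); rewrite ?divr_gt0// mulr_gt0.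
  have [j /Nd + jl] := lP _ nl N.
  have [Lf [k [kp Ak]]] := fP j.
  set x := j.+1%:R^-1 in kp *; have x0 : 0 < x by rewrite invr_gt0.
  rewrite lt_min => nA /andP[xd xt]; apply: nA.
  have Akt : A (k + t *: f j).
    apply: dA.
    have -> : k + t *: f j - (p + t *: l) = (k - p) + t *: (f j - l).
      by apply/rowP => i; rewrite !mxE; ring.
    apply: le_lt_trans (ler_normD _ _) _; rewrite normrZ gtr0_norm//.
    have : t * `|f j - l| < d / 2.
      by rewrite -ltr_pdivlMl// mulrC -mulrA -invfM.
    lra.
  have -> : k + x *: f j = (1 - x / t) *: k + (x / t) *: (k + t *: f j).
    apply/rowP => i; rewrite !mxE; field; exact: lt0r_neq0.
  apply: cone_add => //; apply: cone_scale => //; last by rewrite divr_gt0.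
  by rewrite subr_gt0 ltr_pdivrMr// mul1r.
have [c Bc] := cone_inner gB; have /LB[_ [l1 [_ Ll1 _]]] := innerW Bc.
have [dl dl0 dlP] : exists2 dl, 0 < dl & forall l, L l -> dot e l <= - dl.
  have [||l Ll lmax] := @EVT_max_rV R n (dot e) L _ cL; first by exists l1.
    by apply: continuous_subspaceT; exact: dot_continuous.
  exists (- dot e l); first by rewrite oppr_gt0; apply/eB/LsubB; rewrite inE in Ll.
  by move=> l' Ll'; rewrite opprK; apply: lmax; rewrite inE.
have [M [_ LM]] := compact_bounded cL.
pose M' := `|M| + 1; have M'0 : 0 < M' by rewrite ltr_wpDl.
have {}LM l : L l -> `|l| <= M'.
  by move=> Ll; apply: (LM M') => //; rewrite ltr_pwDr// ler_norm.
have p0 : 0 < `|p| by rewrite normr_gt0 (cone_neq0 gA).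
pose s' := Num.min s `|p|; have s'0 : 0 < s' by rewrite lt_min s0.
(* With a coefficient [a < r1] the vector [a *: l] is shorter than [s' / 2], and [a] is below the
   step length [s]. *)
pose r1 := s' / (2 * M' + 2).
have r10 : 0 < r1 by rewrite divr_gt0//; lra.
have : \forall w \near p, 0 < dot e w + dl * r1.
  apply: (@near_pos R V (fun w => dot e w + dl * r1)).
    by apply: continuousD; [exact: dot_continuous|exact: cst_continuous].
  by rewrite ep add0r mulr_gt0.
have : \forall w \near p, `|w - p| < s' / 2.
  by apply/nearP; exists (s' / 2) => //; rewrite divr_gt0.
apply: filterS2 => w wp ew.
have key a l : 0 < a -> L l -> dot e w <= a * dot e l ->
    `|a *: l| < s' / 2 /\ a < s.
  move=> a0 Ll ewl.
  have ar : a < r1.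
    have := ler_wpM2l (ltW a0) (dlP _ Ll); nra.
  have rs : r1 * (2 * M' + 2) = s' by rewrite /r1 divfK// gt_eqF//; lra.
  have s's : s' <= s by rewrite ge_min lexx.
  rewrite normrZ gtr0_norm//; split; last nra.
  have := ler_wpM2l (ltW a0) (LM _ Ll); nra.
move=> [//|/LB[a [l [a0 Ll we]]]|[k [b [Ak /LB[a [l [a0 Ll be]]] we]]]].
  have [|lt1 _] := key a l a0 Ll; first by rewrite we dotZr.
  have : `|p| <= `|w - p| + `|a *: l|.
    by rewrite -we; have := ler_normB w (w - p); rewrite subKr addrC.
  have : s' <= `|p| by rewrite ge_min lexx orbT.
  lra.
have [|lt1 as_] := key a l a0 Ll.
  by rewrite we be dotDr dotZr gerDr eAle.
have Ak' : A (k + s *: l).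
  apply: sP => //; have -> : k - p = (w - p) - a *: l.
    by rewrite we be; apply/rowP => i; rewrite !mxE; ring.
  apply: le_lt_trans (ler_normB _ _) _.
  have : s' <= s by rewrite ge_min lexx.
  lra.
rewrite we be; have -> : k + a *: l = (1 - a / s) *: k + (a / s) *: (k + s *: l).
  apply/rowP => i; rewrite !mxE; field; exact: lt0r_neq0.
apply: cone_add => //; apply: cone_scale => //; last by rewrite divr_gt0.
by rewrite subr_gt0 ltr_pdivrMr// mul1r.
Qed.

(** The last parameter, as a supremum, at which the segment is in [D]. Closedness is asked along the
    segment only: cones are closed away from the apex, and the lemma also serves sets not yet known
    to be bounded. *)
Lemma exit_point (D : set V) c z : D c -> ~ D z -> let f t : V := c + t *: (z - c) in
  (forall t, 0 <= t -> t <= 1 ->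
     (forall Q : set V, (\forall v \near f t, Q v) -> exists2 v, Q v & D v) -> D (f t)) ->
  exists s : R, [/\ 0 <= s, s < 1, D (f s) & forall Q : set V, (\forall v \near f s, Q v) ->
    exists t : R, [/\ s < t, t <= 1, Q (f t) & ~ D (f t)]].
Proof.
move=> Dc nDz f cl; pose T := [set t | [/\ 0 <= t, t <= 1 & D (f t)]].
have T0 : T 0 by split => //; rewrite /f scale0r addr0.
have Tub : has_ubound T by exists 1 => t [].
have Tsup : has_sup T by split => //; exists 0.
set s := sup T.
have s0 : 0 <= s by apply: ub_le_sup.
have s1 : s <= 1 by apply: ge_sup; [exists 0|move=> t []].
have fE t : f t = f s + (t - s) *: (z - c).
  by apply/rowP => i; rewrite !mxE; ring.
have Df : D (f s).
  apply: cl => // P /(near_line (z - c))[d d0 dP].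
  have [t [t0 t1 Dft]] := sup_adherent d0 Tsup; rewrite -/s => st.
  exists (f t) => //; rewrite fE; apply: dP.
  have ts : t <= s by apply: ub_le_sup.
  by rewrite ler0_norm ?subr_le0//; lra.
have s1' : s < 1.
  rewrite lt_neqAle s1 andbT; apply/eqP => s1'; apply: nDz.
  by move: Df; rewrite s1' /f scale1r addrC subrK.
exists s; split => // Q /(near_line (z - c))[d d0 dQ].
pose x := Num.min (d / 2) (1 - s).
have x0 : 0 < x by rewrite lt_min divr_gt0//= subr_gt0.
have xd : x <= d / 2 by rewrite ge_min lexx.
have xs : x <= 1 - s by rewrite ge_min lexx orbT.
have t1 : s + x <= 1 by lra.
exists (s + x); split => //; first by rewrite ltrDl.
  by rewrite fE; apply: dQ; rewrite addrAC subrr add0r gtr0_norm//; lra.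
move=> Dx; have : T (s + x) by split => //; lra.
by move=> /(ub_le_sup Tub); rewrite -/s; lra.
Qed.

(** On the segment from [c] to a point of [C] off [D], the last point in [D] is on the frontier of
    [D]; there the local inclusion forbids leaving [D] while staying in [C]. *)
Lemma cone_incl C D c : good_cone C -> good_cone D -> C c -> D c ->
  (forall w, frontier D w -> C w -> \forall v \near w, C v -> D v) -> C `<=` D.
Proof.
move=> gC gD Cc Dc CD z Cz; apply: contrapT => nDz.
have Cf t : 0 <= t -> t <= 1 -> C (c + t *: (z - c)).
  rewrite le_eqVlt => /predU1P[<- _|t0]; first by rewrite scale0r addr0.
  rewrite le_eqVlt => /predU1P[->|t1]; first by rewrite scale1r addrC subrK.
  have -> : c + t *: (z - c) = (1 - t) *: c + t *: z by apply/rowP => i; rewrite !mxE; ring.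
  by apply: cone_add => //; apply: cone_scale; rewrite ?subr_gt0.
have [t t0 t1 lim|s [s0 s1 Ds ex]] := exit_point Dc nDz.
  by apply: cone_limit lim => //; apply: (cone_neq0 gC); exact: Cf.
have fD : frontier D (c + s *: (z - c)).
  by split => // /ex[t [_ _ Dt]]; apply.
have [t [st t1 CDt nDt]] := ex _ (CD _ fD (Cf _ s0 (ltW s1))).
by apply/nDt/CDt/Cf => //; exact: le_trans s0 (ltW st).
Qed.

End ConeGerms.

Section ConeGerms2.
Context {R : realType} {n : nat}.
Local Notation V := 'rV[R]_n.
Implicit Types (A B C D : set V) (e h p q u v w z : V).

(** Strict convexity of the body read on its cone: a frontier vector splits only along its own
    ray. *)
Definition strict_cone A : Prop := forall v w, A v -> A w ->
  ~ inner A (v + w) -> exists a, v = a *: w.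

(* The points of [join A B] off [B] near [q] would be interior to segments with
   ends in [A]-like frontier germs; so the frontier of the join near [q] lies in
   [B], and horizontal chords recover the rest. *)
Lemma join_germ_strict A B q h g (F : 'M[R]_n) : good_cone A -> good_cone B ->
  strict_cone A -> q != 0 -> ~ A q -> F *m F = 1%:M ->
  (forall w, A w -> 0 < dot g w) -> (forall w, B w -> 0 < dot g w) ->
  (\forall w \near q, join A B w <-> A (w *m F)) ->
  h != 0 ->
  (forall d, 0 < d -> \forall z \near q,
     forall s : R, join A B z -> join A B (z + s *: h) -> `|s| <= d) ->
  \forall w \near q, join A B w -> B w.
Proof.
move=> gA gB sA q0 nAq FF gpA gpB /nearP[r1 r10 HJ] h0 Hh.
have /nearP[r2 r20 HnA] := cone_closed gA q0 nAq.
pose r := Num.min `|q| (Num.min r1 r2).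
have r0 : 0 < r by rewrite !lt_min normr_gt0 q0 r10.
have rq : r <= `|q| by rewrite ge_min lexx.
have rr1 : r <= r1 by rewrite !ge_min lexx orbT.
have rr2 : r <= r2 by rewrite !ge_min lexx !orbT.
have {HnA}nA w : `|w - q| < r -> ~ A w by move=> wq; apply: HnA; lra.
have {HJ}HJ w : `|w - q| < r -> (join A B w <-> A (w *m F)).
  by move=> wq; apply: HJ; lra.
have hn0 : 0 < `|h| by rewrite normr_gt0.
(* Chosen so that [z + s *: h] stays within [r] of [q] for [z] within [r / 4] and [s] up to
   [2 * d]. *)
pose d := r / (4 * `|h|).
have d0 : 0 < d by rewrite divr_gt0//; lra.
have dh : d * `|h| = r / 4 by rewrite /d; field; rewrite gt_eqF.
have : \forall w \near q, `|w - q| < r / 4.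
  by apply/nearP; exists (r / 4); rewrite ?divr_gt0.
have := Hh d d0; apply: filterS2 => z {}Hh zq Jz.
have claim (k : V) : k = h \/ k = - h -> exists2 s, 0 <= s & B (z + s *: k).
  move=> kh; have kn : `|k| = `|h| by case: kh => ->; rewrite ?normrN.
  have {}Hh s : join A B (z + s *: k) -> `|s| <= d.
    case: kh => -> => [|H]; first exact: Hh.
    by rewrite -normrN; apply: Hh => //; rewrite scaleNr -scalerN.
  pose f s : V := z + s *: k.
  have near_f s : `|s| <= 2 * d -> `|f s - q| < r.
    move=> sd; have -> : f s - q = (z - q) + s *: k by rewrite /f addrAC.
    apply: le_lt_trans (ler_normD _ _) _; rewrite normrZ kn.
    have := ler_wpM2r (ltW hn0) sd; lra.
  (* Chords have length at most [d], so the cap [2 * d] is never reached and the supremum is a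
     genuine exit from the join; its [F]-image is a frontier point of [A]. *)
  pose T := [set s | [/\ 0 <= s, s <= 2 * d & join A B (f s)]].
  have T0 : T 0 by split => //; [lra|rewrite /f scale0r addr0].
  have Tub : has_ubound T by exists (2 * d) => t [].
  have Tsup : has_sup T by split => //; exists 0.
  set s := sup T.
  have s0 : 0 <= s by apply: ub_le_sup.
  have sd : s <= d.
    apply: ge_sup; first by exists 0.
    by move=> t [t0 _ /Hh]; rewrite ger0_norm.
  have sd2 : `|s| <= 2 * d by rewrite ger0_norm//; lra.
  have fq := near_f _ sd2.
  have fE t : f t = f s + (t - s) *: k.
    by apply/rowP => i; rewrite !mxE; ring.
  have Finj w : w *m F = 0 -> w = 0.
    by move=> wF; rewrite -(mulmx1 w) -FF mulmxA wF mul0mx.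
  have fs0 : f s != 0.
    apply/eqP => fs0; move: fq; rewrite fs0 sub0r normrN; lra.
  have Gfs : A (f s *m F).
    have fsF0 : f s *m F != 0 by apply: contra_neq fs0; exact: Finj.
    apply: (cone_limit gA fsF0) => P PP.
    have : \forall v \near f s, P (v *m F).
      exact: near_mulmx.
    move=> /(near_line k)[x x0 xP].
    have [t [t0 t1 Jt]] := sup_adherent x0 Tsup; rewrite -/s => st.
    have ts : t <= s by apply: ub_le_sup.
    exists (f t *m F).
      by rewrite fE; apply: xP; rewrite ler0_norm ?subr_le0//; lra.
    by apply/HJ => //; apply: near_f; rewrite ger0_norm.
  have nGfs : ~ inner A (f s *m F).
    move=> iA; have : \forall v \near f s, A (v *m F).
      exact: near_mulmx.
    move=> /(near_line k)[x x0 xP].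
    pose y := Num.min (x / 2) d.
    have y0 : 0 < y by rewrite lt_min divr_gt0.
    have yx : y <= x / 2 by rewrite ge_min lexx.
    have yd : y <= d by rewrite ge_min lexx orbT.
    have : T (s + y).
      have t0 : 0 <= s + y by lra.
      have t1 : s + y <= 2 * d by lra.
      split => //; apply/HJ; first by apply: near_f; rewrite ger0_norm.
      by rewrite fE; apply: xP; rewrite addrAC subrr add0r gtr0_norm//; lra.
    by move=> /(ub_le_sup Tub); rewrite -/s; lra.
  exists s => //; rewrite -/(f s).
  have : join A B (f s) by apply/HJ.
  case=> [/nA|//|[a [b [Aa Bb fab]]]]; first by case.
  exfalso.
  (* If the exit point is [a + b], then [(1 + x) *: a + b] and [(1 - x) *: a + b] are also in the
     join and close to [q]. Their images in [A] have the frontier point as midpoint, so strictness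
     makes them proportional. *)
  pose x := Num.min (1 / 2) ((r - `|f s - q|) / (2 * (1 + `|a|))).
  have a1 : 0 < 1 + `|a| by rewrite ltr_wpDr.
  have x0 : 0 < x by rewrite lt_min; apply/andP; split; [lra|rewrite divr_gt0//; lra].
  have x1 : x <= 1 / 2 by rewrite ge_min lexx.
  have xr : x * `|a| < r - `|f s - q|.
    have : x <= (r - `|f s - q|) / (2 * (1 + `|a|)) by rewrite ge_min lexx orbT.
    rewrite ler_pdivlMr; [nra|lra].
  have Gab y : `|y| = x -> A ((f s + y *: a) *m F).
    move=> yx; apply/HJ.
      have -> : f s + y *: a - q = f s - q + y *: a by rewrite addrAC.
      by apply: le_lt_trans (ler_normD _ _) _; rewrite normrZ yx; lra.
    constructor 3; exists ((1 + y) *: a), b; split => //.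
      by apply: cone_scale => //; have := ler_norm (- y); rewrite normrN yx; lra.
    by rewrite fab; apply/rowP => i; rewrite !mxE; ring.
  have G1 := Gab x (gtr0_norm x0).
  have G2 : A ((f s + - x *: a) *m F) by apply: Gab; rewrite normrN gtr0_norm.
  have half : (0 : R) < 1 / 2 by lra.
  have [|c] := sA _ _ (cone_scale gA half G1) (cone_scale gA half G2).
    rewrite -scalerDr -mulmxDl.
    have -> : f s + x *: a + (f s + - x *: a) = 2 *: f s.
      by apply/rowP => i; rewrite !mxE; ring.
    have -> : (1 / 2) *: ((2 *: f s) *m F) = f s *m F.
      by rewrite -scalemxAl scalerA -[RHS]scale1r; congr (_ *: _); field.
    by [].
  move=> H1.
  have : (f s + x *: a) *m F = c *: ((f s + - x *: a) *m F).
    by apply: (scalerI (lt0r_neq0 half)); rewrite H1 !scalerA (mulrC c).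
  rewrite scalemxAl => /(congr1 (mulmx^~ F)); rewrite /= -!mulmxA FF !mulmx1 fab.
  have ga := gpA _ Aa; have gb := gpB _ Bb.
  (* A ratio 1 would give [a = 0]; any other ratio makes [b] a positive multiple of [a], which puts
     the exit point in [A], although [A] is absent near [q]. *)
  have [->|c1] := eqVneq c 1.
    move=> /(congr1 (dot g)); rewrite !dotE => H.
    have := mulr_gt0 x0 ga; lra.
  move=> H; pose y := (c * (1 - x) - (1 + x)) / (1 - c).
  have c1' : 1 - c != 0 by rewrite subr_eq0 eq_sym.
  have bE : b = y *: a.
    apply: (scalerI c1'); rewrite scalerA mulrC divfK//.
    apply/rowP => i; move/rowP/(_ i): H; rewrite !mxE => H.
    by apply: subr0_eq; rewrite -[RHS](subrr (c * (a 0 i + b 0 i + - x * a 0 i))) -{1}H; ring.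
  have y0 : 0 < y by move: gb; rewrite bE dotZr pmulr_lgt0.
  apply: (nA _ fq); rewrite fab bE -{1}(scale1r a) -scalerDl.
  by apply: cone_scale => //; lra.
(* Both exits of the chord through [z] are in [B], and [z] lies between them. *)
have [s1 s10 B1] := claim h (or_introl erefl).
have [s2 s20 B2] := claim (- h) (or_intror erefl).
move: s10; rewrite le_eqVlt => /predU1P[s10|s10].
  by move: B1; rewrite -s10 scale0r addr0.
move: s20; rewrite le_eqVlt => /predU1P[s20|s20].
  by move: B2; rewrite -s20 scale0r addr0.
have s12 : 0 < s1 + s2 by rewrite addr_gt0.
have -> : z = (s2 / (s1 + s2)) *: (z + s1 *: h) + (s1 / (s1 + s2)) *: (z + s2 *: - h).
  by apply/rowP => i; rewrite !mxE; field; rewrite gt_eqF.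
by apply: cone_add => //; apply: cone_scale => //; rewrite divr_gt0.
Qed.

(** At a point where the cones agree locally, a normal of one is a normal of the other. Unit normals
    at such points tending to [q] have a cluster point, which supports both cones at [q]; smoothness
    makes [e] and [e'] positive multiples of it. *)
Lemma common_normal C D q e e' : good_cone D -> smooth_at C q -> smooth_at D q ->
  supports e C q -> supports e' D q ->
  (forall w, frontier C w -> exists u, supports u C w) ->
  (forall P : set V, (\forall w \near q, P w) ->
     exists2 w, P w & frontier C w /\ \forall v \near w, C v <-> D v) ->
  exists2 a, 0 < a & e' = a *: e.
Proof.
move=> gD [m m0 sm] [m' m'0 sm'] eC e'D supp acc.
have step (k : nat) : exists wu : V * V,
    [/\ dot (wu.1 - q) (wu.1 - q) < k.+1%:R^-1, dot wu.2 wu.2 = 1, dot wu.2 wu.1 = 0,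
      forall w, C w -> dot wu.2 w <= 0 & forall w, D w -> dot wu.2 w <= 0].
  have : \forall w \near q, 0 < k.+1%:R^-1 - dot (w - q) (w - q).
    apply: (@near_pos R V (fun w => k.+1%:R^-1 - dot (w - q) (w - q))).
      apply: continuousB; first exact: cst_continuous.
      apply: (@continuous_comp _ _ _ (fun w : V => w - q) (fun u => dot u u)).
        by apply: continuousB; [exact: cvg_id|exact: cst_continuous].
      exact: dotxx_continuous.
    by rewrite subrr dot0r subr0 invr_gt0.
  move=> /acc[w wq [fw CD]]; have [u [u0 uw uC]] := supp _ fw.
  have uu := dot_gt0 u0; have su : 0 < (Num.sqrt (dot u u))^-1.
    by rewrite invr_gt0 sqrtr_gt0.
  exists (w, (Num.sqrt (dot u u))^-1 *: u) => /=; split.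
  - by move: wq; rewrite /= subr_gt0.
  - rewrite !dotE mulrA -expr2 exprVn sqr_sqrtr ?dot_ge0// mulVf//.
    by rewrite gt_eqF.
  - by rewrite dotZl uw mulr0.
  - by move=> v /uC; rewrite dotZl pmulr_rle0.
  (* A short step from [w] in the direction [v] stays in [D] and, the germs being equal, in [C]. *)
  - move=> v Dv; rewrite dotZl pmulr_rle0//.
    have /(near_line v)[d d0 dP] := CD.
    have d20 : 0 < d / 2 by rewrite divr_gt0.
    have /uC : C (w + (d / 2) *: v).
      apply/dP; first by rewrite gtr0_norm//; lra.
      apply: cone_add => //; last exact: cone_scale.
      by apply/(nbhs_singleton CD); case: fw.
    by rewrite dotDr uw add0r dotZr pmulr_rle0.
have [f fP] := choice step.
have [u uu uP] : exists2 u, dot u u = 1 & forall P : set V,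
    (\forall v \near u, P v) -> forall N, exists2 k, (N <= k)%N & P (f k).2.
  apply: (@cluster_point R n _ (fun k => (f k).2) sphere_compact) => k.
  by have [] := fP k.
have u0 : u != 0 by apply/eqP => u0; move: uu; rewrite u0 dot0r => /eqP; rewrite eq_sym oner_eq0.
have lim (w : V) : (forall k, dot (f k).2 w <= 0) -> dot u w <= 0.
  move=> fw; rewrite leNgt; apply/negP => uw.
  have : \forall v \near u, 0 < dot w v.
    by apply: near_pos; [exact: dot_continuous|rewrite dotC].
  by move=> /uP/(_ 0%N)[k _]; rewrite dotC ltNge fw.
(* The normal [v] at [w] satisfies [dot v w = 0], so [dot v q] is at most the distance from [w] to
   [q] by Cauchy-Schwarz. *)
have uq : dot u q = 0.
  apply/eqP; apply: contraT => uq.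
  have uq2 : 0 < dot u q ^+ 2 by rewrite exprn_even_gt0.
  have : \forall v \near u, 0 < dot q v * dot q v - dot u q ^+ 2 / 2.
    apply: (@near_pos R V (fun v => dot q v * dot q v - dot u q ^+ 2 / 2)); last first.
      by rewrite (dotC q) -expr2; lra.
    apply: continuousB; last exact: cst_continuous.
    by apply: continuousM; exact: dot_continuous.
  move=> /uP/(_ (Num.truncn (dot u q ^+ 2 / 2)^-1))[k Nk].
  have [] := fP k; case: (f k) => w v /= wq vv vw _ _; rewrite (dotC q) -expr2.
  have := dot_CS v (w - q); rewrite vv mul1r dotDr dotNr vw sub0r sqrrN.
  have : k.+1%:R^-1 < dot u q ^+ 2 / 2.
    rewrite -[ltRHS]invrK ltf_pV2 ?posrE ?invr_gt0// ?divr_gt0//.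
    by apply: lt_le_trans (truncnS_gt _) _; rewrite ler_nat.
  move=> h1 h2; rewrite subr_gt0 => h3.
  by have := lt_trans h3 (lt_trans (le_lt_trans h2 wq) h1); rewrite ltxx.
have uC : supports u C q by split => // w Cw; apply: lim => k; have [_ _ _ + _] := fP k; apply.
have uD : supports u D q by split => // w Dw; apply: lim => k; have [_ _ _ _] := fP k; apply.
have [a a0 ea] := smooth_supports_unique m0 sm eC.
have [b b0 ub] := smooth_supports_unique m0 sm uC.
have [a' a'0 ea'] := smooth_supports_unique m'0 sm' e'D.
have [b' b'0 ub'] := smooth_supports_unique m'0 sm' uD.
exists (a' / b' * b / a); first by rewrite !(mulr_gt0, divr_gt0, invr_gt0).
rewrite ea scalerA divfK ?gt_eqF// -scalerA -ub ub' scalerA divfK ?gt_eqF//.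
Qed.

End ConeGerms2.

(** * Connectedness of the frontier of a cone *)

Section FrontierConnected.
Context {R : realType} {n : nat}.
Local Notation V := 'rV[R]_n.
Variables (C : set V) (c : V).
Hypotheses (gC : good_cone C) (Cc : inner C c).

(** Every line in the interior direction [c] enters the cone at one parameter: far along [c] it is
    inside, since [c] is interior, and far along [- c] it is outside, since a linear form is
    positive on the cone. *)
Let depth (w : V) : R := sup [set t | C (w - t *: c)].

Let depth_set (w : V) : has_sup [set t | C (w - t *: c)].
Proof.
have [h hC] := cone_pos gC; have hc := hC _ (innerW Cc); split.
  have /(near_line w)[d d0 dC] := Cc.
  have d20 : 0 < d / 2 by rewrite divr_gt0.
  have /(cone_scale gC (_ : 0 < (d / 2)^-1)) : C (c + (d / 2) *: w).
    by apply: dC; rewrite gtr0_norm//; lra.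
  rewrite invr_gt0 => /(_ d20); rewrite scalerDr scalerA mulVf ?gt_eqF// scale1r.
  by exists (- (d / 2)^-1); rewrite /= scaleNr opprK addrC.
exists (dot h w / dot h c) => t /= /hC; rewrite dotDr dotNr dotZr subr_gt0 => H.
by rewrite ler_pdivlMr// ltW.
Qed.

Let inner_below (w : V) (t : R) : t < depth w -> inner C (w - t *: c).
Proof.
move=> tw; have [x Cx xt] := sup_gt (depth_set w).1 tw.
have -> : w - t *: c = (x - t) *: c + (w - x *: c).
  by apply/rowP => i; rewrite !mxE; ring.
by apply: inner_add => //; apply: inner_scale => //; rewrite subr_gt0.
Qed.

Let notin_above (w : V) (t : R) : depth w < t -> ~ C (w - t *: c).
Proof.
move=> wt Ct; have := ub_le_sup (depth_set w).2 Ct.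
by rewrite leNgt wt.
Qed.

(** Projection along [c] onto the frontier; it fixes the frontier and is continuous off the line
    through [c]. *)
Let shadow (w : V) : V := w - depth w *: c.

Let shadow_frontier w : shadow w != 0 -> frontier C (shadow w).
Proof.
move=> w0; split.
  apply: (cone_limit gC w0) => P /(near_line c)[d d0 dP].
  exists (shadow w + (d / 2) *: c).
    by apply: dP; rewrite gtr0_norm ?divr_gt0//; lra.
  have -> : shadow w + (d / 2) *: c = w - (depth w - d / 2) *: c.
    by apply/rowP => i; rewrite !mxE; ring.
  by apply: innerW; apply: inner_below; lra.
move=> /(near_line c)[d d0 dP].
have /= := dP (- (d / 2)); rewrite normrN gtr0_norm ?divr_gt0//.
have -> : shadow w + - (d / 2) *: c = w - (depth w + d / 2) *: c.
  by apply/rowP => i; rewrite !mxE; ring.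
have dd : d / 2 < d by lra.
by move=> /(_ dd); apply: notin_above; lra.
Qed.

Let shadow_id w : frontier C w -> shadow w = w.
Proof.
move=> [Cw nCw]; suff : depth w = 0 by rewrite /shadow => ->; rewrite scale0r subr0.
apply: le_anti; apply/andP; split.
  rewrite leNgt; apply/negP => /inner_below; rewrite scale0r subr0; exact: nCw.
by apply: (ub_le_sup (depth_set w).2); rewrite /= scale0r subr0.
Qed.

Let depth_continuous w : (forall t : R, w - t *: c != 0) -> {for w, continuous depth}.
Proof.
move=> w0 U /nbhs_ballP[e /= e0 eU]; change (\forall v \near w, U (depth v)).
have sub_cont t : {for w, continuous (fun v : V => v - t *: c)}.
  by apply: continuousB; [exact: cvg_id|exact: cst_continuous].
have lo : \forall v \near w, C (v - (depth w - e / 2) *: c).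
  by apply: (near_comp (sub_cont _)); apply: inner_below; lra.
have hi : \forall v \near w, ~ C (v - (depth w + e / 2) *: c).
  apply: (@near_comp _ _ (fun v : V => v - (depth w + e / 2) *: c) w (~` C) (sub_cont _)).
  by apply: cone_closed => //; apply: notin_above; lra.
apply: filterS2 lo hi => v Cv nCv.
have := ub_le_sup (depth_set v).2 Cv; rewrite -/(depth v) => H1.
have H2 : depth v <= depth w + e / 2.
  rewrite leNgt; apply/negP => /inner_below/innerW; exact: nCv.
by apply: eU; rewrite /ball/= ltr_norml; apply/andP; split; lra.
Qed.

Let shadow_continuous w : (forall t : R, w - t *: c != 0) -> {for w, continuous shadow}.
Proof.
move=> /depth_continuous dc.
apply: continuousB; first exact: cvg_id.
exact: (continuousZr_tmp (a := c) dc).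
Qed.

(** The line through [w1] and [w2], projected along [c], is a path in the frontier. Independence of
    [w1], [w2] and [c] keeps it away from the apex; connectedness of the real line does the rest. *)
Lemma frontier_path w1 w2 (P : set V) : frontier C w1 -> frontier C w2 ->
  (forall a b t, a *: w1 + b *: w2 = t *: c -> [/\ a = 0, b = 0 & t = 0]) ->
  (forall w, frontier C w -> P w -> \forall v \near w, frontier C v -> P v) ->
  (forall w, frontier C w -> ~ P w -> \forall v \near w, frontier C v -> ~ P v) ->
  P w1 -> P w2.
Proof.
move=> fw1 fw2 ind Popen Pclosed Pw1.
pose f (t : R) : V := w1 + t *: (w2 - w1).
have fN0 t x : f t - x *: c != 0.
  apply/eqP => /eqP; rewrite subr_eq0 => /eqP fx.
  have [|t0 t1 _] := ind (1 - t) t x.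
    by rewrite -fx; apply/rowP => i; rewrite !mxE; ring.
  by move: t0; rewrite t1 subr0 => /eqP; rewrite oner_eq0.
have ff t : frontier C (shadow (f t)) by apply: shadow_frontier; exact: fN0.
have cf : continuous (shadow \o f).
  move=> t; apply: (@continuous_comp _ _ _ f shadow t).
    apply: (@continuousD R V R (fun=> w1) (fun t : R => t *: (w2 - w1)) t).
      exact: cst_continuous.
    by apply: (@continuousZr_tmp R V R id (w2 - w1)); exact: cvg_id.
  by apply: shadow_continuous; exact: fN0.
pose T := [set t | P (shadow (f t))].
have oT : open T.
  rewrite openE => t Tt; have nT : \forall x \near t, frontier C (shadow (f x)) -> P (shadow (f x)).
    exact: (cf t _ (Popen _ (ff t) Tt)).
  by apply: filterS nT => x /(_ (ff x)).
have cT : closed T.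
  rewrite -[T]setCK; apply: open_closedC; rewrite openE => t Tt.
  have nT : \forall x \near t, frontier C (shadow (f x)) -> ~ P (shadow (f x)).
    exact: (cf t _ (Pclosed _ (ff t) Tt)).
  by apply: filterS nT => x /(_ (ff x)).
have /(_ T) TT : connected (@setT R) by apply/connected_intervalP.
have T0 : T 0 by rewrite /T /f /= scale0r addr0 shadow_id.
have : T 1.
  rewrite TT//; first by exists 0.
    by exists T => //; rewrite setTI.
  by exists T => //; rewrite setTI.
by rewrite /T /f /= scale1r addrC subrK shadow_id.
Qed.

End FrontierConnected.

(** From dimension 3 on, an interior [c] outside the plane of [w1] and [w2] exists: a form vanishing
    on that plane cannot vanish on an open set. Points on a common ray are handled by homogeneity of
    [P]. *)
Lemma frontier_connected (R : realType) n (C : set 'rV[R]_n) w1 w2 (P : set 'rV[R]_n) :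
  (3 <= n)%N -> good_cone C -> frontier C w1 -> frontier C w2 ->
  (forall a w, 0 < a -> P w -> P (a *: w)) ->
  (forall w, frontier C w -> P w -> \forall v \near w, frontier C v -> P v) ->
  (forall w, frontier C w -> ~ P w -> \forall v \near w, frontier C v -> ~ P v) ->
  P w1 -> P w2.
Proof.
move=> n3 gC fw1 fw2 Pscale Popen Pclosed Pw1.
have [h hC] := cone_pos gC.
have hw1 := hC _ fw1.1; have hw2 := hC _ fw2.1.
have [[a w2E]|npar] := pselect (exists a, w2 = a *: w1).
  by rewrite w2E; apply: Pscale => //; move: hw2; rewrite w2E dotZr pmulr_lgt0.
have [c0 Cc0] := cone_inner gC.
have [e e0 [ew1 ew2]] := exists_orthogonal w1 w2 n3.
rewrite dotC in ew1; rewrite dotC in ew2.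
have [c Cc ec] : exists2 c, inner C c & dot e c != 0.
  have [ec0|ec0] := eqVneq (dot e c0) 0; last by exists c0.
  have /(near_line e)[d d0 dP] := inner_inner Cc0.
  have d20 : 0 < d / 2 by rewrite divr_gt0.
  exists (c0 + (d / 2) *: e); first by apply: dP; rewrite gtr0_norm//; lra.
  by rewrite dotDr ec0 add0r dotZr mulf_neq0 ?gt_eqF// dot_gt0.
apply: (frontier_path gC Cc fw1 fw2 _ Popen Pclosed Pw1) => a b t H.
have t0 : t = 0.
  have := congr1 (dot e) H; rewrite dotDr !dotZr ew1 ew2 !mulr0 addr0.
  by move=> /esym/eqP; rewrite mulf_eq0 (negPf ec) orbF => /eqP.
have b0 : b = 0.
  apply/eqP; apply: contraT => b0; exfalso; apply: npar; exists (- (a / b)).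
  apply: (scalerI b0); rewrite scalerA.
  have -> : b * - (a / b) = - a by field.
  move: H; rewrite t0 scale0r => /eqP; rewrite addrC addr_eq0 => /eqP ->.
  by rewrite scaleNr.
split => //; move: H; rewrite b0 t0 !scale0r addr0 => /eqP.
by rewrite scaler_eq0 (negPf (cone_neq0 gC fw1.1)) orbF => /eqP.
Qed.

(** * The linear model of the three space forms *)

Section HeadTail.
Context {R : realType} {d : nat}.
Local Notation V := 'rV[R]_d.+1.
Implicit Types v w : V.

Definition hd v : R := v 0 0.
Definition tl v : 'rV[R]_d := \row_i v 0 (lift ord0 i).
Definition mk (a : R) (u : 'rV[R]_d) : V :=
  \row_j (if unlift ord0 j is Some i then u 0 i else a).

Lemma hd_mk a u : hd (mk a u) = a.
Proof. by rewrite /hd mxE unlift_none. Qed.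

Lemma tl_mk a u : tl (mk a u) = u.
Proof. by apply/rowP => i; rewrite !mxE liftK. Qed.

Lemma hdtlP v w : hd v = hd w -> tl v = tl w -> v = w.
Proof.
move=> h t; apply/rowP => j; case: (unliftP ord0 j) => [i ->|->]; last exact: h.
by move/rowP/(_ i): t; rewrite !mxE.
Qed.

Lemma hdD v w : hd (v + w) = hd v + hd w. Proof. by rewrite /hd mxE. Qed.
Lemma hdN v : hd (- v) = - hd v. Proof. by rewrite /hd mxE. Qed.
Lemma hdZ a v : hd (a *: v) = a * hd v. Proof. by rewrite /hd mxE. Qed.
Lemma hd0 : hd 0 = 0. Proof. by rewrite /hd mxE. Qed.
Lemma tlD v w : tl (v + w) = tl v + tl w. Proof. by apply/rowP => i; rewrite !mxE. Qed.
Lemma tlN v : tl (- v) = - tl v. Proof. by apply/rowP => i; rewrite !mxE. Qed.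
Lemma tlZ a v : tl (a *: v) = a *: tl v. Proof. by apply/rowP => i; rewrite !mxE. Qed.
Lemma tl0 : tl 0 = 0. Proof. by apply/rowP => i; rewrite !mxE. Qed.

Definition hdtlE := (hdD, hdN, hdZ, hd0, tlD, tlN, tlZ, tl0, hd_mk, tl_mk).

Lemma hd_continuous : continuous hd.
Proof. exact: coord_continuous. Qed.

Lemma dot_hdtl v w : dot v w = hd v * hd w + dot (tl v) (tl w).
Proof.
rewrite /dot big_ord_recl; congr (_ + _).
by apply: eq_bigr => i _; rewrite !mxE.
Qed.

Lemma dot_tl_continuous u : continuous (fun v => dot u (tl v)).
Proof.
have -> : (fun v => dot u (tl v)) = dot (mk 0 u).
  by apply/funext => v; rewrite dot_hdtl !hdtlE mul0r add0r.
exact: dot_continuous.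
Qed.

Lemma dot_tltl_continuous : continuous (fun v => dot (tl v) (tl v)).
Proof.
have -> : (fun v => dot (tl v) (tl v)) = (fun v => dot v v - hd v * hd v).
  by apply/funext => v; rewrite dot_hdtl addrAC subrr add0r.
move=> v; apply: (@continuousB R R^o V (fun v => dot v v) (fun v => hd v * hd v)).
  exact: dotxx_continuous.
by apply: continuousM; exact: hd_continuous.
Qed.

End HeadTail.

Section SpaceForm.
Context {R : realType}.
Variables (X : geometry).

Definition curv : R :=
  match X with Spherical => 1 | Euclidean => 0 | Hyperbolic => -1 end.

Section Dim.
Context {d : nat}.
Local Notation V := 'rV[R]_d.+1.
Implicit Types v w x y z : V.

(* On [R^(d+1)], [bil] is 1 on the diagonal of the model, and [met] is the
   metric on differences of points; [bil = curv * met] unless [curv = 0]. *)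
Definition bil v w : R := hd v * hd w + curv * dot (tl v) (tl w).
Definition met v w : R := dot (tl v) (tl w) + curv * (hd v * hd w).
(** Squared chord: 2 - 2 cos, the squared distance, or 2 cosh - 2 of the distance. The distance is
    an increasing function of it, so balls and diameters are compared by quadratic expressions,
    uniformly in [X]. *)
Definition sq v w : R := met (v - w) (v - w).

Definition Mod w : Prop := bil w w = 1 /\ (X <> Spherical -> 0 < hd w).

(* Euclidean space is embedded as the affine hyperplane [hd = 1]. *)
Definition homog : ambient R X d -> V :=
  match X return ambient R X d -> V with Euclidean => mk 1 | _ => id end.

Definition dist_of (t : R) : R :=
  match X with
  | Spherical => acos (1 - t / 2)
  | Euclidean => Num.sqrt t
  | Hyperbolic => arcosh (1 + t / 2)
  end.

Lemma bilC v w : bil v w = bil w v.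
Proof. by rewrite /bil dotC (mulrC (hd w)). Qed.

Lemma metC v w : met v w = met w v.
Proof. by rewrite /met dotC (mulrC (hd w)). Qed.

Lemma bilDl u v w : bil (v + w) u = bil v u + bil w u.
Proof. by rewrite /bil !hdtlE !dotE; ring. Qed.
Lemma bilZl a u v : bil (a *: v) u = a * bil v u.
Proof. by rewrite /bil !hdtlE !dotE; ring. Qed.
Lemma bilNl u v : bil (- v) u = - bil v u.
Proof. by rewrite /bil !hdtlE !dotE; ring. Qed.
Lemma bilDr u v w : bil u (v + w) = bil u v + bil u w.
Proof. by rewrite !(bilC u) bilDl. Qed.
Lemma bilZr a u v : bil u (a *: v) = a * bil u v.
Proof. by rewrite !(bilC u) bilZl. Qed.
Lemma bilNr u v : bil u (- v) = - bil u v.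
Proof. by rewrite !(bilC u) bilNl. Qed.
Definition bilE := (bilDl, bilDr, bilZl, bilZr, bilNl, bilNr).

Lemma metDl u v w : met (v + w) u = met v u + met w u.
Proof. by rewrite /met !hdtlE !dotE; ring. Qed.
Lemma metZl a u v : met (a *: v) u = a * met v u.
Proof. by rewrite /met !hdtlE !dotE; ring. Qed.
Lemma metNl u v : met (- v) u = - met v u.
Proof. by rewrite /met !hdtlE !dotE; ring. Qed.
Lemma metDr u v w : met u (v + w) = met u v + met u w.
Proof. by rewrite !(metC u) metDl. Qed.
Lemma metZr a u v : met u (a *: v) = a * met u v.
Proof. by rewrite !(metC u) metZl. Qed.
Lemma metNr u v : met u (- v) = - met u v.
Proof. by rewrite !(metC u) metNl. Qed.
Definition metE := (metDl, metDr, metZl, metZr, metNl, metNr).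

Lemma sqC v w : sq v w = sq w v.
Proof. by rewrite /sq -opprB metNl metNr opprK. Qed.

Lemma sqxx v : sq v v = 0.
Proof. by rewrite /sq subrr -(scale0r 0) metZl mul0r. Qed.

Lemma met_bil v w : X <> Euclidean -> met v w = curv * bil v w.
Proof. by rewrite /met /bil /curv; case: X => // _; ring. Qed.

Lemma bil_met v w : X <> Euclidean -> bil v w = curv * met v w.
Proof. by rewrite /met /bil /curv; case: X => // _; ring. Qed.

Lemma curv2 : X <> Euclidean -> curv * curv = 1.
Proof. by rewrite /curv; case: X => // _; ring. Qed.

Lemma Mod_euclid w : X = Euclidean -> Mod w -> hd w = 1.
Proof.
rewrite /Mod /bil /curv => -> [] + /(_ ltac:(by [])).
rewrite mul0r addr0 -expr2 => /eqP; rewrite sqrf_eq1 => /orP[] /eqP -> //; lra.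
Qed.

Lemma sq_bil x y : X <> Euclidean -> Mod x -> Mod y ->
  sq x y = 2 * curv * (1 - bil x y).
Proof.
move=> nE [bx _] [by_ _]; rewrite /sq met_bil// !bilE bx by_ (bilC y); ring.
Qed.

Lemma sq_euclid x y : X = Euclidean -> Mod x -> Mod y ->
  sq x y = dot (tl x - tl y) (tl x - tl y).
Proof.
move=> E Mx My; rewrite /sq /met !hdtlE (Mod_euclid E Mx) (Mod_euclid E My).
by rewrite subrr mulr0 mulr0 addr0.
Qed.

Lemma Mod_neq0 w : Mod w -> w != 0.
Proof.
move=> [bw _]; apply: contra_eqN bw => /eqP ->.
by rewrite -(scale0r 0) bilZl mul0r eq_sym oner_neq0.
Qed.

(* Reversed Cauchy-Schwarz inequality for timelike vectors. *)
Lemma bil_hyp_ge1 x y : X = Hyperbolic -> Mod x -> Mod y -> 1 <= bil x y.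
Proof.
move=> E [bx /(_ ltac:(by rewrite E)) x0] [by_ /(_ ltac:(by rewrite E)) y0].
move: bx by_; rewrite /bil /curv E /=; have := dot_CS (tl x) (tl y).
have := dot_ge0 (tl x); have := dot_ge0 (tl y).
set a := dot (tl x) (tl x); set b := dot (tl y) (tl y); set c := dot (tl x) (tl y).
move=> b0 a0 cab xx yy.
have cb : c <= Num.sqrt a * Num.sqrt b.
  rewrite -sqrtrM//; apply: le_trans (ler_norm c) _.
  by rewrite -sqrtr_sqr ler_wsqrtr.
have sa := sqr_sqrtr a0; have sb := sqr_sqrtr b0.
have s1 := sqrtr_ge0 a; have s2 := sqrtr_ge0 b.
set p := Num.sqrt a in cb sa s1 *; set q := Num.sqrt b in cb sb s2 *.
have xE : hd x ^+ 2 = 1 + p ^+ 2 by rewrite expr2; lra.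
have yE : hd y ^+ 2 = 1 + q ^+ 2 by rewrite expr2; lra.
have : 1 + p * q <= hd x * hd y.
  have pq := mulr_ge0 s1 s2; have xy := mulr_gt0 x0 y0.
  rewrite leNgt; apply/negP => lt1.
  have : (hd x * hd y) ^+ 2 < (1 + p * q) ^+ 2.
    by rewrite ltrXn2r// ltW.
  by rewrite exprMn xE yE; have := sqr_ge0 (p - q); nra.
lra.
Qed.

Lemma sq_ge0 x y : Mod x -> Mod y -> 0 <= sq x y.
Proof.
move=> Mx My; case: (pselect (X = Hyperbolic)) => [E|nH].
  have kE : curv = -1 by rewrite /curv E.
  by have := bil_hyp_ge1 E Mx My; rewrite sq_bil ?E// kE; lra.
have k0 : 0 <= curv by rewrite /curv; case: X nH.
by rewrite /sq /met addr_ge0 ?dot_ge0// mulr_ge0// -expr2 sqr_ge0.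
Qed.

End Dim.
End SpaceForm.

Section Metric.
Context {R : realType}.
Variables (X : geometry).
Local Notation k := (curv X : R).

Section Dim.
Context {d : nat}.
Local Notation V := 'rV[R]_d.+1.
Implicit Types v w x y z t : V.

(** Only the hyperbolic case is not immediate: tangency says that [hd t * hd x] is the inner product
    of the tails, and [dot (tl x) (tl x) = hd x ^+ 2 - 1], so Cauchy-Schwarz gives
    [hd t ^+ 2 < dot (tl t) (tl t)]. *)
Lemma met_tangent_gt0 x t : Mod X x -> bil X t x = 0 -> t != 0 -> 0 < met X t t.
Proof.
move=> Mx tx t0; case: (pselect (X = Hyperbolic)) => [E|nH]; last first.
  have [E|nE] := pselect (X = Euclidean).
    have ht : hd t = 0.
      move: tx; rewrite /bil /curv E mul0r addr0 (Mod_euclid E Mx) mulr1.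
      by move=> ->.
    rewrite /met ht mul0r mulr0 addr0; apply: dot_gt0.
    by apply: contra_neq t0 => tt; apply: hdtlP; rewrite ?hd0 ?tl0.
  have k1 : k = 1 by rewrite /curv; case: X nH nE.
  by rewrite /met k1 mul1r addrC -dot_hdtl dot_gt0.
move: Mx => [xx /(_ ltac:(by rewrite E)) x0].
move: xx tx; rewrite /bil /met /curv E /= !mulN1r -!expr2.
have := dot_CS (tl t) (tl x); have := dot_ge0 (tl t).
set T := dot (tl t) (tl t) in t0 *; set a := dot (tl x) (tl x); set c := dot (tl t) (tl x).
move=> T0 cT xx tx; have ch : c = hd t * hd x by lra.
have aE : a = hd x ^+ 2 - 1 by lra.
have x2 : 0 < hd x ^+ 2 by rewrite exprn_gt0.
have Tgt0 : 0 < T.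
  rewrite lt_def T0 andbT; apply: contra_neq t0 => TE.
  have tl0' : tl t = 0 by apply: dot_eq0.
  apply: hdtlP; rewrite ?tl0// hd0.
  move: ch; rewrite /c tl0' dot0l => /esym/eqP; rewrite mulf_eq0 (gt_eqF x0) orbF.
  by move=> /eqP.
move: cT; rewrite ch aE exprMn => cT.
rewrite -(pmulr_rgt0 _ x2) mulrDr mulrN subr_gt0.
by apply: le_lt_trans (_ : T * (hd x ^+ 2 - 1) < _); [rewrite mulrC|rewrite mulrBr mulr1 mulrC gtrBl].
Qed.

(** When the squared chord vanishes, [x - y] is tangent at [x], where [met] is definite. *)
Lemma sq_eq0 x y : Mod X x -> Mod X y -> sq X x y = 0 -> x = y.
Proof.
move=> Mx My sxy; apply/eqP; rewrite -subr_eq0; apply: contraT => xy.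
have : 0 < met X (x - y) (x - y); last by rewrite -/(sq X x y) sxy ltxx.
apply: (@met_tangent_gt0 x) => //.
have [E|nE] := pselect (X = Euclidean).
  by rewrite /bil /curv E mul0r addr0 hdD hdN (Mod_euclid E Mx) (Mod_euclid E My) subrr mul0r.
rewrite bilDl bilNl Mx.1 bilC.
have kk : k * k = 1 by exact: curv2.
move: sxy; rewrite sq_bil// => /(congr1 ( *%R k)); rewrite mulr0.
have -> : k * (2 * k * (1 - bil X x y)) = (k * k) * (2 * (1 - bil X x y)) by ring.
by rewrite kk; lra.
Qed.

Lemma sq_gt0 x y : Mod X x -> Mod X y -> x != y -> 0 < sq X x y.
Proof.
move=> Mx My xy; rewrite lt_def sq_ge0// andbT.
by apply: contra_neq xy; exact: sq_eq0.
Qed.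

Lemma sq_le4 x y : X = Spherical -> Mod X x -> Mod X y -> sq X x y <= 4.
Proof.
move=> E Mx My; have nE : X <> Euclidean by rewrite E.
have MNy : Mod X (- y) by split; rewrite ?bilNl ?bilNr ?opprK ?My.1.
have := sq_ge0 Mx MNy; rewrite !sq_bil// bilNr.
have -> : k = 1 by rewrite /curv E.
lra.
Qed.

Lemma homog_inj : injective (@homog R X d).
Proof.
by rewrite /homog; case: X => /= z w // /(congr1 tl); rewrite !tl_mk.
Qed.

Lemma homogP (z : ambient R X d) : model R X d z <-> Mod X (homog z).
Proof.
rewrite /homog /model /Mod /bil /curv; case: X z => /= z.
- by rewrite mul1r -dot_hdtl; split=> [H|[]] //; split.
- by rewrite hd_mk mul0r addr0 mulr1; split.
- rewrite mulN1r /lorentz /dot /hd; split=> -[H1 H2]; split=> //; last by apply: H2.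
  + by rewrite -H1; congr (_ - _); apply: eq_bigr => i _; rewrite !mxE.
  + by rewrite -H1; congr (_ - _); apply: eq_bigr => i _; rewrite !mxE.
Qed.

Lemma homog_onto w : Mod X w -> exists2 z : ambient R X d, model R X d z & homog z = w.
Proof.
move=> Mw; suff [z zw] : exists z : ambient R X d, homog z = w.
  by exists z => //; apply/homogP; rewrite zw.
have := @Mod_euclid R X d w; move: Mw; rewrite /homog; case: X => Mw HE.
- by exists w.
- exists (tl w); apply: hdtlP; rewrite !hdtlE//; by rewrite HE.
- by exists w.
Qed.

Lemma distE (x y : ambient R X d) : model R X d x -> model R X d y ->
  dist x y = dist_of X (sq X (homog x) (homog y)).
Proof.
move=> /homogP + /homogP; rewrite /dist /dist_of.
have := @sq_bil R X d (homog x) (homog y); have := @sq_euclid R X d (homog x) (homog y).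
rewrite /homog /bil /curv; case: X x y => /= x y sE sB Mx My.
- rewrite sB//; congr acos; rewrite dot_hdtl; by field.
- by rewrite sE// !tl_mk.
- rewrite sB//; congr arcosh; rewrite /lorentz /hd.
  have -> : \sum_(i < d) x 0 (lift ord0 i) * y 0 (lift ord0 i) = dot (tl x) (tl y).
    by apply: eq_bigr => i _; rewrite !mxE.
  by field.
Qed.

End Dim.
End Metric.

Section Metric2.
Context {R : realType}.
Variables (X : geometry).
Local Notation k := (curv X : R).

Definition sq_range (t : R) : Prop := 0 <= t /\ (X = Spherical -> t <= 4).

Lemma dist_of_lt t t' : sq_range t -> sq_range t' -> t < t' ->
  dist_of X t < dist_of X t'.
Proof.
rewrite /sq_range /dist_of; case: X => -[t0 t4] [t'0 t'4] tt'.
- have {}t4 := t4 erefl; have {}t'4 := t'4 erefl.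
  have i1 : -1 <= 1 - t / 2 <= 1 by apply/andP; split; lra.
  have i2 : -1 <= 1 - t' / 2 <= 1 by apply/andP; split; lra.
  rewrite -ltr_cos ?in_itv/= ?acos_ge0 ?acos_lepi// !acosK ?in_itv//=; lra.
- by rewrite ltr_sqrt// (le_lt_trans t0).
- have s1 := sqrtr_ge0 ((1 + t / 2) ^+ 2 - 1).
  have s2 := sqrtr_ge0 ((1 + t' / 2) ^+ 2 - 1).
  rewrite /arcosh ltr_ln ?posrE; [|lra|lra].
  have : (1 + t / 2) ^+ 2 - 1 <= (1 + t' / 2) ^+ 2 - 1 by nra.
  by move=> /ler_wsqrtr; lra.
Qed.

Lemma dist_of_ltE t t' : sq_range t -> sq_range t' ->
  (dist_of X t < dist_of X t') = (t < t').
Proof.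
move=> rt rt'; apply/idP/idP; last exact: dist_of_lt.
case: (ltgtP t t') => // [tt'|->]; last by rewrite ltxx.
by move=> /lt_trans/(_ (dist_of_lt rt' rt tt')); rewrite ltxx.
Qed.

Lemma dist_of_leE t t' : sq_range t -> sq_range t' ->
  (dist_of X t <= dist_of X t') = (t <= t').
Proof. by move=> rt rt'; rewrite !leNgt dist_of_ltE. Qed.

Lemma dist_of_inj t t' : sq_range t -> sq_range t' ->
  dist_of X t = dist_of X t' -> t = t'.
Proof.
by move=> rt rt' e; apply: le_anti; rewrite -(dist_of_leE rt rt') -(dist_of_leE rt' rt) e lexx.
Qed.

Section Dim.
Context {d : nat}.
Local Notation V := 'rV[R]_d.+1.
Implicit Types v w x y z t : V.

Lemma sq_inr x y : Mod X x -> Mod X y -> sq_range (sq X x y).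
Proof. by move=> Mx My; split; [exact: sq_ge0|move=> ?; exact: sq_le4]. Qed.

Lemma segmentP (x y z : ambient R X d) : model R X d x -> model R X d y ->
  segment x y z <-> model R X d z /\ exists a b,
    [/\ 0 <= a, 0 <= b & homog z = a *: homog x + b *: homog y].
Proof.
rewrite /segment /homog; case: X x y z => //= x y z Mx My.
split=> [[t [t0 t1 ->]]|[_ [a [b [a0 b0 H]]]]].
  split=> //; exists (1 - t), t; split; rewrite ?subr_ge0//.
  by apply: hdtlP; rewrite !hdtlE//; ring.
have ab : a + b = 1 by have := congr1 hd H; rewrite !hdtlE !mulr1.
exists b; split => //; first lra.
have := congr1 tl H; rewrite !hdtlE => ->; congr (_ *: _ + _); lra.
Qed.

Lemma bil_continuous : continuous (fun w => bil X w w).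
Proof.
move=> w; apply: (@continuousD R R^o V (fun w => hd w * hd w) (fun w => k * dot (tl w) (tl w))).
  by apply: continuousM; exact: hd_continuous.
apply: continuousM; first exact: cst_continuous.
exact: dot_tltl_continuous.
Qed.

Lemma metxx_continuous : continuous (fun w => met X w w).
Proof.
move=> w; apply: (@continuousD R R^o V (fun w => dot (tl w) (tl w)) (fun w => k * (hd w * hd w))).
  exact: dot_tltl_continuous.
apply: continuousM; first exact: cst_continuous.
by apply: continuousM; exact: hd_continuous.
Qed.

Lemma met_continuous x : continuous (fun w => met X x w).
Proof.
move=> w; apply: (@continuousD R R^o V (fun w => dot (tl x) (tl w)) (fun w => k * (hd x * hd w))).
  exact: dot_tl_continuous.
apply: continuousM; first exact: cst_continuous.
by apply: continuousM; [exact: cst_continuous|exact: hd_continuous].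
Qed.

Lemma sq_continuous x : continuous (sq X x).
Proof.
have -> : sq X x = fun w => met X x x + (met X w w - (met X x w + met X x w)).
  by apply/funext => w; rewrite /sq !metE (metC X w x); ring.
move=> w; apply: (@continuousD R R^o V (fun=> met X x x) (fun w => met X w w - (met X x w + met X x w))).
  exact: cst_continuous.
apply: (@continuousB R R^o V (fun w => met X w w) (fun w => met X x w + met X x w)).
  exact: metxx_continuous.
by apply: (@continuousD R R^o V (met X x) (met X x)); exact: met_continuous.
Qed.

(** Radial projection to the model is continuous at [x]. With [near_Mod] this identifies ambient
    neighbourhoods with metric ones. *)
Lemma Mod_near x (e : R) : Mod X x -> 0 < e ->
  \forall w \near x, exists a v, [/\ 0 < a, Mod X v, w = a *: v & sq X v x < e].
Proof.
move=> [xx xpos] e0; pose a w := Num.sqrt (bil X w w).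
have ca : continuous a.
  move=> w; apply: (@continuous_comp _ _ _ (fun w => bil X w w) (@Num.sqrt R)).
    exact: bil_continuous.
  exact: sqrt_continuous.
have ax : a x = 1 by rewrite /a xx sqrtr1.
(* The squared chord from the projection of [w] to [x], multiplied by [bil X w w] to clear
   denominators; keeping [bil X w w] above 1/2 allows [f w < e / 2] to suffice. *)
pose f w := met X w w + (a w * a w * met X x x - 2 * a w * met X x w).
have cf : {for x, continuous f}.
  apply: (@continuousD R R^o V (fun w => met X w w)
     (fun w => a w * a w * met X x x - 2 * a w * met X x w)).
    exact: metxx_continuous.
  apply: (@continuousB R R^o V (fun w => a w * a w * met X x x)
     (fun w => 2 * a w * met X x w)).
    apply: continuousM; last exact: cst_continuous.
    by apply: continuousM; exact: ca.
  apply: (@continuousM R V (fun w => 2 * a w) (fun w => met X x w)).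
    by apply: continuousM; [exact: cst_continuous|exact: ca].
  exact: met_continuous.
have n1 : \forall w \near x, 0 < bil X w w - 1 / 2.
  apply: (@near_pos R V (fun w => bil X w w - 1 / 2)); last by rewrite xx; lra.
  by apply: continuousB; [exact: bil_continuous|exact: cst_continuous].
have n2 : \forall w \near x, 0 < e / 2 - f w.
  apply: (@near_pos R V (fun w => e / 2 - f w)).
    by apply: continuousB; [exact: cst_continuous|exact: cf].
  rewrite /f ax mul1r mul1r mulr1.
  have -> : met X x x + (met X x x - 2 * met X x x) = 0 by ring.
  by rewrite subr0 divr_gt0.
have n3 : \forall w \near x, X <> Spherical -> 0 < hd w.
  have [E|nE] := pselect (X = Spherical).
    by near=> w => /(_ E).
  have : \forall w \near x, 0 < hd w by apply: near_pos; [exact: hd_continuous|exact: xpos].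
  by apply: filterS.
apply: filterS3 n1 n2 n3 => w b1 f1 h1.
have b0 : 0 < bil X w w by lra.
have a0 : 0 < a w by rewrite sqrtr_gt0.
have aa : a w * a w = bil X w w by rewrite -expr2 sqr_sqrtr// ltW.
exists (a w), ((a w)^-1 *: w); split => //.
- split; last by move=> /h1; rewrite hdZ pmulr_rgt0 ?invr_gt0.
  by rewrite !bilE -aa; field; rewrite gt_eqF.
- by rewrite scalerA mulfV ?scale1r// gt_eqF.
- have -> : sq X ((a w)^-1 *: w) x = f w / bil X w w.
    by rewrite /sq /f -aa !metE (metC X w x); field; rewrite gt_eqF.
  rewrite ltr_pdivrMr//; nra.
Unshelve. all: by end_near. Qed.

Lemma sqr_norm_le_dot v : `|v| ^+ 2 <= dot v v.
Proof.
rewrite -[`|v|]/(mx_norm v); have [->|v0] := eqVneq v 0.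
  by rewrite mx_norm0 expr0n /= dot0r.
have [|[i j] ->] := @mx_norm_neq0 R 1 d.+1 v.
  by apply: contra_neq v0; exact: mx_norm_eq0.
rewrite /= ord1 real_normK ?num_real// /dot (bigD1 j)//= expr2 lerDl.
by apply: sumr_ge0 => l _; rewrite -expr2 sqr_ge0.
Qed.

Lemma near_dot x (P : set V) : (\forall w \near x, P w) ->
  exists2 e : R, 0 < e & forall v, dot (v - x) (v - x) < e -> P v.
Proof.
move=> /nearP[e e0 eP]; exists (e ^+ 2) => [|v ve]; first by rewrite exprn_gt0.
apply: eP; rewrite ltNge; apply/negP => ev.
have e2 : e ^+ 2 <= `|v - x| ^+ 2 by rewrite lerXn2r ?nnegrE// ltW.
by have := le_trans e2 (sqr_norm_le_dot (v - x)); rewrite leNgt ve.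
Qed.

(** Converse of [Mod_near]: the squared chord has to bound the ambient Euclidean norm. In the
    hyperbolic case write [v = b *: x + t] with [t] tangent at [x]; then [met X t t = b ^+ 2 - 1]
    and [sq X v x = 2 * (b - 1)], and Cauchy-Schwarz bounds the Euclidean size of [t]. *)
Lemma near_Mod x (P : set V) : Mod X x -> (\forall w \near x, P w) ->
  exists2 e : R, 0 < e & forall v, Mod X v -> sq X v x < e -> P v.
Proof.
move=> Mx /near_dot[e e0 eP].
suff [C C0 CP] : exists2 C : R, 0 < C & forall v, Mod X v -> sq X v x < 1 ->
    dot (v - x) (v - x) <= C * sq X v x.
  exists (Num.min 1 (e / C)); first by rewrite lt_min ltr01 divr_gt0.
  move=> v Mv; rewrite lt_min => /andP[/(CP _ Mv) v1 v2]; apply: eP.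
  by apply: le_lt_trans v1 _; rewrite mulrC -ltr_pdivlMr.
case: (pselect (X = Hyperbolic)) => [E|nH]; last first.
  exists 1 => // v Mv _; rewrite mul1r dot_hdtl /sq /met.
  have [E|nE] := pselect (X = Euclidean).
    by rewrite hdD hdN (Mod_euclid E Mx) (Mod_euclid E Mv) subrr !mul0r mulr0 addr0 add0r.
  have -> : k = 1 by rewrite /curv; case: X nH nE.
  by rewrite mul1r addrC.
have nE : X <> Euclidean by rewrite E.
have k1 : k = -1 by rewrite /curv E.
have x0 : 0 < hd x by apply: Mx.2; rewrite E.
exists (5 * hd x ^+ 2 + dot x x) => [|v Mv v1].
  by rewrite ltr_pwDl ?dot_ge0// mulr_gt0// exprn_gt0.
pose b := bil X v x; have b1 : 1 <= b by exact: bil_hyp_ge1.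
have sb : sq X v x = 2 * (b - 1) by rewrite sq_bil// k1 -/b; ring.
pose t := v - b *: x.
have tx : bil X t x = 0 by rewrite bilDl bilNl bilZl Mx.1 mulr1 subrr.
have tt : met X t t = b ^+ 2 - 1.
  by rewrite met_bil// k1 /t !bilE Mv.1 Mx.1 (bilC X x v) -/b; ring.
have vx : v - x = t + (b - 1) *: x.
  by apply/rowP => i; rewrite !mxE; ring.
have cs := dot_CS (tl t) (tl x); have T0 := dot_ge0 (tl t).
have xx : hd x ^+ 2 = 1 + dot (tl x) (tl x).
  by have := Mx.1; rewrite /bil k1 expr2; lra.
have htx : hd t * hd x = dot (tl t) (tl x) by move: tx; rewrite /bil k1; lra.
have mt : dot (tl t) (tl t) - hd t ^+ 2 = b ^+ 2 - 1.
  by rewrite -tt /met k1 expr2; lra.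
have Tle : dot (tl t) (tl t) <= hd x ^+ 2 * (b ^+ 2 - 1).
  move: cs; rewrite -htx exprMn -mt xx; nra.
have dt : dot t t <= 2 * (hd x ^+ 2 * (b ^+ 2 - 1)).
  by rewrite dot_hdtl -expr2; have := b1; nra.
have cs2 := dot_ge0 (t - (b - 1) *: x); rewrite !dotE in cs2.
have d2 : dot (v - x) (v - x) <= 2 * dot t t + 2 * (b - 1) ^+ 2 * dot x x.
  by rewrite vx !dotE; lra.
apply: le_trans d2 _; rewrite sb.
have b2 : b < 3 / 2 by lra.
have X0 := dot_ge0 x; have H0 : 0 < hd x ^+ 2 by rewrite exprn_gt0.
have e1 : b ^+ 2 - 1 <= 5 / 2 * (b - 1) by nra.
have e2 : (b - 1) ^+ 2 <= (b - 1) by nra.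
have e3 : hd x ^+ 2 * (b ^+ 2 - 1) <= hd x ^+ 2 * (5 / 2 * (b - 1)) by rewrite ler_pM2l.
have e4 : (b - 1) ^+ 2 * dot x x <= (b - 1) * dot x x by rewrite ler_wpM2r.
lra.
Qed.

(** Stewart's theorem in the three geometries. As [C] does not depend on [z], it cancels when two
    points are compared. *)
Lemma sq_comb c m x a b : Mod X c -> Mod X m -> Mod X x -> c = a *: m + b *: x ->
  exists C, forall z, Mod X z -> sq X z c = a * sq X z m + b * sq X z x + C.
Proof.
move=> Mc Mm Mx cE; have [E|nE] := pselect (X = Euclidean).
  have ab : a + b = 1.
    by have := Mod_euclid E Mc; rewrite cE !hdtlE !(Mod_euclid E)// !mulr1.
  exists (- (a * b * sq X m x)) => z Mz; rewrite !sq_euclid// cE !hdtlE.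
  have -> : a = 1 - b by move: ab; clear; lra.
  by rewrite !dotE; ring.
by exists (2 * k * (1 - a - b)) => z Mz; rewrite !sq_bil// cE !bilE; ring.
Qed.

End Dim.
End Metric2.

(** * Isometries as matrices *)

Section Isometries.
Context {R : realType}.
Variables (X : geometry).
Local Notation k := (curv X : R).

Section Dim.
Context {d : nat}.
Local Notation V := 'rV[R]_d.+1.
Implicit Types (v w x y z : V) (F : 'M[R]_d.+1).

(** A Euclidean translation is a shear of the linear model and preserves [met] only on differences
    of points, whence the condition on [hd]. *)
Definition isom F : Prop :=
  [/\ F \in unitmx,
      forall v w, bil X (v *m F) (w *m F) = bil X v w,
      forall v w, (X = Euclidean -> hd v = 0 /\ hd w = 0) ->
        met X (v *m F) (w *m F) = met X v w
    & forall z, Mod X z -> Mod X (z *m F)].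

Lemma Mod_or_opp w : X <> Spherical -> bil X w w = 1 -> Mod X w \/ Mod X (- w).
Proof.
move=> nS bw; have hw : hd w != 0.
  move: bw; rewrite /bil /curv; case: X nS => //= _; have := dot_ge0 (tl w);
    by move=> t0; apply: contra_eq_neq => ->; rewrite mul0r; lra.
case: (ltgtP (hd w) 0) hw => // hw _; last by left.
by right; split; rewrite ?bilNl ?bilNr ?opprK// hdN oppr_gt0.
Qed.

Lemma isom_sq F x y : isom F -> Mod X x -> Mod X y ->
  sq X (x *m F) (y *m F) = sq X x y.
Proof.
move=> [_ _ iF _] Mx My; rewrite /sq -mulmxBl iF// => E.
by rewrite hdD hdN (Mod_euclid E Mx) (Mod_euclid E My) subrr.
Qed.

Lemma isom1 : isom 1%:M.
Proof.
split; first exact: unitmx1.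
- by move=> v w; rewrite !mulmx1.
- by move=> v w _; rewrite !mulmx1.
- by move=> z; rewrite mulmx1.
Qed.

Lemma isomM F F' : isom F -> isom F' -> isom (F *m F').
Proof.
move=> [uF bF mF MF] [uF' bF' mF' MF']; split.
- by rewrite unitmx_mul uF.
- by move=> v w; rewrite !mulmxA bF' bF.
- move=> v w vw; rewrite !mulmxA mF' ?mF// => E.
  have [hv hw] := vw E; have h0 u : hd u = 0 -> hd (u *m F) = 0.
    move=> hu; have := bF u u; rewrite /bil /curv E !mul0r !addr0 hu mul0r.
    by move=> /eqP; rewrite mulf_eq0 orbb => /eqP.
  by rewrite !h0.
- by move=> z Mz; rewrite mulmxA; exact/MF'/MF.
Qed.

Lemma isomV F : isom F -> isom (invmx F).
Proof.
move=> [uF bF mF MF].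
have bV v w : bil X (v *m invmx F) (w *m invmx F) = bil X v w.
  by rewrite -bF !mulmxKV.
split => //; first by rewrite unitmx_inv.
- move=> v w vw; rewrite -mF ?mulmxKV// => E; have [hv hw] := vw E.
  have h0 u : hd u = 0 -> hd (u *m invmx F) = 0.
    move=> hu; have := bV u u; rewrite /bil /curv E !mul0r !addr0 hu mul0r.
    by move=> /eqP; rewrite mulf_eq0 orbb => /eqP.
  by rewrite !h0.
- move=> z [bz hz]; have [E|nS] := pselect (X = Spherical).
    by split; rewrite ?bV// E.
  have [|//|] := @Mod_or_opp (z *m invmx F) nS; first by rewrite bV.
  move=> /MF; rewrite mulNmx mulmxKV// => -[_ /(_ nS)].
  by rewrite hdN oppr_gt0; have := hz nS; lra.
Qed.

(* The reflection exchanging [a] and [b]: on the model, the coefficient of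
   [a - b] is [(sq z b - sq z a) / sq a b]. *)
Definition swap a b : 'M[R]_d.+1 :=
  1%:M - (sq X a b)^-1 *:
    ((2 *: mk (k * hd (a - b)) (tl (a - b)) +
      ((1 - k ^+ 2) * (dot (tl b) (tl b) - dot (tl a) (tl a))) *: mk 1 0)^T *m (a - b)).

Section Swap.
Variables a b : V.
Hypotheses (Ma : Mod X a) (Mb : Mod X b) (ab : a <> b).
Local Notation S := (swap a b).

Let s := sq X a b.
Let lam z := 2 * met X z (a - b) +
  (1 - k ^+ 2) * (dot (tl b) (tl b) - dot (tl a) (tl a)) * hd z.

Let s0 : s != 0.
Proof. by rewrite gt_eqF// sq_gt0//; apply/eqP. Qed.

Lemma swapE z : z *m S = z - (lam z / s) *: (a - b).
Proof.
rewrite /swap mulmxBr mulmx1 -scalemxAr mulmxA; congr (_ - _).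
have -> (n : V) : z *m n^T = (dot n z)%:M.
  apply/rowP => i; rewrite ord1 !mxE eqxx mulr1n.
  by apply: eq_bigr => j _; rewrite mxE mulrC.
rewrite mul_scalar_mx scalerA mulrC; congr ((_ / _) *: _).
rewrite dotDl !dotZl !dot_hdtl !hd_mk !tl_mk dot0l addr0 mul1r /lam /met.
by rewrite (dotC (tl z)); ring.
Qed.

Let lam_hd0 z : (X = Euclidean -> hd z = 0) -> lam z = 2 * met X z (a - b).
Proof.
rewrite /lam => hz; have [E|nE] := pselect (X = Euclidean).
  by rewrite hz// mulr0 addr0.
by rewrite expr2 curv2// subrr !mul0r addr0.
Qed.

Let hd_ab : X = Euclidean -> hd (a - b) = 0.
Proof. by move=> E; rewrite hdD hdN (Mod_euclid E Ma) (Mod_euclid E Mb) subrr. Qed.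

Let lam_Mod z : Mod X z -> lam z = sq X z b - sq X z a.
Proof.
move=> Mz; have [E|nE] := pselect (X = Euclidean).
  have hz := Mod_euclid E Mz.
  rewrite !sq_euclid// /lam hz /met /curv E expr2 !mul0r subr0 mul1r mulr1 addr0.
  by rewrite !hdtlE !dotE (dotC (tl b) (tl z)) (dotC (tl a) (tl z)); ring.
rewrite lam_hd0 ?sq_bil// met_bil// !bilE; ring.
Qed.

Lemma swap_Mod z : Mod X z -> z *m S = z - ((sq X z b - sq X z a) / sq X a b) *: (a - b).
Proof. by move=> Mz; rewrite swapE lam_Mod. Qed.

Let lam_ab : lam (a - b) = 2 * s.
Proof. by rewrite lam_hd0// /s /sq. Qed.

Lemma swap_invol : S *m S = 1%:M.
Proof.
apply/row_matrixP => i; rewrite row_mul (rowE i S) row1; set z := delta_mx 0 i.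
rewrite [z *m S]swapE mulmxBl -scalemxAl !swapE lam_ab.
apply/rowP => j; rewrite !mxE; field; exact: s0.
Qed.

Lemma swapl : a *m S = b.
Proof.
rewrite swapE lam_Mod// sqxx subr0 mulfV// scale1r.
by rewrite opprB addrCA subrr addr0.
Qed.

Lemma swapr : b *m S = a.
Proof. by rewrite -{1}swapl -mulmxA swap_invol mulmx1. Qed.

Lemma swap_fix z : Mod X z -> sq X z a = sq X z b -> z *m S = z.
Proof. by move=> Mz e; rewrite swapE lam_Mod// e subrr mul0r scale0r subr0. Qed.

Lemma swap_isom : isom S.
Proof.
have metS v w : (X = Euclidean -> hd v = 0 /\ hd w = 0) ->
    met X (v *m S) (w *m S) = met X v w.
  move=> vw; rewrite !swapE !lam_hd0; [|by move=> /vw[]|by move=> /vw[]].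
  rewrite !(metDl, metDr, metNl, metNr, metZl, metZr) -!/(met X _ _).
  have sE : met X a a - met X a b - (met X b a - met X b b) = s.
    by rewrite /s /sq !metE; ring.
  rewrite (metC X a w) (metC X b w).
  have -> : met X b b = s - met X a a + met X a b + met X b a by rewrite -sE; ring.
  by rewrite (metC X b a); field; exact: s0.
have bilS v w : bil X (v *m S) (w *m S) = bil X v w.
  have [E|nE] := pselect (X = Euclidean); last first.
    by rewrite !bil_met// metS.
  rewrite /bil /curv E !mul0r !addr0 !swapE.
  by rewrite !(hdD _ (- _)) !hdN !hdZ hd_ab// !mulr0 !subr0.
split=> //.
  have /mulmx1_unit[//] := swap_invol.
move=> z Mz; have [E|nS] := pselect (X = Spherical).
  by split; rewrite ?bilS ?Mz.1// => /(_ E).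
have [|//|MN] := @Mod_or_opp (z *m S) nS; first by rewrite bilS Mz.1.
exfalso; have [E|nE] := pselect (X = Euclidean).
  have := Mod_euclid E MN; rewrite hdN swapE hdD hdN hdZ hd_ab// mulr0 subr0.
  by rewrite (Mod_euclid E Mz); lra.
have H : X = Hyperbolic by case: X nS nE.
(* Since [a = b *m S], landing on the wrong sheet would make both [bil X z b] and its opposite at
   least 1. *)
have := bil_hyp_ge1 H MN Ma; rewrite -{2}swapr bilNl bilS.
by have := bil_hyp_ge1 H Mz Mb; lra.
Qed.

End Swap.

(** Two reflections suffice: the second exchanges the image of [c] with [c'] and fixes [x'], which
    is equidistant from them. *)
Lemma isom_pair x c x' c' : Mod X x -> Mod X c -> Mod X x' -> Mod X c' ->
  sq X x c = sq X x' c' -> exists F, [/\ isom F, x *m F = x' & c *m F = c'].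
Proof.
move=> Mx Mc Mx' Mc' e.
have [F [iF xF]] : exists F, isom F /\ x *m F = x'.
  have [->|xx'] := pselect (x = x'); first by exists 1%:M; rewrite mulmx1; split => //; exact: isom1.
  by exists (swap x x'); rewrite swapl//; split => //; exact: swap_isom.
have McF : Mod X (c *m F) by have [_ _ _] := iF; apply.
have [cc'|cc'] := pselect (c *m F = c'); first by exists F.
exists (F *m swap (c *m F) c'); split.
- by apply: isomM => //; exact: swap_isom.
- rewrite mulmxA xF swap_fix// -e -(isom_sq iF Mx Mc) xF//.
- by rewrite mulmxA swapl.
Qed.

End Dim.
End Isometries.

Section Act.
Context {R : realType}.
Variables (X : geometry) (d : nat).
Local Notation V := 'rV[R]_d.+1.
Implicit Types (v w : V) (F : 'M[R]_d.+1).

Definition unhomog : V -> ambient R X d :=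
  match X return V -> ambient R X d with Euclidean => tl | _ => id end.

Definition act F (z : ambient R X d) : ambient R X d := unhomog (homog z *m F).

Lemma unhomogK w : Mod X w -> homog (unhomog w) = w.
Proof.
have := @Mod_euclid R X d w; rewrite /homog /unhomog; case: X => //= + Mw.
by move=> /(_ erefl Mw) hw; apply: hdtlP; rewrite !hdtlE.
Qed.

Lemma unhomog_model w : Mod X w -> model R X d (unhomog w).
Proof. by move=> Mw; apply/homogP; rewrite unhomogK. Qed.

Lemma homogK z : unhomog (homog z) = z.
Proof. by rewrite /homog /unhomog; case: X z => //= z; rewrite tl_mk. Qed.

Lemma homog_act F z : isom X F -> model R X d z -> homog (act F z) = homog z *m F.
Proof. by move=> [_ _ _ MF] /homogP/MF Mz; rewrite unhomogK. Qed.

Lemma act_model F z : isom X F -> model R X d z -> model R X d (act F z).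
Proof. by move=> [_ _ _ MF] /homogP/MF Mz; exact: unhomog_model. Qed.

Lemma actK F z : isom X F -> model R X d z -> act (invmx F) (act F z) = z.
Proof.
move=> iF Mz; have [uF _ _ _] := iF.
by rewrite -[LHS]/(unhomog (homog (act F z) *m _)) homog_act// mulmxK// homogK.
Qed.

Lemma actVK F z : isom X F -> model R X d z -> act F (act (invmx F) z) = z.
Proof. by move=> iF Mz; rewrite -{1}(invmxK F) actK//; exact: isomV. Qed.

Lemma act_congruence F : isom X F -> congruence (act F).
Proof.
move=> iF; split; last first.
  move=> x y Mx My; rewrite (distE (act_model iF Mx) (act_model iF My)) (distE Mx My).
  rewrite !homog_act//.
  by rewrite isom_sq//; apply/homogP.
split.
- by move=> z; exact: act_model.
- move=> x y; rewrite !inE => Mx My e.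
  by rewrite -(actK iF Mx) e actK.
- move=> z Mz; exists (act (invmx F) z); last exact: actVK.
  by apply: act_model => //; exact: isomV.
Qed.

(** In the Euclidean case the first column of [F] is that of the identity, so the block left after
    deleting the first row and column is the linear part and has the same determinant. *)
Lemma act_orientation F : isom X F -> 0 < \det F -> orientation_preserving (act F).
Proof.
rewrite /orientation_preserving /act /unhomog /homog => iF dF.
case: X iF => iF.
- by exists F, 0; split => // x _; rewrite addr0.
- have [_ bF _ _] := iF.
  have h0 w : hd w = 0 -> hd (w *m F) = 0.
    move=> hw; have := bF w w; rewrite /bil /= !mul0r !addr0 hw mul0r.
    by move=> /eqP; rewrite mulf_eq0 orbb => /eqP.
  have F0 i : F (lift ord0 i) ord0 = 0.
    have := h0 (delta_mx 0 (lift ord0 i)); rewrite -rowE /hd !mxE; apply.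
    by rewrite andbF.
  have F00 : F ord0 ord0 = 1.
    have M1 : Mod Euclidean (mk 1 0 : V).
      by split; rewrite /bil ?hd_mk /= ?mul0r ?addr0 ?mulr1.
    have [_ _ _ /(_ _ M1)] := iF; move=> /(Mod_euclid erefl) <-.
    have -> : mk 1 0 = delta_mx 0 0 :> V.
      apply: hdtlP; rewrite !hdtlE /hd ?mxE// .
      by apply/rowP => i; rewrite !mxE.
    by rewrite -rowE /hd mxE.
  exists (row' ord0 (col' ord0 F)), (tl (mk 1 0 *m F)); split.
    move: dF; rewrite (expand_det_col F ord0) big_ord_recl big1 ?addr0.
      by rewrite F00 mul1r /cofactor expr0 mul1r.
    by move=> i _; rewrite F0 mul0r.
  move=> x _; have -> : mk 1 x = mk 0 x + mk 1 0 :> V.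
    by apply: hdtlP; rewrite !hdtlE ?add0r ?addr0.
  rewrite mulmxDl tlD; congr (_ + _); apply/rowP => j; rewrite !mxE big_ord_recl.
  rewrite -[mk 0 x 0 ord0]/(hd (mk 0 x)) hd_mk mul0r add0r; apply: eq_bigr => i _.
  by rewrite !mxE liftK.
- by exists F, 0; split => // x _; rewrite addr0.
Qed.

End Act.

(** * Unified trigonometry and a geodesic axis *)

Section Trigonometry.
Context {R : realType}.
Variables (X : geometry).
Local Notation k := (curv X : R).
Implicit Types a b s t : R.

Definition gcos t : R := match X with
  | Spherical => cos t | Euclidean => 1 | Hyperbolic => (expR t + expR (- t)) / 2 end.
Definition gsin t : R := match X with
  | Spherical => sin t | Euclidean => t | Hyperbolic => (expR t - expR (- t)) / 2 end.

Lemma cn0 : gcos 0 = 1.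
Proof. by rewrite /gcos; case: X; rewrite ?cos0// oppr0 expR0; field. Qed.
Lemma sn0 : gsin 0 = 0.
Proof. by rewrite /gsin; case: X; rewrite ?sin0// oppr0 expR0 subrr mul0r. Qed.
Lemma cnN t : gcos (- t) = gcos t.
Proof. by rewrite /gcos; case: X; rewrite ?cosN// opprK addrC. Qed.
Lemma snN t : gsin (- t) = - gsin t.
Proof. by rewrite /gsin; case: X; rewrite ?sinN// opprK -mulNr opprB. Qed.

Lemma cn_sn t : gcos t ^+ 2 + k * gsin t ^+ 2 = 1.
Proof.
rewrite /gcos /gsin /curv; case: X; first by rewrite mul1r cos2Dsin2.
  by rewrite expr1n mul0r addr0.
by rewrite expRN; field; rewrite gt_eqF// expR_gt0.
Qed.

Lemma cnB a b : gcos (a - b) = gcos a * gcos b + k * (gsin a * gsin b).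
Proof.
rewrite /gcos /gsin /curv; case: X; first by rewrite mul1r cosB.
  by rewrite mul0r addr0 mulr1.
by rewrite opprB !expRD !expRN; field; rewrite !gt_eqF// expR_gt0.
Qed.

Lemma snB a b : gsin (a - b) = gsin a * gcos b - gcos a * gsin b.
Proof.
rewrite /gcos /gsin; case: X; first by rewrite sinB.
  by rewrite mulr1 mul1r.
by rewrite opprB !expRD !expRN; field; rewrite !gt_eqF// expR_gt0.
Qed.

Lemma sn_gt0 t : 0 < t -> (X = Spherical -> t < pi) -> 0 < gsin t.
Proof.
rewrite /gsin; case: X => // t0 tpi; first by apply: sin_gt0_pi; rewrite t0 tpi.
by rewrite divr_gt0// subr_gt0 ltr_expR; lra.
Qed.

Lemma cn_gt0 t : (X = Spherical -> `|t| < pi / 2) -> 0 < gcos t.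
Proof.
rewrite /gcos; case: X => // H; last by rewrite divr_gt0// addr_gt0// expR_gt0.
by apply: cos_gt0_pihalf; rewrite -ltr_norml H.
Qed.

End Trigonometry.

Section Axis.
Context {R : realType}.
Variables (X : geometry) (d : nat).
Local Notation k := (curv X : R).
Local Notation cn := (@gcos R X).
Local Notation sn := (@gsin R X).
Local Notation V := 'rV[R]_d.+3.
Implicit Types (a b s t : R) (v w x c : V) (F : 'M[R]_d.+3).

Definition axis_dir : 'rV[R]_d.+2 := delta_mx 0 0.
Local Notation e1 := axis_dir.

(** All placements are normalised to this unit speed geodesic. The index [d.+3] means dimension at
    least 2, so the last coordinate is transverse to the axis. *)
Definition axis t : V := mk (cn t) (sn t *: e1).
Local Notation gamma := axis.

Lemma hd_gamma t : hd (gamma t) = cn t. Proof. by rewrite hd_mk. Qed.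
Lemma tl_gamma t : tl (gamma t) = sn t *: e1. Proof. by rewrite tl_mk. Qed.

Lemma dot_e1 : dot e1 e1 = 1.
Proof. by rewrite dot_delta mxE !eqxx. Qed.

Lemma bil_gamma s t : bil X (gamma s) (gamma t) = cn (s - t).
Proof. by rewrite /bil !hd_gamma !tl_gamma !dotE dot_e1 cnB; ring. Qed.

Lemma Mod_gamma t : Mod X (gamma t).
Proof.
split=> [|nS]; first by rewrite bil_gamma subrr cn0.
by rewrite hd_gamma cn_gt0.
Qed.

Lemma sq_gamma s t : sq X (gamma s) (gamma t) =
  (sn s - sn t) ^+ 2 + k * (cn s - cn t) ^+ 2.
Proof.
by rewrite /sq /met !hdtlE ?hd_gamma ?tl_gamma !dotE dot_e1; ring.
Qed.

Lemma gamma_comb a b t :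
  sn (a - b) *: gamma t = sn (t - b) *: gamma a + sn (a - t) *: gamma b.
Proof.
apply: hdtlP; rewrite !(hdtlE, hd_gamma, tl_gamma).
  by rewrite !snB; ring.
by rewrite !scalerA -scalerDl; congr (_ *: _); rewrite !snB; ring.
Qed.

Lemma dist_of_gamma s t : (X = Spherical -> `|s - t| <= pi) ->
  dist_of X (sq X (gamma s) (gamma t)) = `|s - t|.
Proof.
have := @sq_bil R X _ (gamma s) (gamma t); rewrite bil_gamma => sB.
have nrm : cn (s - t) = cn `|s - t|.
  by case: (ger0P (s - t)) => _; rewrite ?cnN.
rewrite /dist_of; move: sB nrm (Mod_gamma s) (Mod_gamma t).
set u := `|s - t|; have u0 : 0 <= u by rewrite normr_ge0.
rewrite sq_gamma /gcos /gsin /curv; case: X => sB nrm Ms Mt upi.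
- rewrite sB// nrm -[RHS]cosK ?in_itv/= ?u0 ?upi//; congr acos; by field.
- by rewrite mul0r addr0 sqrtr_sqr.
- rewrite sB// nrm /arcosh expRN; have e0 := expR_gt0 u.
  have e1' : 1 <= expR u by rewrite -expR0 ler_expR.
  set E := expR u in e0 e1' *.
  have -> : 1 + 2 * -1 * (1 - (E + E^-1) / 2) / 2 = (E + E^-1) / 2 by field; rewrite gt_eqF.
  have -> : ((E + E^-1) / 2) ^+ 2 - 1 = ((E - E^-1) / 2) ^+ 2 by field; rewrite gt_eqF.
  have Ei : E^-1 <= 1 by rewrite invf_le1.
  rewrite sqrtr_sqr ger0_norm; last by rewrite divr_ge0// subr_ge0; lra.
  have -> : (E + E^-1) / 2 + (E - E^-1) / 2 = E by field; rewrite gt_eqF.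
  by rewrite expRK.
Qed.

(* Fixes the axis pointwise, so it can correct the orientation of a placement. *)
Definition flip : 'M[R]_d.+3 := diag_mx (\row_j (if j == ord_max then -1 else 1)).

Lemma flip_isom : isom X flip.
Proof.
have fE v j : (v *m flip) 0 j = v 0 j * (if j == ord_max then -1 else 1).
  by rewrite mul_mx_diag !mxE.
have hdf v : hd (v *m flip) = hd v by rewrite /hd fE mulr1.
have tlf v w : dot (tl (v *m flip)) (tl (w *m flip)) = dot (tl v) (tl w).
  apply: eq_bigr => i _; rewrite ![tl _ 0 i]mxE !fE.
  by case: ifP => _; ring.
split.
- have /mulmx1_unit[//] : flip *m flip = 1%:M.
  apply/matrixP => i j; rewrite mul_diag_mx !mxE.
  have [->|ij] := eqVneq i j; rewrite ?mulr0n ?mulr0 ?mulr1n//=.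
  by case: (j == ord_max); ring.
- by move=> v w; rewrite /bil !hdf tlf.
- by move=> v w _; rewrite /met !hdf tlf.
- by move=> z [bz hz]; split; rewrite /bil !hdf ?tlf.
Qed.

Lemma flip_gamma t : gamma t *m flip = gamma t.
Proof.
apply/rowP => j; rewrite mul_mx_diag !mxE; case: eqP => [->|_]; last by rewrite mulr1.
have -> : ord_max = lift ord0 (ord_max : 'I_d.+2) by apply: val_inj.
by rewrite liftK !mxE /= mulr0 mul0r.
Qed.

Lemma det_flip : \det flip = -1.
Proof.
rewrite det_diag (bigD1 ord_max)//= big1 ?mulr1; first by rewrite mxE eqxx.
by move=> j jm; rewrite mxE (negPf jm).
Qed.

Lemma place_gamma x c s t : Mod X x -> Mod X c ->
  sq X x c = sq X (gamma s) (gamma t) ->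
  exists F, [/\ isom X F, 0 < \det F, x *m F = gamma s & c *m F = gamma t].
Proof.
move=> Mx Mc e; have [F [iF xF cF]] := isom_pair Mx Mc (Mod_gamma s) (Mod_gamma t) e.
have [uF _ _ _] := iF; have : \det F != 0 by rewrite -unitfE -unitmxE.
case: (ltgtP (\det F) 0) => // dF _; last by exists F.
exists (F *m flip); rewrite !mulmxA xF cF !flip_gamma; split => //.
  by apply: isomM => //; exact: flip_isom.
by rewrite det_mulmx det_flip mulrN1 oppr_gt0.
Qed.

End Axis.

(** * Convex bodies as cones *)

Section ModelCones.
Context {R : realType}.
Variables (X : geometry).
Local Notation k := (curv X : R).

Lemma dist_of0 : dist_of X (0 : R) = 0.
Proof.
have := @dist_of_gamma R X 0 0 0; rewrite sqxx subrr normr0; apply => _.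
exact: pi_ge0.
Qed.

(** The bound is the squared chord of two axis points at distance [m], which spares an inversion of
    [dist_of] in each geometry; [m] at most 1 keeps them within pi on the sphere. *)
Lemma dist_of_small (e : R) : 0 < e -> exists2 e', 0 < e' &
  forall t, sq_range X t -> t < e' -> dist_of X t < e.
Proof.
move=> e0; pose m := Num.min e 1.
have m0 : 0 < m by rewrite lt_min e0 ltr01.
have m1 : m <= 1 by rewrite ge_min lexx orbT.
have me : m <= e by rewrite ge_min lexx.
have p2 := @pi_ge2 R.
pose q : R := sq X (@axis R X 0 0) (@axis R X 0 m).
have qr : sq_range X q by apply: sq_inr; exact: Mod_gamma.
have dq : dist_of X q = m.
  by rewrite dist_of_gamma ?sub0r ?normrN gtr0_norm// => _; lra.
exists q => [|t rt tq].
  rewrite lt_def qr.1 andbT; apply/eqP => q0.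
  by move: dq; rewrite q0 dist_of0; lra.
by apply: lt_le_trans me; rewrite -dq dist_of_lt.
Qed.

Lemma sq_small (e : R) : 0 < e -> exists2 e', 0 < e' &
  forall t, sq_range X t -> dist_of X t < e' -> t < e.
Proof.
move=> e0; pose m := Num.min e 4.
have m0 : 0 < m by rewrite lt_min e0/=; lra.
have mr : sq_range X m by split; [exact: ltW|rewrite ge_min lexx orbT].
have zr : sq_range X (0 : R) by split => // _; lra.
exists (dist_of X m) => [|t rt].
  by rewrite -dist_of0 dist_of_lt.
rewrite dist_of_ltE// => /lt_le_trans; apply.
by rewrite ge_min lexx.
Qed.

Section Dim.
Context {d : nat}.
Local Notation V := 'rV[R]_d.+1.
Local Notation P := (ambient R X d).
Implicit Types (v w : V) (x y z c : P) (A K : set P).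

Definition cone A : set V := [set w | exists a z, [/\ 0 < a, A z & w = a *: homog z]].

Lemma Mod_scale_eq (a b : R) v w : Mod X v -> Mod X w -> 0 < a -> 0 < b ->
  a *: v = b *: w -> a = b /\ v = w.
Proof.
move=> [bv _] [bw _] a0 b0 e; have ab : a = b.
  have := congr1 (fun u => bil X u u) e; rewrite !bilE bv bw !mulr1 -!expr2.
  by move=> /eqP; rewrite eqf_sqr => /orP[/eqP//|/eqP H]; lra.
by split => //; move: e; rewrite ab => /scalerI; apply; rewrite gt_eqF.
Qed.

Lemma cone_homog A z : A `<=` model R X d -> model R X d z ->
  cone A (homog z) <-> A z.
Proof.
move=> AM Mz; split=> [[a [y [a0 Ay]]]|Az]; last first.
  by exists 1, z; rewrite scale1r.
rewrite -[LHS]scale1r => /Mod_scale_eq[]//; try exact/homogP; try exact/homogP/AM.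
by move=> _ /homog_inj ->.
Qed.

Lemma cone_scaleP A (a : R) w : 0 < a -> cone A w -> cone A (a *: w).
Proof.
move=> a0 [b [z [b0 Az ->]]]; exists (a * b), z; rewrite mulr_gt0//.
by split => //; rewrite scalerA.
Qed.

Lemma inner_coneP A z : A `<=` model R X d -> model R X d z ->
  geo_interior A z <-> inner (cone A) (homog z).
Proof.
move=> AM Mz; have Mz' : Mod X (homog z) by apply/homogP.
split=> [[_ [e e0 eA]]|].
  have [e' e'0 e'P] := dist_of_small e0.
  apply: filterS (Mod_near Mz' e'0) => w [a [v [a0 Mv -> vz]]].
  have [y My yv] := homog_onto Mv; exists a, y; rewrite yv; split => //.
  apply: eA => //; rewrite distE// yv sqC; apply: e'P => //; exact: sq_inr.
move=> /(near_Mod Mz')[e e0 eP]; split => //.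
have [e' e'0 e'P] := sq_small e0; exists e' => // y My zy.
have My' : Mod X (homog y) by apply/homogP.
apply/(cone_homog AM My)/eP => //; rewrite sqC; apply: e'P; first exact: sq_inr.
by rewrite -distE.
Qed.

Lemma closureP A z : A `<=` model R X d -> model R X d z ->
  (forall Q : set V, (\forall w \near homog z, Q w) -> exists2 y, A y & Q (homog y)) ->
  geo_closure A z.
Proof.
move=> AM Mz H; split => // e e0; have [e' e'0 e'P] := dist_of_small e0.
have Mz' : Mod X (homog z) by apply/homogP.
have [|y Ay /= yz] := H [set w | 0 < e' - sq X (homog z) w].
  apply: near_pos; last by rewrite sqxx subr0.
  apply: (@continuousB R R^o V (fun=> e') (sq X (homog z))); first exact: cst_continuous.
  exact: sq_continuous.
have My := AM _ Ay; have My' : Mod X (homog y) by apply/homogP.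
exists y => //; rewrite distE//; apply: e'P; first exact: sq_inr.
by move: yz; rewrite subr_gt0.
Qed.

(** On the sphere boundedness is automatic. In hyperbolic space [hd z * (hd c - |tl c|)], with the
    Euclidean norm, is at most [bil X z c], and [hd c] exceeds [|tl c|], so a bounded distance
    bounds the ambient coordinates. *)
Lemma homog_compact K : geo_closed K -> K `<=` model R X d ->
  (X <> Spherical -> exists2 c, model R X d c & exists M, forall z, K z ->
     sq X (homog z) (homog c) <= M) ->
  compact (@homog R X d @` K).
Proof.
move=> cK KM bK; apply: bounded_closed_compact; last first.
  move=> w clw.
  have Mw : Mod X w.
    split.
      have cl1 : closed [set v : V | bil X v v = 1].
        have -> : [set v : V | bil X v v = 1] = (fun v => bil X v v) @^-1` [set x | x = 1] by [].
        by apply: preimage_closed; [move=> ? _; exact: bil_continuous|exact: closed_eq].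
      by apply: cl1 => B /clw[_ [[z Kz <-] Bz]]; exists (homog z); split => //; have [] := (homogP z).1 (KM _ Kz).
    move=> nS; have hw : 0 <= hd w.
      have cl1 : closed [set v : V | 0 <= hd v].
        have -> : [set v : V | 0 <= hd v] = hd @^-1` [set x | 0 <= x] by [].
        by apply: preimage_closed; [move=> ? _; exact: hd_continuous|exact: closed_ge].
      by apply: cl1 => B /clw[_ [[z Kz <-] Bz]]; exists (homog z); split => //; have [_ /(_ nS)/ltW] := (homogP z).1 (KM _ Kz).
    have b1 : bil X w w = 1.
      have cl1 : closed [set v : V | bil X v v = 1].
        have -> : [set v : V | bil X v v = 1] = (fun v => bil X v v) @^-1` [set x | x = 1] by [].
        by apply: preimage_closed; [move=> ? _; exact: bil_continuous|exact: closed_eq].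
      by apply: cl1 => B /clw[_ [[z Kz <-] Bz]]; exists (homog z); split => //; have [] := (homogP z).1 (KM _ Kz).
    have [[_ /(_ nS)//]|[_ /(_ nS)]] := Mod_or_opp nS b1.
    by rewrite hdN; lra.
  have [z Mz zw] := homog_onto Mw; exists z => //; apply: cK.
  apply: closureP => // Q; rewrite zw => /clw[_ [[y Ky <-] Qy]].
  by exists y.
suff [C CP] : exists C : R, forall z, K z -> dot (homog z) (homog z) <= C.
  exists (1 + C); split; first exact: num_real.
  move=> x xC _ [z Kz <-]; apply: le_trans (ltW xC).
  have := sqr_norm_le_dot (homog z : V); have := CP _ Kz.
  set n := `|_|; have := sqr_ge0 (n - 1); nra.
have [E|nS] := pselect (X = Spherical).
  exists 1 => z /KM/homogP[+ _]; rewrite dot_hdtl /bil.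
  have -> : k = 1 by rewrite /curv E.
  by rewrite mul1r => ->.
have [c Mc [M KM2]] := bK nS; have Mc' : Mod X (homog c) by apply/homogP.
have [E|nE] := pselect (X = Euclidean).
  exists (1 + 2 * (M + dot (tl (homog c)) (tl (homog c)))) => z Kz.
  have Mz' : Mod X (homog z) by apply/homogP/KM.
  rewrite dot_hdtl (Mod_euclid E Mz') mul1r lerD2l.
  have := KM2 _ Kz; rewrite sq_euclid//.
  set u := tl (homog z); set u' := tl (homog c).
  have := dot_ge0 (u - 2 *: u'); rewrite !dotE (dotC u' u); lra.
have E : X = Hyperbolic by case: X nS nE.
have k1 : k = -1 by rewrite /curv E.
set h := hd (homog c); have h0 : 0 < h by exact: Mc'.2.
pose p := Num.sqrt (dot (tl (homog c)) (tl (homog c))).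
have p0 : 0 <= p by exact: sqrtr_ge0.
have pp : p ^+ 2 = dot (tl (homog c)) (tl (homog c)) by rewrite sqr_sqrtr ?dot_ge0.
have hp : h ^+ 2 - p ^+ 2 = 1.
  by have := Mc'.1; rewrite /bil k1 -pp expr2 -/h; lra.
have php : p < h by nra.
exists (2 * ((1 + M / 2) / (h - p)) ^+ 2) => z Kz.
have Mz' : Mod X (homog z) by apply/homogP/KM.
have hz0 : 0 < hd (homog z) by exact: Mz'.2.
have zz : hd (homog z) ^+ 2 - dot (tl (homog z)) (tl (homog z)) = 1.
  by have := Mz'.1; rewrite /bil k1 expr2; lra.
have := KM2 _ Kz; rewrite sq_bil// k1 => bM.
have cs := dot_CS (tl (homog z)) (tl (homog c)).
have tzh : dot (tl (homog z)) (tl (homog c)) <= hd (homog z) * p.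
  have q0 : 0 <= hd (homog z) * p by rewrite mulr_ge0// ltW.
  rewrite leNgt; apply/negP => lt1.
  have : (hd (homog z) * p) ^+ 2 < dot (tl (homog z)) (tl (homog c)) ^+ 2.
    by rewrite ltrXn2r.
  move=> /lt_le_trans/(_ cs); rewrite exprMn pp.
  have := dot_ge0 (tl (homog c)); nra.
have hz : hd (homog z) * (h - p) <= 1 + M / 2.
  by move: bM; rewrite /bil k1 -/h; nra.
have hz2 : hd (homog z) <= (1 + M / 2) / (h - p).
  by rewrite ler_pdivlMr// subr_gt0.
have hz3 := lt_le_trans hz0 hz2.
have : hd (homog z) ^+ 2 <= ((1 + M / 2) / (h - p)) ^+ 2.
  by rewrite lerXn2r// nnegrE ltW.
by rewrite dot_hdtl -expr2; lra.
Qed.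

(** [bil] of the combination is [a ^+ 2 + b ^+ 2 + 2 * (a * b) * bil X v w]; it is positive as
    [bil X v w] exceeds -1, antipodal pairs being excluded. *)
Lemma Mod_sum (a b : R) v w : Mod X v -> Mod X w -> 0 <= a -> 0 <= b -> 0 < a + b ->
  (X = Spherical -> w <> - v) ->
  exists (c : R) (u : V), [/\ 0 < c, Mod X u & a *: v + b *: w = c *: u].
Proof.
move=> Mv Mw a0 b0 ab nvw; set s := a *: v + b *: w.
have hs : X <> Spherical -> 0 < hd s.
  move=> nS; have h1 := Mv.2 nS; have h2 := Mw.2 nS; rewrite /s !hdtlE.
  have [a00|aN0] := eqVneq a 0.
    by move: ab; rewrite a00 mul0r !add0r => ab; rewrite mulr_gt0.
  by rewrite ltr_pwDl ?mulr_ge0 ?mulr_gt0// ?ltW// lt_def aN0.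
have bs : 0 < bil X s s.
  have -> : bil X s s = a ^+ 2 + b ^+ 2 + 2 * (a * b) * bil X v w.
    by rewrite /s !bilE (bilC X w v) Mv.1 Mw.1; ring.
  have [E|nE] := pselect (X = Euclidean).
    rewrite /bil /curv E mul0r addr0 (Mod_euclid E Mv) (Mod_euclid E Mw).
    have -> : a ^+ 2 + b ^+ 2 + 2 * (a * b) * (1 * 1) = (a + b) ^+ 2 by ring.
    by rewrite exprn_gt0.
  have [E|nS] := pselect (X = Spherical).
    have k1 : k = 1 by rewrite /curv E.
    have MN : Mod X (- v) by split; rewrite ?bilNl ?bilNr ?opprK ?Mv.1// E.
    have : 0 < sq X w (- v) by apply: sq_gt0 => //; apply/eqP; exact: nvw.
    rewrite sq_bil// k1 bilNr (bilC X w) => bvw.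
    have b1 : -1 < bil X v w by lra.
    have [a00|aN0] := eqVneq a 0.
      move: ab; rewrite a00 expr0n/= !(mul0r, mulr0) !add0r addr0 => ab.
      by rewrite exprn_gt0.
    have a1 : 0 < a by rewrite lt_def aN0.
    have [->|bN0] := eqVneq b 0.
      by rewrite expr0n/= !(mul0r, mulr0) !addr0 exprn_gt0.
    have b2 : 0 < b by rewrite lt_def bN0.
    have bv0 : 0 < bil X v w + 1 by move: b1; clear; lra.
    have := mulr_gt0 (mulr_gt0 a1 b2) bv0; have := sqr_ge0 (a - b).
    by clear; lra.
  have E : X = Hyperbolic by case: X nE nS.
  have b1 : 0 <= bil X v w - 1 by rewrite subr_ge0 bil_hyp_ge1.
  have := mulr_ge0 (mulr_ge0 a0 b0) b1; have : 0 < (a + b) ^+ 2 by rewrite exprn_gt0.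
  by clear; lra.
pose c := Num.sqrt (bil X s s); have c0 : 0 < c by rewrite sqrtr_gt0.
have cc : c * c = bil X s s by rewrite -expr2 sqr_sqrtr// ltW.
exists c, (c^-1 *: s); split => //; last by rewrite scalerA mulfV ?gt_eqF// scale1r.
split; last by move=> /hs; rewrite hdZ pmulr_rgt0// invr_gt0.
by rewrite bilZl bilZr -cc; field; rewrite gt_eqF.
Qed.

End Dim.
End ModelCones.

Section Bodies.
Context {R : realType}.
Variables (X : geometry) (d : nat).
Local Notation k := (curv X : R).
Local Notation V := 'rV[R]_d.+1.
Local Notation P := (ambient R X d).
Implicit Types (v w : V) (x y z c : P) (A B K S : set P).

(** A supporting sphere at [x] in terms of squared chords: positive radius is [x <> c], and radius
    below pi/2 is a squared chord below 2. *)
Definition supp_center K x c : Prop :=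
  [/\ model R X d c, x <> c, X = Spherical -> sq X (homog x) (homog c) < 2
    & forall z, K z -> sq X (homog z) (homog c) <= sq X (homog x) (homog c)].

(** The last field is what compactness of the base needs; [body_of_supports] gets it from the
    supporting ball at a single boundary point. *)
Record body K : Prop := Body {
  body_model : K `<=` model R X d;
  body_closed : geo_closed K;
  body_convex : geo_convex K;
  body_inner : geo_interior K !=set0;
  body_region : exists2 S, region S & K `<=` S;
  body_supp : forall x, geo_boundary K x -> exists c, supp_center K x c;
  body_bounded : X <> Spherical -> exists2 c, model R X d c & exists M, forall z, K z ->
     sq X (homog z) (homog c) <= M }.

Lemma dist_of2 : X = Spherical -> dist_of X (2 : R) = pi / 2.
Proof.
rewrite /dist_of => ->; have -> : 1 - 2 / 2 = 0 :> R by field.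
by rewrite acos0.
Qed.

Lemma supp_centerP K x : K `<=` model R X d -> model R X d x ->
  has_supporting_sphere K x -> exists c, supp_center K x c.
Proof.
move=> KM Mx [c [r [Mc [r0 rS] Kb cx]]]; exists c.
have Mx' : Mod X (homog x) by apply/homogP.
have Mc' : Mod X (homog c) by apply/homogP.
split => //.
- move=> xc; move: cx; rewrite xc distE// sqxx dist_of0 => r00.
  by move: r0; rewrite r00 ltxx.
- move=> E; rewrite sqC -(@dist_of_ltE R X).
  + by rewrite -distE// cx dist_of2//; exact: rS.
  + exact: sq_inr.
  + by split => // _; lra.
- move=> z Kz; have Mz := KM _ Kz; have Mz' : Mod X (homog z) by apply/homogP.
  have [_] := Kb _ Kz; rewrite -cx !distE// dist_of_leE; [|exact: sq_inr|exact: sq_inr].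
  by rewrite (sqC X (homog c)) (sqC X (homog c)).
Qed.

Lemma boundaryP K z : K `<=` model R X d -> geo_closed K ->
  geo_boundary K z <-> K z /\ ~ inner (cone K) (homog z).
Proof.
move=> KM cK; split=> [[clz nint]|[Kz nint]].
  have Kz := cK _ clz; split => //.
  by move=> /(inner_coneP KM (KM _ Kz)).
split; last by move=> /(inner_coneP KM (KM _ Kz)).
split; first exact: KM.
by move=> e e0; exists z => //; rewrite distE ?sqxx ?dist_of0//; exact: KM.
Qed.

Lemma frontier_coneP K w : K `<=` model R X d -> geo_closed K ->
  frontier (cone K) w -> exists (a : R) z, [/\ 0 < a, geo_boundary K z & w = a *: homog z].
Proof.
move=> KM cK [[a [z [a0 Kz ->]]] nint]; exists a, z; split => //.
apply/boundaryP => //; split => // iz; apply: nint.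
have ca : {for a *: homog z, continuous (fun v : V => a^-1 *: v)}.
  by apply: scaler_continuous.
have : \forall v \near a *: (homog z : V), cone K (a^-1 *: v).
  by apply: (near_comp ca); rewrite scalerA mulVf ?gt_eqF// scale1r.
apply: filterS => v /(cone_scaleP a0).
by rewrite scalerA mulfV ?gt_eqF// scale1r.
Qed.

Lemma region_form S : region S ->
  exists h : V, forall z, S z -> 0 < dot h (homog z).
Proof.
rewrite /region /homog; case: X S => /= S.
- by move=> [u _ ->]; exists u => z [].
- by move=> _; exists (mk 1 0) => z _; rewrite dot_hdtl !hdtlE dot0l addr0 mul1r.
- move=> ->; exists (mk 1 0) => z [_ z0].
  by rewrite dot_hdtl !hdtlE dot0l addr0 mul1r.
Qed.

Lemma region_model S : region S -> S `<=` model R X d.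
Proof. by rewrite /region; case: X S => /= S; [move=> [u _ ->] z []|move=> ->|move=> ->]. Qed.

Lemma homogN x : X = Spherical -> homog (- x) = - homog x.
Proof. by rewrite /homog; case: X x. Qed.

Lemma cone_addP K S : region S -> K `<=` S -> geo_convex K ->
  forall v w, cone K v -> cone K w -> cone K (v + w).
Proof.
move=> rS KS [KM cK] v w [a [x [a0 Kx ->]]] [b [y [b0 Ky ->]]].
have [h hS] := region_form rS.
have nxy : homog y <> - homog x.
  move=> e; have := hS _ (KS _ Kx); have := hS _ (KS _ Ky).
  by rewrite e dotNr; lra.
have Mx := KM _ Kx; have My := KM _ Ky.
have [||c [u [c0 Mu e]]] := Mod_sum ((homogP x).1 Mx) ((homogP y).1 My) (ltW a0) (ltW b0).
- by rewrite addr_gt0.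
- by [].
have [z Mz zu] := homog_onto Mu; exists c, z; rewrite zu; split => //.
apply: (cK x y) => //.
  by move=> E yx; apply: nxy; rewrite yx homogN.
apply/segmentP => //; split => //; exists (a / c), (b / c).
rewrite !divr_ge0 ?(ltW a0) ?(ltW b0) ?(ltW c0)//; split => //; rewrite zu.
by rewrite ![_ / c]mulrC -!scalerA -scalerDr e scalerA mulVf ?gt_eqF// scale1r.
Qed.

Lemma cone_good K : body K -> good_cone (cone K).
Proof.
move=> [KM cK vK [c ic] [S rS KS] _ bK]; split.
- exact: cone_addP rS KS vK.
- by move=> a w; exact: cone_scaleP.
- have [h hS] := region_form rS.
  exists (@homog R X d @` K), h; split; first exact: homog_compact.
    by move=> _ [z Kz <-]; exact/hS/KS.
  move=> w; split=> [[a [z [a0 Kz ->]]]|[a [_ [a0 [z Kz <-] ->]]]].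
    by exists a, (homog z); split => //; exists z.
  by exists a, z.
- by exists (homog c); apply/inner_coneP => //; case: ic.
Qed.

(** Strict convexity of balls. The Euclidean case is Stewart's formula. Otherwise linearity of [bil]
    in [u] compares [a + b] with 1 (at most 1 on the sphere, where a radius below pi/2 makes
    [bil X u c] positive, at least 1 in hyperbolic space), and [bil X u u = 1] then forces the chord
    of [u1] and [u2] to vanish. *)
Lemma ball_strict (a b : R) (u1 u2 u c : V) : Mod X u1 -> Mod X u2 -> Mod X u -> Mod X c ->
  0 < a -> 0 < b -> u = a *: u1 + b *: u2 ->
  sq X u1 c <= sq X u c -> sq X u2 c <= sq X u c -> (X = Spherical -> sq X u c < 2) ->
  u1 = u2.
Proof.
move=> M1 M2 Mu Mc a0 b0 uE s1 s2 u2S; apply: (sq_eq0 M1 M2).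
have [E|nE] := pselect (X = Euclidean).
  have ab : a + b = 1.
    by have := Mod_euclid E Mu; rewrite uE !hdtlE (Mod_euclid E M1) (Mod_euclid E M2) !mulr1.
  have bE : b = 1 - a by move: ab; clear; lra.
  have H : sq X u c = a * sq X u1 c + b * sq X u2 c - a * b * sq X u1 u2.
    by rewrite !sq_euclid// uE !hdtlE bE !dotE; ring.
  have := sq_ge0 M1 M2; rewrite le_eqVlt => /predU1P[e0|s0]; first by rewrite -e0.
  have := mulr_gt0 (mulr_gt0 a0 b0) s0.
  have h1 := ler_wpM2l (ltW a0) s1; have h2 := ler_wpM2l (ltW b0) s2.
  have h3 : a * sq X u c + b * sq X u c = sq X u c by rewrite -mulrDl ab mul1r.
  lra.
have bu : bil X u c = a * bil X u1 c + b * bil X u2 c by rewrite uE !bilE.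
have uu : 1 = a ^+ 2 + b ^+ 2 + 2 * (a * b) * bil X u1 u2.
  by rewrite -{1}Mu.1 uE !bilE M1.1 M2.1 (bilC X u2); ring.
have ab0 := mulr_gt0 a0 b0.
move: s1 s2 u2S; rewrite !sq_bil//.
set p := bil X u1 c in bu *; set q := bil X u2 c in bu *; set g := bil X u c in bu *.
have [E|nS] := pselect (X = Spherical).
  have k1 : k = 1 by rewrite /curv E.
  have g1 := sq_ge0 M1 M2; rewrite sq_bil// k1 in g1.
  rewrite k1 => s1 s2 /(_ E) s3.
  have h1 : a * g <= a * p by apply: ler_wpM2l; [exact: ltW|move: s1; clear; lra].
  have h2 : b * g <= b * q by apply: ler_wpM2l; [exact: ltW|move: s2; clear; lra].
  have g0 : 0 < g by move: s3; clear; lra.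
  have ab1 : a + b <= 1 by rewrite -(ler_pM2r g0) mul1r mulrDl; move: h1 h2 bu; clear; lra.
  have ab2 : (a + b) ^+ 2 <= 1 by rewrite expr_le1// addr_ge0 ?ltW.
  have : a * b * (1 - bil X u1 u2) <= 0 by move: uu ab2; clear; lra.
  rewrite pmulr_rle0// => h3; move: g1 h3; set g' := bil X u1 u2; clear; lra.
have E : X = Hyperbolic by case: X nS nE.
have k1 : k = -1 by rewrite /curv E.
have g1 := bil_hyp_ge1 E M1 M2; have g0 := bil_hyp_ge1 E Mu Mc; rewrite -/g in g0.
rewrite k1 => s1 s2 _.
have h1 : a * p <= a * g by apply: ler_wpM2l; [exact: ltW|move: s1; clear; lra].
have h2 : b * q <= b * g by apply: ler_wpM2l; [exact: ltW|move: s2; clear; lra].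
have g00 : 0 < g by move: g0; clear; lra.
have ab1 : 1 <= a + b.
  by rewrite -(ler_pM2r g00) mul1r mulrDl; move: h1 h2 bu; clear; lra.
have ab2 : 1 <= (a + b) ^+ 2 by rewrite expr_ge1// addr_ge0 ?ltW.
have : a * b * (bil X u1 u2 - 1) <= 0 by move: uu ab2; clear; lra.
rewrite pmulr_rle0// => h3; move: g1 h3; set g' := bil X u1 u2; clear; lra.
Qed.

(** A segment through a frontier point lies in the supporting ball there, and that ball is strictly
    convex. *)
Lemma cone_strict K : body K -> strict_cone (cone K).
Proof.
move=> bK v w Kv Kw nvw; have KM := body_model bK; have cK := body_closed bK.
have gK := cone_good bK.
have [a [z [a0 bz e]]] := frontier_coneP KM cK (conj (cone_add gK Kv Kw) nvw).
have [c [Mc _ cS Kc]] := body_supp bK bz.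
move: Kv Kw e => [b [x [b0 Kx ->]]] [b' [y [b'0 Ky ->]]] e.
have Kz : K z by have [] := (boundaryP z KM cK).1 bz.
exists (b / b'); suff -> : homog x = homog y :> V.
  by rewrite scalerA divfK ?gt_eqF.
apply: (@ball_strict (b / a) (b' / a) _ _ (homog z) (homog c)); rewrite ?divr_gt0//.
- exact/homogP/KM.
- exact/homogP/KM.
- exact/homogP/KM.
- exact/homogP.
- by rewrite ![_ / a]mulrC -!scalerA -scalerDr e scalerA mulVf ?gt_eqF// scale1r.
- exact: Kc.
- exact: Kc.
Qed.

(** The component of [c] tangent at [x]: the unnormalised initial direction of the geodesic from [x]
    to [c]. *)
Definition toward (x c : V) : V := c - bil X x c *: x.

(* The linear form vanishing on the hyperplane through [x] orthogonal to the
   geodesic from [x] to [c], and negative on the side of [c]. *)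
Definition normal (x c : V) : V :=
  met X x (toward x c) *: mk (hd x) (k *: tl x) -
  mk (k * hd (toward x c)) (tl (toward x c)).

Lemma dot_normal (x c w : V) : dot (normal x c) w = - met X (w - bil X w x *: x) (toward x c).
Proof.
rewrite /normal; move: (toward x c) => t.
rewrite dotDl dotNl dotZl !dot_hdtl !hd_mk !tl_mk dotZl /met /bil.
rewrite !(hdD, hdN, hdZ, tlD, tlN, tlZ) !(dotDl, dotNl, dotZl).
by rewrite (dotC (tl t) (tl w)) (dotC (tl x) (tl w)); ring.
Qed.

End Bodies.

Section Normals.
Context {R : realType}.
Variables (X : geometry) (d : nat).
Local Notation k := (curv X : R).
Local Notation V := 'rV[R]_d.+1.
Local Notation P := (ambient R X d).
Implicit Types (v w : V).

Lemma bil_toward (x c : V) : Mod X x -> bil X (toward X x c) x = 0.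
Proof. by move=> Mx; rewrite bilDl bilNl bilZl Mx.1 mulr1 (bilC X c) subrr. Qed.

Lemma toward_neq0 (x c : V) : Mod X x -> Mod X c -> x <> c ->
  (X = Spherical -> sq X x c < 2) -> toward X x c != 0.
Proof.
move=> Mx Mc xc s2; rewrite subr_eq0; apply/eqP => cE.
have b1 : bil X x c ^+ 2 = 1.
  by have := Mc.1; rewrite {1 2}cE bilZl bilZr Mx.1 mulr1 expr2.
move/eqP: b1; rewrite sqrf_eq1 => /orP[] /eqP b1.
  by apply: xc; rewrite cE b1 scale1r.
have [E|nE] := pselect (X = Euclidean).
  move: b1; rewrite /bil /curv E mul0r addr0 (Mod_euclid E Mx) (Mod_euclid E Mc).
  by clear -X d; lra.
have [E|nS] := pselect (X = Spherical).
  have := s2 E; rewrite sq_bil// b1; have -> : k = 1 by rewrite /curv E.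
  by clear -X d; lra.
have E : X = Hyperbolic by move: nS nE; case: (X).
by have := bil_hyp_ge1 E Mx Mc; rewrite b1; clear -X d; lra.
Qed.

Lemma met_toward (x c : V) : Mod X x -> Mod X c ->
  met X (toward X x c) (toward X x c) =
  if X is Euclidean then sq X x c else k * (1 - bil X x c ^+ 2).
Proof.
move=> Mx Mc; have [E|nE] := pselect (X = Euclidean).
  have b1 : bil X x c = 1.
    by rewrite /bil /curv E mul0r addr0 (Mod_euclid E Mx) (Mod_euclid E Mc) mulr1.
  by rewrite /toward b1 scale1r E sqC.
have -> : met X (toward X x c) (toward X x c) = k * (1 - bil X x c ^+ 2).
  by rewrite met_bil// /toward !bilE Mx.1 Mc.1 (bilC X c x); ring.
by move: nE; case: (X).
Qed.

Lemma normal_neq0 (x c : V) : Mod X x -> toward X x c != 0 -> normal X x c != 0.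
Proof.
move=> Mx t0; apply/eqP => n0; have := dot_normal X x c (toward X x c).
rewrite n0 dot0l bil_toward// scale0r subr0 => /eqP.
by rewrite eq_sym oppr_eq0 gt_eqF//; apply: (met_tangent_gt0 Mx) => //; exact: bil_toward.
Qed.

Lemma dot_normal0 (x c : V) : Mod X x -> dot (normal X x c) x = 0.
Proof.
by move=> Mx; rewrite dot_normal Mx.1 scale1r subrr -(scale0r 0) metZl mul0r oppr0.
Qed.

Lemma dot_normal_le0 (x c z : V) : Mod X x -> Mod X c -> Mod X z ->
  (X = Spherical -> sq X x c < 2) -> sq X z c <= sq X x c -> dot (normal X x c) z <= 0.
Proof.
move=> Mx Mc Mz s2; rewrite dot_normal oppr_le0.
have [E|nE] := pselect (X = Euclidean).
  have b1 u u' : Mod X u -> Mod X u' -> bil X u u' = 1.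
    by move=> M1 M2; rewrite /bil /curv E mul0r addr0 (Mod_euclid E M1) (Mod_euclid E M2) mulr1.
  rewrite /toward !b1// !scale1r !sq_euclid// /met /curv E mul0r addr0 !hdtlE.
  set a := tl z; set b := tl x; set e := tl c.
  have := dot_ge0 (a - b); rewrite !dotE (dotC b a) (dotC e a) (dotC e b).
  by clear -X d; lra.
have zt : met X x (toward X x c) = 0 by rewrite met_bil// bilC bil_toward// mulr0.
rewrite metDl metNl metZl zt mulr0 subr0 met_bil// /toward bilDr bilNr bilZr.
rewrite !sq_bil//; have := sq_ge0 Mz Mx; rewrite sq_bil//.
set p := bil X z x; set q := bil X z c; set g := bil X x c.
have [E|nS] := pselect (X = Spherical).
  have k1 : k = 1 by rewrite /curv E.
  have := s2 E; rewrite sq_bil// -/g k1 => g0 p1 qg.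
  have := mulr_ge0 (_ : 0 <= g) (_ : 0 <= 1 - p).
  have -> : 0 <= g by move: g0; clear -X d; lra.
  have -> : 0 <= 1 - p by move: p1; clear -X d; lra.
  by move=> /(_ isT isT); move: qg; clear -X d; lra.
have E : X = Hyperbolic by move: nS nE; case: (X).
have k1 : k = -1 by rewrite /curv E.
have g1 := bil_hyp_ge1 E Mx Mc; rewrite -/g in g1; rewrite k1 => p1 qg.
have := mulr_ge0 (_ : 0 <= g) (_ : 0 <= p - 1).
have -> : 0 <= g by move: g1; clear -X d; lra.
have -> : 0 <= p - 1 by move: p1; clear -X d; lra.
by move=> /(_ isT isT); move: qg; clear -X d; lra.
Qed.

Lemma normal_supports (K : set P) (x c : P) : K `<=` model R X d -> model R X d x ->
  supp_center K x c -> supports (normal X (homog x) (homog c)) (cone K) (homog x).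
Proof.
move=> KM /homogP Mx [/homogP Mc xc s2 Kc]; split.
- by apply: normal_neq0 => //; apply: toward_neq0 => // /homog_inj.
- exact: dot_normal0.
- move=> w [a [z [a0 Kz ->]]]; rewrite dotZr pmulr_rle0//.
  by apply: dot_normal_le0 => //; [exact/homogP/KM|exact: Kc].
Qed.

(** A point is determined by its direction and distance from [x]. Equal normals give equal
    directions because [met] is definite on tangent vectors. *)
Lemma normal_unique (x c c' : V) (a : R) : Mod X x -> Mod X c -> Mod X c' ->
  sq X x c = sq X x c' -> 0 < a -> normal X x c = a *: normal X x c' -> c = c'.
Proof.
move=> Mx Mc Mc' scc a0 nE; pose t := toward X x c; pose t' := toward X x c'.
have u0 : t - a *: t' = 0.
  apply/eqP; apply: contraT => u0; exfalso.
  have bu : bil X (t - a *: t') x = 0.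
    by rewrite bilDl bilNl bilZl !bil_toward// mulr0 subrr.
  have := met_tangent_gt0 Mx bu u0; rewrite {2}/t metDr metNr metZr.
  have := congr1 (fun n => dot n (t - a *: t')) nE.
  rewrite dotZl !dot_normal bu scale0r subr0 -/t -/t'.
  by move: (met X _ t) (met X _ t') => p q; clear -X d; lra.
have tE : t = a *: t' by apply/eqP; rewrite -subr_eq0 u0.
have bcc : bil X x c = bil X x c'.
  have [E|nEu] := pselect (X = Euclidean).
    by rewrite /bil /curv E !mul0r !addr0 (Mod_euclid E Mc) (Mod_euclid E Mc').
  move: scc; rewrite !sq_bil// => /(congr1 ( *%R k)).
  rewrite !(mulrCA k) !mulrA; have := curv2 (R := R) nEu.
  set b := bil X x c; set b' := bil X x c' => kk.
  have -> : 2 * k * k * (1 - b) = 2 * (k * k) * (1 - b) by ring.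
  have -> : 2 * k * k * (1 - b') = 2 * (k * k) * (1 - b') by ring.
  by rewrite kk; clear -X d; lra.
have cE : c = t + bil X x c *: x by rewrite /t /toward subrK.
have c'E : c' = t' + bil X x c *: x by rewrite bcc /t' /toward subrK.
rewrite cE c'E; congr (_ + _).
have [t'0|t'0] := eqVneq t' 0; first by rewrite tE t'0 scaler0.
have m' : 0 < met X t' t' by apply: (met_tangent_gt0 Mx) => //; exact: bil_toward.
have : met X t t = met X t' t' by rewrite !met_toward// scc bcc.
rewrite tE metZl metZr mulrA => /eqP.
rewrite -subr_eq0 -{2}(mul1r (met X t' t')) -mulrBl mulf_eq0 (gt_eqF m') orbF.
rewrite subr_eq0 -expr2 sqrf_eq1 => /orP[] /eqP a1; first by rewrite a1 scale1r.
by move: a0; rewrite a1 ltr0N1.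
Qed.

Lemma normal_isom F (x c w : V) : isom X F -> Mod X x -> Mod X c ->
  dot (normal X (x *m F) (c *m F)) (w *m F) = dot (normal X x c) w.
Proof.
move=> [_ bF mF _] Mx Mc; rewrite !dot_normal; congr (- _).
rewrite /toward !bF !scalemxAl -!mulmxBl mF// => E.
have b1 u : bil X u x = hd u.
  by rewrite /bil /curv E mul0r addr0 (Mod_euclid E Mx) mulr1.
by rewrite (bilC X x c) !b1 !hdtlE (Mod_euclid E Mx) !mulr1 !subrr.
Qed.

End Normals.

(** * Linear images of cones *)

Section Img.
Context {R : realType} {n : nat}.
Local Notation V := 'rV[R]_n.
Implicit Types (C : set V) (F : 'M[R]_n) (v w : V).

Definition img F C : set V := [set w | C (w *m invmx F)].

Lemma img_mul F C w : F \in unitmx -> img F C (w *m F) <-> C w.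
Proof. by move=> uF; rewrite /img /= mulmxK. Qed.

Lemma inner_img F C w : F \in unitmx -> inner (img F C) w <-> inner C (w *m invmx F).
Proof.
move=> uF; split; last exact: near_mulmx.
move=> iw; have /near_mulmx : inner (img F C) ((w *m invmx F) *m F) by rewrite mulmxKV.
by apply: filterS => v /(img_mul C v uF).
Qed.

Lemma frontier_img F C w : F \in unitmx ->
  frontier (img F C) w <-> frontier C (w *m invmx F).
Proof.
by move=> uF; split=> -[Cw nw]; split => // iw; apply: nw; apply/(inner_img _ _ uF).
Qed.

Lemma good_img F C : F \in unitmx -> good_cone C -> good_cone (img F C).
Proof.
move=> uF gC; split.
- by move=> v w Cv Cw; rewrite /img /= mulmxDl; exact: cone_add.
- by move=> a w a0 Cw; rewrite /img /= -scalemxAl; exact: cone_scale.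
- have [L [h [cL hL LC]]] := cone_base gC.
  exists ((fun l => l *m F) @` L), (h *m (invmx F)^T); split.
  + apply: continuous_compact => //; apply: continuous_subspaceT.
    exact: mulmx_continuous.
  + by move=> _ [l Ll <-]; rewrite -dot_mulmx mulmxK// hL.
  + move=> w; split=> [/LC[a [l [a0 Ll e]]]|[a [_ [a0 [l Ll <-] ->]]]].
      exists a, (l *m F); split => //; first by exists l.
      by rewrite scalemxAl -e mulmxKV.
    by apply/LC; exists a, l; rewrite -scalemxAl mulmxK.
- have [c ic] := cone_inner gC; exists (c *m F); apply/(inner_img _ _ uF).
  by rewrite mulmxK.
Qed.

Lemma strict_img F C : F \in unitmx -> strict_cone C -> strict_cone (img F C).
Proof.
move=> uF sC v w Cv Cw nvw.
have [|a e] := sC _ _ Cv Cw.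
  by move=> i; apply: nvw; apply/(inner_img _ _ uF); rewrite mulmxDl.
by exists a; rewrite -(mulmxKV uF v) e -scalemxAl mulmxKV.
Qed.

Lemma supports_img F C e q : F \in unitmx -> supports e C q ->
  supports (e *m (invmx F)^T) (img F C) (q *m F).
Proof.
move=> uF [e0 eq eC]; split.
- apply: contra_neq e0 => H; apply: dot_eq0.
  by rewrite -{2}(mulmxK uF e) dot_mulmx H dot0l.
- by rewrite -dot_mulmx mulmxK.
- by move=> w; rewrite -dot_mulmx; exact: eC.
Qed.

Lemma smooth_img F C q : F \in unitmx -> smooth_at C q -> smooth_at (img F C) (q *m F).
Proof.
move=> uF [m m0 sm]; exists (m *m (invmx F)^T).
  apply: contra_neq m0 => H; apply: dot_eq0.
  by rewrite -{2}(mulmxK uF m) dot_mulmx H dot0l.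
move=> z; rewrite -dot_mulmx => /sm[t t0 it]; exists t => //.
by apply/(inner_img _ _ uF); rewrite mulmxDl (mulmxK uF) -scalemxAl.
Qed.

Lemma imgM F G C : F \in unitmx -> G \in unitmx -> img G (img F C) = img (F *m G) C.
Proof.
move=> uF uG; apply/funext => w; rewrite /img /=; congr C.
have uFG : F *m G \in unitmx by rewrite unitmx_mul uF.
rewrite -[LHS](mulmxK uFG); congr (_ *m _).
by rewrite mulmxA mulmxKV// mulmxKV.
Qed.

End Img.

(** * Tight placements *)

Section Tight.
Context {R : realType}.
Variables (X : geometry) (d : nat).
Local Notation k := (curv X : R).
Local Notation cn := (@gcos R X).
Local Notation sn := (@gsin R X).
Local Notation V := 'rV[R]_d.+3.
Local Notation gamma := (@axis R X d).
Local Notation e1 := (@axis_dir R d).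
Implicit Types (s t : R) (v w : V) (C : set V) (F : 'M[R]_d.+3).

(** The linear form of the hyperplane orthogonal to the axis at [gamma s]. All normals at [gamma s]
    towards points of the axis are multiples of it, so a normal there does not reveal which point of
    the axis it came from. *)
Definition axial s w : R := dot e1 (tl w) * cn s - hd w * sn s.

Lemma normal_gamma s t w :
  dot (normal X (gamma s) (gamma t)) w = sn (s - t) * axial s w.
Proof.
have tE : toward X (gamma s) (gamma t) = sn (s - t) *: mk (k * sn s) (- cn s *: e1).
  have := cnB X s (s - t); have := snB X s (s - t); rewrite subKr /toward bil_gamma.
  move=> sE cE; apply: hdtlP; rewrite !(hd_gamma, tl_gamma, hdtlE).
    by rewrite cE; ring.
  by rewrite -!scaleNr !scalerA -scalerDl; congr (_ *: _); rewrite sE; ring.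
rewrite dot_normal tE metZr metDl metNl metZl /met /bil.
rewrite !(hd_gamma, tl_gamma, hdtlE) !(dotZl, dotZr) dot_e1 /axial (dotC (tl w)).
have [E|nE] := pselect (X = Euclidean).
  by rewrite /curv /gcos /gsin E; ring.
have kk := curv2 (R := R) nE.
ring: kk.
Qed.

End Tight.

Section Tight2.
Context {R : realType}.
Variables (X : geometry) (d : nat).
Local Notation k := (curv X : R).
Local Notation cn := (@gcos R X).
Local Notation sn := (@gsin R X).
Local Notation V := 'rV[R]_d.+3.
Local Notation P := (ambient R X d.+2).
Local Notation gamma := (@axis R X d).
Implicit Types (s t : R) (u v w : V) (C : set V) (F : 'M[R]_d.+3).

Lemma dot_ext u v : (forall w, dot u w = dot v w) -> u = v.
Proof.
move=> uv; apply/eqP; rewrite -subr_eq0; apply/eqP/dot_eq0.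
by rewrite {1}dotDl dotNl uv subrr.
Qed.

Lemma bil_o u : bil X u (gamma 0) = hd u.
Proof. by rewrite /bil hd_gamma tl_gamma cn0 sn0 scale0r dot0r mulr0 addr0 mulr1. Qed.

Definition small s : Prop := X = Spherical -> `|s| < pi / 2.

Lemma sn_pos s : small s -> 0 < s -> 0 < sn s.
Proof.
move=> sm s0; apply: sn_gt0 => // /sm; rewrite gtr0_norm// => sp.
by have := @pi_gt0 R; move: sp; set p := pi; clear -X d; lra.
Qed.

(* [sq u o <= sq (gamma s) o], in homogeneous coordinates. *)
Lemma round_le u s : Mod X u -> small s ->
  sq X u (gamma 0) <= sq X (gamma s) (gamma 0) ->
  [/\ 0 < hd u, dot (tl u) (tl u) * cn s ^+ 2 <= sn s ^+ 2 * hd u ^+ 2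
    & dot (tl u) (tl u) * cn s ^+ 2 = sn s ^+ 2 * hd u ^+ 2 ->
      sq X u (gamma 0) = sq X (gamma s) (gamma 0)].
Proof.
move=> Mu sm; have c0 : 0 < cn s by exact: cn_gt0.
have uu := Mu.1; have M0 : Mod X (gamma 0) by exact: Mod_gamma.
have Ms : Mod X (gamma s) by exact: Mod_gamma.
have cs := cn_sn X s.
have [E|nE] := pselect (X = Euclidean).
  rewrite !sq_euclid// !tl_gamma sn0 scale0r !subr0 !dotE dot_e1 (Mod_euclid E Mu).
  have -> : cn s = 1 by rewrite /gcos E.
  rewrite !mulr1 !expr1n !mulr1 expr2 => H.
  by split.
rewrite !sq_bil// !bil_o hd_gamma; move: uu; rewrite /bil.
set T := dot _ _; set h := hd u; move: (Mu.2) c0 cs.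
rewrite -/h; set c := cn s; set n := sn s => hp c0 cs uu.
have [E|nS] := pselect (X = Spherical).
  move: uu cs; have -> : k = 1 by rewrite /curv E.
  rewrite !mul1r => uu cs hc.
  have {}hc : c <= h by move: hc; clear -X d; lra.
  have h0 : 0 < h by exact: lt_le_trans hc.
  have TE : T = 1 - h ^+ 2 by rewrite expr2 -uu; ring.
  have nE' : n ^+ 2 = 1 - c ^+ 2 by rewrite -cs; ring.
  have ch : c ^+ 2 <= h ^+ 2 by apply: lerXn2r => //; rewrite nnegrE ltW.
  rewrite TE nE'; split => //; first by move: ch; clear -X d; lra.
  move=> e; have ch2 : c ^+ 2 = h ^+ 2 by move: e; clear -X d; lra.
  have -> : c = h by apply/eqP; rewrite -(@eqrXn2 _ 2) ?(ltW c0) ?(ltW h0)// ch2.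
  by [].
have E : X = Hyperbolic by move: nS nE; case: (X).
have h0 := hp nS; move: uu cs; have -> : k = -1 by rewrite /curv E.
move=> uu cs hc.
have {}hc : h <= c by move: hc; clear -X d; lra.
have TE : T = h ^+ 2 - 1 by rewrite expr2 -[in RHS]uu; ring.
have nE' : n ^+ 2 = c ^+ 2 - 1 by rewrite -[in RHS]cs; ring.
have ch : h ^+ 2 <= c ^+ 2 by apply: lerXn2r => //; rewrite nnegrE ltW.
rewrite TE nE'; split => //; first by move: ch; clear -X d; lra.
move=> e; have ch2 : h ^+ 2 = c ^+ 2 by move: e; clear -X d; lra.
have -> : h = c by apply/eqP; rewrite -(@eqrXn2 _ 2) ?(ltW c0) ?(ltW h0)// ch2.
by [].
Qed.

(** The inequality is the cone over the ball of radius [|s|] about [gamma 0]; its equality case says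
    that [gamma s] is the only point of contact with the sphere. *)
Definition tight C s : Prop := C (gamma s) /\ forall w, C w ->
  [/\ 0 < hd w, dot (tl w) (tl w) * cn s ^+ 2 <= sn s ^+ 2 * hd w ^+ 2
    & dot (tl w) (tl w) * cn s ^+ 2 = sn s ^+ 2 * hd w ^+ 2 ->
      exists a, w = a *: gamma s].

Lemma small_le s t : small s -> `|t| <= `|s| -> small t.
Proof. by move=> sm ts /sm; apply: le_lt_trans. Qed.

Lemma sn_ratio s t : small s -> s != 0 -> 0 < t -> t <= 1 -> 0 < sn (t * s) / sn s.
Proof.
move=> sm s0 t0 t1; case: (ltgtP s 0) s0 => // s0 _.
  have sm' : small (- s) by move=> /sm; rewrite normrN.
  rewrite -[X in X / _]opprK -[X in _ / X]opprK invrN mulrNN -!snN -mulrN.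
  have smt : small (t * - s).
    by apply: (small_le sm'); rewrite normrM gtr0_norm// ler_piMl.
  by rewrite divr_gt0// sn_pos// ?mulr_gt0// oppr_gt0.
have smt : small (t * s).
  by apply: (small_le sm); rewrite normrM gtr0_norm// ler_piMl.
by rewrite divr_gt0// sn_pos// ?mulr_gt0.
Qed.

(** [gamma (t * s)] is a positive combination of [gamma 0] and [gamma s], so by [sq_comb] the
    inequality at the inner centre becomes a positive multiple of the one at [gamma 0] plus a
    positive multiple of [sq X u (gamma s)]. *)
Lemma ball_sub u s t : Mod X u -> small s -> s != 0 -> 0 < t -> t < 1 ->
  sq X u (gamma (t * s)) <= sq X (gamma s) (gamma (t * s)) ->
  sq X u (gamma 0) <= sq X (gamma s) (gamma 0) /\
  (sq X u (gamma 0) = sq X (gamma s) (gamma 0) -> u = gamma s).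
Proof.
move=> Mu sm s0 t0 t1 us; pose al := sn ((1 - t) * s) / sn s; pose be := sn (t * s) / sn s.
have al0 : 0 < al by apply: sn_ratio; rewrite ?subr_gt0// gerBl ltW.
have be0 : 0 < be by apply: sn_ratio; rewrite ?ltW.
have sns : sn s != 0.
  by apply: contraTneq be0 => e; rewrite /be e invr0 mulr0 ltxx.
have comb : gamma (t * s) = al *: gamma 0 + be *: gamma s.
  have := gamma_comb X d 0 s (t * s).
  rewrite !sub0r !snN => /(congr1 (fun v => (- sn s)^-1 *: v)).
  rewrite scalerA mulVf ?oppr_eq0// scale1r => ->; rewrite scalerDr !scalerA.
  have -> : t * s - s = - ((1 - t) * s) by ring.
  by rewrite snN /al /be; congr (_ *: _ + _ *: _); field.
have [C HC] := sq_comb (Mod_gamma X d (t * s)) (Mod_gamma X d 0) (Mod_gamma X d s) comb.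
move: us; rewrite !HC ?sqxx ?mulr0 ?addr0//; last exact: Mod_gamma.
have us0 : 0 <= sq X u (gamma s) by apply: sq_ge0 => //; exact: Mod_gamma.
have bus := mulr_ge0 (ltW be0) us0 => us; split.
  by rewrite -(ler_pM2l al0); move: us bus; clear -X d; lra.
move=> e; apply: (sq_eq0 Mu (Mod_gamma _ _ _)).
apply/eqP; rewrite -(mulrI_eq0 _ (mulfI (lt0r_neq0 be0))); apply/eqP.
by apply: le_anti; rewrite bus andbT; move: us; rewrite e; clear -X d; lra.
Qed.

(* A ball centred between [o] and [gamma s], with [gamma s] on its boundary,
   touches the larger ball around [o] at [gamma s] only. *)
Lemma tight_of_center (K : set P) (x c : P) F s t : K `<=` model R X d.+2 -> K x ->
  isom X F -> small s -> s != 0 -> 0 < t -> t < 1 -> supp_center K x c ->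
  homog x *m F = gamma s -> homog c *m F = gamma (t * s) ->
  tight (img F (cone K)) s.
Proof.
move=> KM Kx iF sm s0 t0 t1 [/homogP Mc _ _ Kc] xF cF; have [uF _ _ MF] := iF.
split; first by rewrite -xF; apply/img_mul => //; exists 1, x; rewrite scale1r.
move=> w [a [z [a0 Kz]]] => /(congr1 (mulmx^~ F)); rewrite /= mulmxKV// -scalemxAl => ->.
set u := homog z *m F; have Mz : Mod X (homog z) by exact/homogP/KM.
have Mx : Mod X (homog x) by exact/homogP/KM.
have Mu : Mod X u by exact: MF.
have us : sq X u (gamma (t * s)) <= sq X (gamma s) (gamma (t * s)).
  by rewrite -xF -cF !isom_sq//; exact: Kc.
have [uo uoE] := ball_sub Mu sm s0 t0 t1 us.
have [h0 hle heq] := round_le Mu sm uo.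
rewrite !hdtlE !dotE; split; first exact: mulr_gt0.
  have -> : a * (a * dot (tl u) (tl u)) * cn s ^+ 2 = a ^+ 2 * (dot (tl u) (tl u) * cn s ^+ 2) by ring.
  have -> : sn s ^+ 2 * (a * hd u) ^+ 2 = a ^+ 2 * (sn s ^+ 2 * hd u ^+ 2) by ring.
  by rewrite ler_pM2l// exprn_gt0.
have -> : a * (a * dot (tl u) (tl u)) * cn s ^+ 2 = a ^+ 2 * (dot (tl u) (tl u) * cn s ^+ 2) by ring.
have -> : sn s ^+ 2 * (a * hd u) ^+ 2 = a ^+ 2 * (sn s ^+ 2 * hd u ^+ 2) by ring.
move=> /mulfI; rewrite gt_eqF ?exprn_gt0// => /(_ isT)/heq e.
by exists a; rewrite -(uoE e).
Qed.

(** [r] and [m] are the radius and the outer normal of a supporting sphere at [x]. The first half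
    produces an orientation preserving placement; the second certifies a placement that is already
    imposed, provided that it carries [m] to the axis normal. *)
Lemma placement (K : set P) (x : P) : body K -> geo_boundary K x ->
  exists (r : R) (m : V), [/\ 0 < r, X = Spherical -> r < pi / 2,
    supports m (cone K) (homog x) &
    forall s, r < `|s| -> small s ->
      (exists F, [/\ isom X F, 0 < \det F, homog x *m F = gamma s &
          tight (img F (cone K)) s]) /\
      (forall F, isom X F -> homog x *m F = gamma s ->
         (exists2 a, 0 < a &
            forall w, dot m w = a * dot (normal X (gamma s) (gamma 0)) (w *m F)) ->
         tight (img F (cone K)) s)].
Proof.
move=> bK bx; have KM := body_model bK; have cK := body_closed bK.
have [Kx _] := (boundaryP x KM cK).1 bx.
have [c sc] := body_supp bK bx; have [Mc xc s2 Kc] := sc.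
have Mx := KM _ Kx; have Mx' : Mod X (homog x) by exact/homogP.
have Mc' : Mod X (homog c) by exact/homogP.
have sq0 : 0 < sq X (homog x) (homog c).
  by apply: sq_gt0 => //; apply/eqP => /homog_inj.
have sqr : sq_range X (sq X (homog x) (homog c)) by exact: sq_inr.
have r0r : sq_range X (0 : R) by split => // _; clear -X d; lra.
pose r := dist_of X (sq X (homog x) (homog c)).
have r0 : 0 < r by rewrite -(dist_of0 X) dist_of_lt.
exists r, (normal X (homog x) (homog c)); split => //.
- move=> E; rewrite -(dist_of2 E) dist_of_lt//; last exact: s2.
  by split => // _; clear -X d; lra.
- exact: normal_supports.
move=> s rs sm; have s0 : s != 0 by rewrite -normr_gt0 (lt_trans r0).
have sn0' : 0 < `|s| by exact: lt_trans rs.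
(* Then [gamma (t * s)] is at distance [r] from [gamma s], towards [gamma 0]: the place for the
   centre of the supporting ball. *)
pose t := 1 - r / `|s|.
have rs1 : r / `|s| < 1 by rewrite ltr_pdivrMr// mul1r.
have rs0 : 0 < r / `|s| by exact: divr_gt0.
have t0 : 0 < t by rewrite subr_gt0.
have t1 : t < 1 by rewrite gtrBl.
have sts : `|s - t * s| = r.
  have -> : s - t * s = (r / `|s|) * s by rewrite /t; ring.
  by rewrite normrM (gtr0_norm rs0) divfK// gt_eqF.
have sqE : sq X (homog x) (homog c) = sq X (gamma s) (gamma (t * s)).
  apply: (@dist_of_inj R X) => //; first by apply: sq_inr; exact: Mod_gamma.
  rewrite dist_of_gamma sts// => E; have := sm E; have := @pi_gt0 R.
  by move: rs; set p := pi; set q := `|s|; clear -X d; lra.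
split.
  have [F [iF dF xF cF]] := place_gamma Mx' Mc' sqE.
  by exists F; split => //; exact: (tight_of_center KM Kx iF sm s0 t0 t1 sc).
move=> F iF xF [a a0 mF]; apply: (tight_of_center KM Kx iF sm s0 t0 t1 sc) => //.
have [uF _ _ MF] := iF.
have ratio : 0 < sn (s - t * s) / sn s.
  have -> : s - t * s = (r / `|s|) * s by rewrite /t; ring.
  by apply: sn_ratio => //; exact: ltW.
have sns : sn s != 0.
  by apply: contraTneq ratio => e; rewrite e invr0 mulr0 ltxx.
have snst : sn (s - t * s) != 0.
  by apply: contraTneq ratio => e; rewrite e mul0r ltxx.
apply: (@normal_unique R X _ (gamma s) _ _ (a * (sn (s - t * s) / sn s)^-1)).
- exact: Mod_gamma.
- exact: MF.
- exact: Mod_gamma.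
- by rewrite -sqE -xF isom_sq.
- by rewrite mulr_gt0 ?invr_gt0.
- apply: dot_ext => w; rewrite dotZl normal_gamma.
  rewrite -{1}xF -{1}(mulmxKV uF w) normal_isom// mF mulmxKV// normal_gamma subr0.
  by field; rewrite snst sns.
Qed.

End Tight2.

(** * The cone of the hull of two convex sets *)

Section HullCone.
Context {R : realType}.
Variables (X : geometry) (d : nat).
Local Notation V := 'rV[R]_d.+1.
Local Notation P := (ambient R X d).
Implicit Types (v w : V) (x y z c : P) (A B K S : set P).

Lemma segment_cone A x y z : geo_convex A -> A x -> A y ->
  (X = Spherical -> y <> - x) -> model R X d z ->
  (exists a b : R, [/\ 0 <= a, 0 <= b & homog z = a *: homog x + b *: homog y]) -> A z.
Proof.
move=> [AM cA] Ax Ay nxy Mz H; apply: (cA x y) => //.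
by apply/segmentP => //; exact: AM.
Qed.

Lemma region_not_opp S x y : region S -> S x -> S y -> X = Spherical -> y <> - x.
Proof.
move=> rS Sx Sy E e; have [h hS] := region_form rS.
have := hS _ Sx; have := hS _ Sy; rewrite e homogN// dotNr; set p := dot _ _.
by clear -X d; lra.
Qed.

Lemma region_formP S : region S ->
  exists h : V, forall z, S z <-> model R X d z /\ 0 < dot h (homog z).
Proof.
have h1 (w : V) : dot (mk 1 0) w = hd w.
  by rewrite dot_hdtl !hdtlE dot0l addr0 mul1r.
rewrite /region /homog; case: (X) S => /= S.
- by move=> [u _ ->]; exists u.
- move=> ->; exists (mk 1 0) => z; rewrite h1 hd_mk ltr01; split=> //.
- by move=> ->; exists (mk 1 0) => z; rewrite h1; split=> [[]|[]].
Qed.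

Lemma hull_sub S A : A `<=` hull S A.
Proof. by move=> z Az Y _ AY _; exact: AY. Qed.

(** For convex [A] and [B] one segment between them already reaches every point of the hull: the
    join of the cones is closed under addition, so its trace [Y] on the model is convex and in [S],
    and every convex set containing both contains [Y]. *)
Lemma hull_cone S A B : region S -> A `<=` S -> B `<=` S ->
  (forall v w, cone A v -> cone A w -> cone A (v + w)) ->
  (forall v w, cone B v -> cone B w -> cone B (v + w)) ->
  [/\ hull S (A `|` B) `<=` S, geo_convex (hull S (A `|` B))
    & forall w, cone (hull S (A `|` B)) w <-> join (cone A) (cone B) w].
Proof.
move=> rS AS BS Aadd Badd; have [h hS] := region_formP rS; have SM := region_model rS.
have jscale (a : R) w : 0 < a -> join (cone A) (cone B) w -> join (cone A) (cone B) (a *: w).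
  move=> a0 [Aw|Bw|[v [u [Av Bu ->]]]].
  - by constructor 1; exact: cone_scaleP.
  - by constructor 2; exact: cone_scaleP.
  - by constructor 3; exists (a *: v), (a *: u); rewrite scalerDr; split => //; exact: cone_scaleP.
have jadd v w : join (cone A) (cone B) v -> join (cone A) (cone B) w ->
    join (cone A) (cone B) (v + w).
  move=> [Av|Bv|[v1 [v2 [Av1 Bv2 ->]]]] [Aw|Bw|[w1 [w2 [Aw1 Bw2 ->]]]].
  - by constructor 1; exact: Aadd.
  - by constructor 3; exists v, w.
  - by constructor 3; exists (v + w1), w2; rewrite addrA; split => //; exact: Aadd.
  - by constructor 3; exists w, v; rewrite addrC.
  - by constructor 2; exact: Badd.
  - by constructor 3; exists w1, (v + w2); rewrite addrCA; split => //; exact: Badd.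
  - by constructor 3; exists (v1 + w), v2; rewrite addrAC; split => //; exact: Aadd.
  - by constructor 3; exists v1, (v2 + w); rewrite addrA; split => //; exact: Badd.
  - by constructor 3; exists (v1 + w1), (v2 + w2); rewrite addrACA; split; [exact: Aadd|exact: Badd|].
have posA C w : C `<=` S -> cone C w -> 0 < dot h w.
  by move=> CS [a [z [a0 /CS/hS[_ Sz] ->]]]; rewrite dotZr mulr_gt0.
have jpos w : join (cone A) (cone B) w -> 0 < dot h w.
  move=> [Aw|Bw|[v [u [Av Bu ->]]]]; [exact: (posA A)|exact: (posA B)|].
  by rewrite dotDr addr_gt0//; [exact: (posA A)|exact: (posA B)].
pose Y : set P := [set z | model R X d z /\ join (cone A) (cone B) (homog z)].
have cY : geo_convex Y.
  split=> [z []//|x y [Mx jx] [My jy] nxy z /segmentP]; move=> /(_ Mx My)[Mz [a [b [a0 b0 e]]]].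
  split => //; rewrite e; move: a0; rewrite le_eqVlt => /predU1P[a00|a0].
    move: b0; rewrite le_eqVlt => /predU1P[b00|b0].
      have := Mod_neq0 ((homogP z).1 Mz); rewrite e -a00 -b00 !scale0r addr0 eqxx//.
    by rewrite -a00 scale0r add0r; exact: jscale.
  move: b0; rewrite le_eqVlt => /predU1P[<-|b0].
    by rewrite scale0r addr0; exact: jscale.
  by apply: jadd; exact: jscale.
have YS : Y `<=` S by move=> z [Mz /jpos]; rewrite hS.
have AY : A `|` B `<=` Y.
  move=> z [Az|Bz]; [have Mz := SM _ (AS _ Az)|have Mz := SM _ (BS _ Bz)]; split => //.
    by constructor 1; exists 1, z; rewrite scale1r.
  by constructor 2; exists 1, z; rewrite scale1r.
have hY : hull S (A `|` B) = Y.
  apply/seteqP; split=> [z|z [Mz jz] Z cZ ABZ ZS]; first exact.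
  have sub1 C x : C `<=` S -> C `<=` Z -> model R X d x -> cone C (homog x) -> Z x.
    by move=> CS CZ Mx /cone_homog Cx; apply: CZ; apply: Cx => // u /CS/SM.
  have AZ : A `<=` Z by move=> u Au; apply: ABZ; left.
  have BZ : B `<=` Z by move=> u Bu; apply: ABZ; right.
  move: jz => [Aw|Bw|[_ [_ [[a [x [a0 Ax ->]]] [b [y [b0 By ->]]] e]]]].
  - exact: (sub1 A).
  - exact: (sub1 B).
  apply: (segment_cone cZ (AZ _ Ax) (BZ _ By)) => //.
    by apply: (region_not_opp rS); [exact: AS|exact: BS].
  by exists a, b; rewrite !ltW.
rewrite hY; split => // w; split=> [[a [z [a0 [_ jz] ->]]]|jw].
  exact: jscale.
suff [a [u [a0 Mu wE]]] : exists (a : R) u, [/\ 0 < a, Mod X u & w = a *: u].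
  have [z Mz zu] := homog_onto Mu; exists a, z; rewrite zu; split => //; split => //.
  have -> : homog z = a^-1 *: w by rewrite zu wE scalerA mulVf ?gt_eqF// scale1r.
  by apply: jscale => //; rewrite invr_gt0.
have MA x : A x -> Mod X (homog x) by move=> Ax; apply/homogP/SM/AS.
have MB x : B x -> Mod X (homog x) by move=> Bx; apply/homogP/SM/BS.
move: jw => [[a [x [a0 Ax ->]]]|[a [x [a0 Bx ->]]]|[_ [_ [[a [x [a0 Ax ->]]] [b [y [b0 By ->]]] ->]]]].
- by exists a, (homog x); split => //; exact: MA.
- by exists a, (homog x); split => //; exact: MB.
have [||c [u [c0 Mu e]]] := Mod_sum (MA _ Ax) (MB _ By) (ltW a0) (ltW b0).
- exact: addr_gt0.
- move=> E e; have /hS[_] := AS _ Ax; have /hS[_] := BS _ By.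
  by rewrite e dotNr; set p := dot _ _; clear -X d; lra.
by exists c, u.
Qed.

End HullCone.

Section Round.
Context {R : realType}.
Variables (X : geometry) (d : nat).
Local Notation k := (curv X : R).
Local Notation cn := (@gcos R X).
Local Notation sn := (@gsin R X).
Local Notation V := 'rV[R]_d.+3.
Local Notation gamma := (@axis R X d).
Implicit Types (s t : R) (u v w : V) (A B : set V).

Definition round s w : Prop :=
  0 < hd w /\ dot (tl w) (tl w) * cn s ^+ 2 <= sn s ^+ 2 * hd w ^+ 2.

Lemma round_sq u s : Mod X u -> small X s -> round s u ->
  sq X u (gamma 0) <= sq X (gamma s) (gamma 0) /\
  (sq X u (gamma 0) = sq X (gamma s) (gamma 0) ->
   dot (tl u) (tl u) * cn s ^+ 2 = sn s ^+ 2 * hd u ^+ 2).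
Proof.
move=> Mu sm [h0 H]; have c0 : 0 < cn s by exact: cn_gt0.
have uu := Mu.1; have M0 : Mod X (gamma 0) by exact: Mod_gamma.
have Ms : Mod X (gamma s) by exact: Mod_gamma.
have cs := cn_sn X s; move: H.
have [E|nE] := pselect (X = Euclidean).
  rewrite !sq_euclid// !tl_gamma sn0 scale0r !subr0 !dotE dot_e1 (Mod_euclid E Mu).
  have -> : cn s = 1 by rewrite /gcos E.
  by rewrite !mulr1 !expr1n !mulr1 expr2.
rewrite !sq_bil// !bil_o hd_gamma; move: uu; rewrite /bil.
move: h0 c0 cs; set T := dot _ _; set h := hd u; set c := cn s; set n := sn s.
move=> h0 c0 cs uu.
have [E|nS] := pselect (X = Spherical).
  move: uu cs; have -> : k = 1 by rewrite /curv E.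
  rewrite !mul1r => uu cs.
  have -> : T = 1 - h ^+ 2 by rewrite expr2 -uu; ring.
  have -> : n ^+ 2 = 1 - c ^+ 2 by rewrite -cs; ring.
  move=> H; have ch : c ^+ 2 <= h ^+ 2 by move: H; clear -X d; lra.
  have ch' : c <= h by rewrite -(@ler_pXn2r _ 2)// nnegrE ltW.
  split; first by move: ch'; clear -X d; lra.
  move=> e; have -> : h = c by move: e; clear -X d; lra.
  by ring.
have E : X = Hyperbolic by move: nS nE; case: (X).
move: uu cs; have -> : k = -1 by rewrite /curv E.
move=> uu cs.
have -> : T = h ^+ 2 - 1 by rewrite expr2 -[in RHS]uu; ring.
have -> : n ^+ 2 = c ^+ 2 - 1 by rewrite -[in RHS]cs; ring.
move=> H; have ch : h ^+ 2 <= c ^+ 2 by move: H; clear -X d; lra.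
have ch' : h <= c by rewrite -(@ler_pXn2r _ 2)// nnegrE ltW.
split; first by move: ch'; clear -X d; lra.
move=> e; have -> : h = c by move: e; clear -X d; lra.
by ring.
Qed.

(** Cauchy-Schwarz makes the cone over the ball convex. Equality for a sum would need it for both
    summands, which then lie on the rays of [gamma (- s)] and [gamma s]; these have opposite tails,
    against equality in Cauchy-Schwarz. *)
Lemma join_round A B s : small X s -> s != 0 -> tight X A (- s) -> tight X B s ->
  forall w, join A B w -> round s w /\
    (dot (tl w) (tl w) * cn s ^+ 2 = sn s ^+ 2 * hd w ^+ 2 ->
     exists a, w = a *: gamma s \/ w = a *: gamma (- s)).
Proof.
move=> sm s0 [_ tA] [_ tB] w; rewrite snN cnN sqrrN in tA.
move=> [/tA[h0 le eq]|/tB[h0 le eq]|[a [b [/tA[ha la ea] /tB[hb lb eb] ->]]]].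
- by split => // /eq[a ->]; exists a; right.
- by split => // /eq[a ->]; exists a; left.
set c2 := cn s ^+ 2 in la ea lb eb *; set n2 := sn s ^+ 2 in la ea lb eb *.
have c20 : 0 < c2 by rewrite exprn_gt0// cn_gt0.
have hab : 0 < hd a * hd b by exact: mulr_gt0.
have sns : sn s != 0.
  have := sn_ratio sm s0 ltr01 (lexx 1); rewrite mul1r; apply: contraTneq => ->.
  by rewrite mul0r ltxx.
have n20 : 0 < n2 by rewrite exprn_even_gt0.
have cs := dot_CS (tl a) (tl b).
set ta := dot (tl a) (tl a) in la ea cs *; set tb := dot (tl b) (tl b) in lb eb cs *.
set p := dot (tl a) (tl b) in cs *.
have ta0 : 0 <= ta := dot_ge0 _; have tb0 : 0 <= tb := dot_ge0 _.
have pc : p * c2 <= n2 * (hd a * hd b).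
  rewrite leNgt; apply/negP => lt1.
  have : (n2 * (hd a * hd b)) ^+ 2 < (p * c2) ^+ 2.
    by rewrite ltrXn2r// mulr_ge0// ltW.
  have : (p * c2) ^+ 2 <= (n2 * (hd a * hd b)) ^+ 2.
    apply: le_trans (_ : (ta * c2) * (tb * c2) <= _).
      have -> : ta * c2 * (tb * c2) = (ta * tb) * c2 ^+ 2 by ring.
      by rewrite exprMn ler_pM2r// exprn_gt0.
    have -> : (n2 * (hd a * hd b)) ^+ 2 = (n2 * hd a ^+ 2) * (n2 * hd b ^+ 2) by ring.
    by apply: ler_pM => //; rewrite mulr_ge0// ltW.
  by move=> h1 h2; have := lt_le_trans h2 h1; rewrite ltxx.
have tab : dot (tl (a + b)) (tl (a + b)) = ta + tb + 2 * p.
  by rewrite tlD !dotE (dotC (tl b) (tl a)) -/ta -/tb -/p; ring.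
rewrite /round -/c2 -/n2 tab hdD; split.
  split; first exact: addr_gt0.
  by move: la lb pc; clear -X d; lra.
move=> e; exfalso.
have e1' : p * c2 = n2 * (hd a * hd b) by move: la lb pc e; clear -X d; lra.
have [|x xE] := ea; first by move: la lb pc e; clear -X d; lra.
have [|y yE] := eb; first by move: la lb pc e; clear -X d; lra.
move: e1' n20 c20 hab; rewrite /p xE yE !hdtlE ?tl_gamma ?hd_gamma snN cnN !dotE dot_e1.
rewrite -/n2.
have -> : x * (- sn s * (y * (sn s * 1))) * c2 = - (x * y) * (n2 * c2) by rewrite /n2; ring.
have -> : n2 * (x * cn s * (y * cn s)) = (x * y) * (n2 * c2) by rewrite /c2; ring.
have -> : x * cn s * (y * cn s) = (x * y) * c2 by rewrite /c2; ring.
move=> e2 n20 c20' hab'; have nc : 0 < n2 * c2 by exact: mulr_gt0.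
have xy0 : x * y * (n2 * c2) = 0 by move: e2; rewrite mulNr; set q := _ * _; clear -X d; lra.
by move: hab'; rewrite pmulr_lgt0// => xy; have := mulr_gt0 xy nc; rewrite xy0 ltxx.
Qed.

Lemma sq_gamma_opp s : sq X (gamma s) (gamma (- s)) = 4 * sn s ^+ 2.
Proof. by rewrite sq_gamma snN cnN; ring. Qed.

Lemma sq_pair u v s : Mod X u -> Mod X v -> small X s ->
  sq X u (gamma 0) <= sq X (gamma s) (gamma 0) ->
  sq X v (gamma 0) <= sq X (gamma s) (gamma 0) ->
  sq X u v <= 4 * sn s ^+ 2 /\
  (sq X u v = 4 * sn s ^+ 2 ->
   [/\ u + v = (2 * cn s) *: gamma 0, sq X u (gamma 0) = sq X (gamma s) (gamma 0)
     & sq X v (gamma 0) = sq X (gamma s) (gamma 0)]).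
Proof.
move=> Mu Mv sm; have c0 : 0 < cn s by exact: cn_gt0.
have M0 : Mod X (gamma 0) by exact: Mod_gamma.
have Ms : Mod X (gamma s) by exact: Mod_gamma.
have cs := cn_sn X s.
have T0 := dot_ge0 (tl u + tl v).
have tE : dot (tl u + tl v) (tl u + tl v) = dot (tl u) (tl u) + dot (tl v) (tl v) + 2 * dot (tl u) (tl v).
  by rewrite !dotE (dotC (tl v) (tl u)); ring.
have tl00 : tl u + tl v = 0 -> hd u + hd v = 2 * cn s -> u + v = (2 * cn s) *: gamma 0.
  move=> t0 h0; apply: hdtlP; rewrite !(hd_gamma, tl_gamma, hdtlE).
    by rewrite cn0 mulr1.
  by rewrite sn0 scale0r scaler0.
have [E|nE] := pselect (X = Euclidean).
  have c1 : cn s = 1 by rewrite /gcos E.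
  rewrite !sq_euclid// !tl_gamma sn0 scale0r !subr0 !dotE dot_e1 mulr1 -expr2.
  rewrite (dotC (tl v) (tl u)); move: T0; rewrite tE.
  set a := dot (tl u) (tl u) in tE *; set b := dot (tl v) (tl v) in tE *.
  set p := dot (tl u) (tl v) in tE *; set q := sn s ^+ 2 => T0 aq bq.
  split; first by move: T0 aq bq; clear -X d; lra.
  move=> e; split.
  - apply: tl00.
      by apply: dot_eq0; rewrite tE; move: T0 aq bq e; clear -X d; lra.
    by rewrite (Mod_euclid E Mu) (Mod_euclid E Mv) c1 mulr1.
  - by move: T0 aq bq e; clear -X d; lra.
  - by move: T0 aq bq e; clear -X d; lra.
rewrite !sq_bil// !bil_o hd_gamma.
have uu := Mu.1; have vv := Mv.1; move: uu vv; rewrite /bil.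
move: T0; rewrite tE; set a := dot (tl u) (tl u) in tE *; set b := dot (tl v) (tl v) in tE *.
set p := dot (tl u) (tl v) in tE *.
set x := hd u in tl00 *; set y := hd v in tl00 *; set c := cn s in tl00 c0 cs *; set n := sn s in cs *.
have [E|nS] := pselect (X = Spherical).
  move: cs; have -> : k = 1 by rewrite /curv E.
  rewrite !mul1r mulr1 => cs T0 uu vv xc yc.
  have {}xc : c <= x by move: xc; clear -X d; lra.
  have {}yc : c <= y by move: yc; clear -X d; lra.
  have nE' : n ^+ 2 = 1 - c ^+ 2 by rewrite -cs; ring.
  have xy : 4 * c ^+ 2 <= (x + y) ^+ 2.
    have -> : 4 * c ^+ 2 = (2 * c) ^+ 2 by ring.
    have cc : 0 <= 2 * c by move: c0; clear -X d; lra.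
    have cxy : 2 * c <= x + y by move: xc yc; clear -X d; lra.
    by apply: lerXn2r => //; rewrite nnegrE (le_trans cc).
  rewrite nE'; split; first by move: T0 uu vv xy; clear -X d; lra.
  move=> e; have xyE : (x + y) ^+ 2 = (2 * c) ^+ 2.
    by move: T0 uu vv xy e; clear -X d; lra.
  have sE : x + y = 2 * c.
    apply/eqP; rewrite -(@eqrXn2 _ 2)//; first exact/eqP.
      by move: xc yc c0; clear -X d; lra.
    by move: c0; clear -X d; lra.
  split.
  - apply: tl00 => //; apply: dot_eq0; rewrite tE.
    by move: T0 uu vv xy e; clear -X d; lra.
  - by move: sE xc yc; clear -X d; lra.
  - by move: sE xc yc; clear -X d; lra.
have E : X = Hyperbolic by move: nS nE; case: (X).
have x0 : 0 < x := Mu.2 nS; have y0 : 0 < y := Mv.2 nS.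
move: cs; have -> : k = -1 by rewrite /curv E.
move=> cs T0 uu vv xc yc.
have {}xc : x <= c by move: xc; clear -X d; lra.
have {}yc : y <= c by move: yc; clear -X d; lra.
have nE' : n ^+ 2 = c ^+ 2 - 1 by rewrite -[in RHS]cs; ring.
have xy : (x + y) ^+ 2 <= 4 * c ^+ 2.
  have -> : 4 * c ^+ 2 = (2 * c) ^+ 2 by ring.
  have cc : 0 <= x + y by move: x0 y0; clear -X d; lra.
  have cxy : x + y <= 2 * c by move: xc yc; clear -X d; lra.
  by apply: lerXn2r => //; rewrite nnegrE (le_trans cc).
rewrite nE'; split; first by move: T0 uu vv xy; clear -X d; lra.
move=> e; have xyE : (x + y) ^+ 2 = (2 * c) ^+ 2.
  by move: T0 uu vv xy e; clear -X d; lra.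
have sE : x + y = 2 * c.
  apply/eqP; rewrite -(@eqrXn2 _ 2)//; first exact/eqP.
    by move: x0 y0; clear -X d; lra.
  by move: c0; clear -X d; lra.
split.
- apply: tl00 => //; apply: dot_eq0; rewrite tE.
  by move: T0 uu vv xy e; clear -X d; lra.
- by move: sE xc yc; clear -X d; lra.
- by move: sE xc yc; clear -X d; lra.
Qed.

End Round.

(** * Configurations and their unique diameter *)

Section Config.
Context {R : realType}.
Variables (X : geometry) (d : nat).
Local Notation cn := (@gcos R X).
Local Notation sn := (@gsin R X).
Local Notation V := 'rV[R]_d.+3.
Local Notation P := (ambient R X d.+2).
Local Notation gamma := (@axis R X d).
Implicit Types (s t : R) (u v w : V) (A B : set V) (K L M : set P) (x y z p q : P)
  (F G : 'M[R]_d.+3).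

Lemma cone_act K F : K `<=` model R X d.+2 -> isom X F ->
  cone (@act R X d.+2 F @` K) = img F (cone K).
Proof.
move=> KM iF; have [uF _ _ _] := iF; apply/seteqP; split=> w.
  move=> [a [_ [a0 [z Kz <-] ->]]]; exists a, z; split => //.
  by rewrite homog_act// -?scalemxAl ?mulmxK//; exact: KM.
move=> [a [z [a0 Kz e]]]; exists a, (act F z); split; [by []|by exists z|].
by rewrite homog_act//; [rewrite scalemxAl -e mulmxKV|exact: KM].
Qed.

Definition regO : set P := [set z | model R X d.+2 z /\ 0 < hd (homog z)].

Lemma region_regO : region regO.
Proof.
rewrite /region /regO /homog; case: (X).
- exists (@axis R Spherical d 0).
    by apply/(@homogP R Spherical); exact: Mod_gamma.
  have fE : forall z : V, @Defs.form R Spherical d.+2 (@axis R Spherical d 0) z = hd z.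
    move=> z; rewrite /Defs.form dot_hdtl hd_mk tl_mk.
    by rewrite cn0 sn0 scale0r dot0l mul1r addr0.
  apply/seteqP; split=> z [Mz hz]; split => //.
    by rewrite fE.
  by rewrite fE in hz.
- by apply/seteqP; split=> z // _; split => //; rewrite hd_mk.
- by apply/seteqP; split=> [z []//|z [z1 z0]]; split.
Qed.

Lemma segmentC p q : model R X d.+2 p -> model R X d.+2 q -> segment p q = segment q p.
Proof.
move=> Mp Mq; apply/seteqP; split=> z /segmentP H; apply/segmentP => //;
  have [//|//|Mz [a [b [a0 b0 e]]]] := H; split => //; exists b, a; by rewrite addrC.
Qed.

Lemma diam_max M p q : M p -> M q ->
  (forall p' q', M p' -> M q' -> dist p' q' <= dist p q) -> diam M = dist p q.
Proof.
move=> Mp Mq Mmax; rewrite /diam; set T := [set t | _].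
have Tpq : T (dist p q) by exists p, q.
have Tub : ubound T (dist p q) by move=> _ [p' [q' [Mp' Mq' ->]]]; exact: Mmax.
apply: le_anti; apply/andP; split; first by apply: ge_sup => //; exists (dist p q).
by apply: ub_le_sup => //; exists (dist p q).
Qed.

(* [K] and [L] are moved to touch the ball of radius [|s|] around [o] from
   inside at [gamma (- s)] and [gamma s] only. *)
Record config K L x y F G s : Prop := Config {
  config_small : small X s;
  config_neq0 : s != 0;
  config_isomF : isom X F;
  config_isomG : isom X G;
  config_detF : 0 < \det F;
  config_detG : 0 < \det G;
  config_x : homog x *m F = gamma (- s);
  config_y : homog y *m G = gamma s;
  config_tightF : tight X (img F (cone K)) (- s);
  config_tightG : tight X (img G (cone L)) s }.

Section OneConfig.
Variables (K L : set P) (x y : P) (F G : 'M[R]_d.+3) (s : R).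
Hypotheses (bK : body K) (bL : body L) (bx : geo_boundary K x) (by_ : geo_boundary L y)
  (cfg : config K L x y F G s).

Local Notation f := (@act R X d.+2 F).
Local Notation g := (@act R X d.+2 G).
Local Notation M := (joint_hull regO f g K L).
Local Notation A := (img F (cone K)).
Local Notation B := (img G (cone L)).

Let sm := config_small cfg.
Let iF := config_isomF cfg.
Let iG := config_isomG cfg.
Let KM := body_model bK.
Let LM := body_model bL.

Let uF : F \in unitmx. Proof. by have [] := iF. Qed.
Let uG : G \in unitmx. Proof. by have [] := iG. Qed.

Let Kx : K x. Proof. by have [] := (boundaryP x KM (body_closed bK)).1 bx. Qed.
Let Ly : L y. Proof. by have [] := (boundaryP y LM (body_closed bL)).1 by_. Qed.

Lemma config_sub : f @` K `|` g @` L `<=` regO.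
Proof.
move=> _ [[z Kz <-]|[z Lz <-]].
  split; first exact: act_model (KM Kz).
  have [_ tA] := config_tightF cfg; have [] := tA (homog (f z)); last by [].
  rewrite homog_act//; last exact: KM.
  by apply/img_mul => //; exists 1, z; rewrite scale1r.
split; first exact: act_model (LM Lz).
have [_ tB] := config_tightG cfg; have [] := tB (homog (g z)); last by [].
rewrite homog_act//; last exact: LM.
by apply/img_mul => //; exists 1, z; rewrite scale1r.
Qed.

Lemma config_admissible : admissible regO f g K L.
Proof.
split; [split|split|exact: region_regO|exact: config_sub].
- exact: act_congruence.
- exact: act_orientation (config_detF cfg).
- exact: act_congruence.
- exact: act_orientation (config_detG cfg).
Qed.

Lemma config_hull : [/\ M `<=` regO, geo_convex M & forall w, cone M w <-> join A B w].
Proof.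
rewrite -(cone_act KM iF) -(cone_act LM iG); apply: hull_cone.
- exact: region_regO.
- by move=> z Az; apply: config_sub; left.
- by move=> z Az; apply: config_sub; right.
- by rewrite (cone_act KM iF); have := good_img uF (cone_good bK); move=> gA v w; exact: cone_add.
- by rewrite (cone_act LM iG); have := good_img uG (cone_good bL); move=> gA v w; exact: cone_add.
Qed.

Lemma config_model : M `<=` model R X d.+2.
Proof. by have [MO _ _] := config_hull => z /MO[]. Qed.

Lemma config_round z : M z -> round X s (homog z) /\
  (sq X (homog z) (gamma 0) = sq X (gamma s) (gamma 0) ->
   homog z = gamma s \/ homog z = gamma (- s)).
Proof.
move=> Mz; have [_ _ cM] := config_hull.
have Mz' : Mod X (homog z) by apply/homogP; exact: config_model.
have jz : join A B (homog z) by apply/cM; exists 1, z; rewrite scale1r.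
have [rz ez] := join_round sm (config_neq0 cfg) (config_tightF cfg) (config_tightG cfg) jz.
split => // /(round_sq Mz' sm rz).2 /ez[a].
have hz : 0 < hd (homog z) := rz.1.
have key t : hd (gamma t) = cn s -> homog z = a *: gamma t -> homog z = gamma t.
  move=> ht e; have a0 : 0 < a.
    by move: hz; rewrite e hdZ ht pmulr_lgt0// cn_gt0.
  have e' : 1 *: homog z = a *: gamma t by rewrite scale1r.
  by have [] := Mod_scale_eq Mz' (Mod_gamma X d t) ltr01 a0 e'.
by case=> e; [left|right]; apply: key; rewrite ?hd_gamma// cnN.
Qed.

Let hp : homog (f x) = gamma (- s).
Proof. by rewrite homog_act// ?(config_x cfg)//; exact: KM. Qed.

Let hq : homog (g y) = gamma s.
Proof. by rewrite homog_act// ?(config_y cfg)//; exact: LM. Qed.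

Let Mp : M (f x).
Proof. by apply: hull_sub; left; exists x. Qed.

Let Mq : M (g y).
Proof. by apply: hull_sub; right; exists y. Qed.

Let sqpq : sq X (homog (f x)) (homog (g y)) = 4 * sn s ^+ 2.
Proof. by rewrite hp hq sqC sq_gamma_opp. Qed.

Let sq_le p q : M p -> M q -> sq X (homog p) (homog q) <= 4 * sn s ^+ 2 /\
  (sq X (homog p) (homog q) = 4 * sn s ^+ 2 ->
   p = f x /\ q = g y \/ p = g y /\ q = f x).
Proof.
move=> Mp' Mq'; have [rp ep] := config_round Mp'; have [rq eq] := config_round Mq'.
have Hp : Mod X (homog p) by apply/homogP; exact: config_model.
have Hq : Mod X (homog q) by apply/homogP; exact: config_model.
have [le imp] := sq_pair Hp Hq sm (round_sq Hp sm rp).1 (round_sq Hq sm rq).1.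
split => // /imp[sum /ep ep1 /eq eq1].
have sns : sn s != 0.
  have := sn_ratio sm (config_neq0 cfg) ltr01 (lexx 1); rewrite mul1r.
  by apply: contraTneq => ->; rewrite mul0r ltxx.
have bad t : sn t != 0 -> homog p = gamma t -> homog q = gamma t -> False.
  move=> t0 e1 e2; move: sum; rewrite e1 e2 => /(congr1 (fun w => dot (axis_dir d) (tl w))).
  rewrite !hdtlE ?tl_gamma !dotE dot_e1 !mulr1 sn0 !mulr0 -mulr2n => /eqP.
  by rewrite mulrn_eq0 (negPf t0).
move: ep1 eq1; rewrite -hp -hq => -[] e1 [] e2.
- by exfalso; apply: (bad s) => //; rewrite -hq.
- by right; split; exact: homog_inj.
- by left; split; exact: homog_inj.
- by exfalso; apply: (bad (- s)); rewrite ?snN ?oppr_eq0// -hp.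
Qed.

Let dist_le p q : M p -> M q -> dist p q <= dist (f x) (g y).
Proof.
move=> Mp' Mq'; rewrite !distE; try exact: config_model.
rewrite dist_of_leE ?sqpq; first by have [] := sq_le Mp' Mq'.
  by apply: sq_inr; apply/homogP; exact: config_model.
by rewrite -sqpq; apply: sq_inr; apply/homogP; exact: config_model.
Qed.

Lemma config_diam : diam M = 2 * `|s|.
Proof.
rewrite (diam_max Mp Mq dist_le) distE; try exact: config_model.
have ss : - s - s = - (2 * s) by ring.
rewrite hp hq dist_of_gamma ss normrN normrM (gtr0_norm (ltr0Sn _ 1))//.
by move=> /sm h; rewrite mulrC -ler_pdivlMr// ltW.
Qed.

Lemma config_ends p q : diametral M p q -> p = f x /\ q = g y \/ p = g y /\ q = f x.
Proof.
move=> [Mp' Mq']; rewrite (diam_max Mp Mq dist_le) !distE; try exact: config_model.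
move=> e; apply: (sq_le Mp' Mq').2; rewrite -sqpq; apply: (@dist_of_inj R X) => //.
  by apply: sq_inr; apply/homogP; exact: config_model.
by apply: sq_inr; apply/homogP; exact: config_model.
Qed.

(** The hull is in a ball of radius [|s|] and meets its sphere only in two opposite points, so only
    this pair realises the diameter of the ball. *)
Lemma config_unique : unique_diametral M (f x) (g y).
Proof.
split; first by split => //; rewrite (diam_max Mp Mq dist_le).
move=> p q /config_ends[[-> ->]//|[-> ->]].
by apply: segmentC; exact: config_model.
Qed.

End OneConfig.
End Config.

(** * The reflections of the statement as matrices *)

Section Reflections.
Context {R : realType}.
Variables (X : geometry) (d : nat).
Local Notation k := (curv X : R).
Local Notation V := 'rV[R]_d.+1.
Local Notation P := (ambient R X d).
Implicit Types (u v w : V) (x y z p q c : P).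

Lemma lorentz_bil v w : lorentz v w = bil Hyperbolic v w.
Proof.
rewrite /lorentz /bil /= mulN1r; congr (_ - _).
by apply: eq_bigr => i _; rewrite !mxE.
Qed.

Lemma dot_bil v w : dot v w = bil Spherical v w.
Proof. by rewrite dot_hdtl /bil mul1r. Qed.

Lemma homog_point_reflection c z : model R X d c -> model R X d z ->
  homog (point_reflection c z) = (2 * bil X (homog c) (homog z)) *: homog c - homog z.
Proof.
move=> /homogP Mc /homogP Mz; have := @Mod_euclid R X d (homog c).
have := @Mod_euclid R X d (homog z); move: Mc Mz.
rewrite /homog /point_reflection /Defs.form; case: (X) c z => /= c z Mc Mz hz hc.
- by rewrite dot_bil.
- have {}hz := hz erefl Mz; have {}hc := hc erefl Mc.
  rewrite /bil /curv hz hc mul0r addr0; apply: hdtlP; rewrite !hdtlE; last by rewrite !mulr1.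
  by ring.
- by rewrite lorentz_bil.
Qed.

(** The tangent at the midpoint towards [q] is half of [q - p], and [q - p] is orthogonal to the
    midpoint, so the reflection in the bisector is the one exchanging [p] and [q]. *)
Lemma reflection_swap (p q z : V) : X <> Euclidean -> Mod X p -> Mod X q -> p <> q ->
  q <> - p -> Mod X z ->
  let m := (Num.sqrt (bil X (p + q) (p + q)))^-1 *: (p + q) in
  let v := q - bil X m q *: m in
  z - (2 * bil X (z - m) v / bil X v v) *: v = z *m swap X p q.
Proof.
move=> nE Mp Mq pq npq Mz m v.
have sE : bil X (p + q) (p + q) = 2 * (1 + bil X p q).
  by rewrite !bilE Mp.1 Mq.1 (bilC X q p); ring.
have s0 : 0 < 1 + bil X p q.
  have [E|nS] := pselect (X = Spherical).
    have MN : Mod X (- p) by split; rewrite ?bilNl ?bilNr ?opprK ?Mp.1// E.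
    have : 0 < sq X q (- p) by apply: sq_gt0 => //; apply/eqP.
    rewrite sq_bil// bilNr (bilC X q) opprK; have -> : k = 1 by rewrite /curv E.
    by rewrite mulr1 pmulr_rgt0.
  have E : X = Hyperbolic by move: nS nE; case: (X).
  by have := bil_hyp_ge1 E Mp Mq; set b := bil X p q; clear -X d; lra.
pose c := (Num.sqrt (bil X (p + q) (p + q)))^-1.
have cc : c * c = (2 * (1 + bil X p q))^-1.
  by rewrite -expr2 exprVn sqr_sqrtr sE// mulr_ge0// ltW.
have bmq : bil X m q = c * (1 + bil X p q).
  by rewrite /m -/c bilZl bilDl Mq.1 addrC.
have vE : v = 2^-1 *: (q - p).
  rewrite /v bmq /m -/c scalerA mulrAC cc.
  have -> : (2 * (1 + bil X p q))^-1 * (1 + bil X p q) = 2^-1.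
    by field; rewrite gt_eqF.
  by apply/rowP => i; rewrite !mxE; field.
have bmv : bil X m v = 0.
  by rewrite vE /m -/c bilZl bilZr bilDl !bilDr !bilNr Mp.1 Mq.1 (bilC X q p); ring.
have kk := curv2 (R := R) nE.
have k0 : k != 0 by apply: contra_eq_neq kk => ->; rewrite mul0r eq_sym oner_eq0.
have wE : bil X (p - q) (p - q) != 0.
  have : 0 < sq X p q by apply: sq_gt0 => //; apply/eqP.
  by rewrite /sq met_bil//; apply: contraTneq => ->; rewrite mulr0 ltxx.
have -> : bil X (z - m) v = bil X z v by rewrite bilDl bilNl bmv subr0.
rewrite swapE// expr2 kk subrr !mul0r addr0 /sq !met_bil// vE.
have -> : q - p = - (p - q) by rewrite opprB.
move: wE; set w := p - q; move=> wE; congr (_ - _).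
rewrite scalerN !(bilNl, bilNr, bilZl, bilZr) opprK scalerN -scaleNr scalerA.
by congr (_ *: _); field; rewrite wE k0.
Qed.

Definition antipodal_free p q : Prop := X = Spherical -> q <> - p.

Lemma homog_reflection p q z : model R X d p -> model R X d q -> p <> q ->
  antipodal_free p q -> model R X d z ->
  homog (hyperplane_reflection (Defs.midpoint p q) (tangent (Defs.midpoint p q) q) z) =
  homog z *m swap X (homog p) (homog q).
Proof.
move=> /homogP Mp /homogP Mq pq apq /homogP Mz.
have pq' : homog p <> homog q :> V by move=> /homog_inj.
have npq' : homog q <> - homog p :> V.
  have [E|nS] := pselect (X = Spherical).
    by rewrite -homogN// => /homog_inj; exact: apq.
  by move=> e; have := Mp.2 nS; have := Mq.2 nS; rewrite e hdN; set h := hd _; clear -X d; lra.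
have [E|nE] := pselect (X = Euclidean); last first.
  rewrite -reflection_swap//; move: nE {apq pq Mp Mq Mz pq' npq'}.
  rewrite /homog /hyperplane_reflection /tangent /Defs.midpoint /Defs.form.
  case: (X) p q z => p q z nE; [|by case: nE|].
    by rewrite !dot_bil.
  by rewrite !lorentz_bil.
rewrite swapE//; move: E pq' Mp Mq Mz {pq apq npq'}.
rewrite /homog /hyperplane_reflection /tangent /Defs.midpoint /Defs.form.
move=> E; move: E p q z; case: (X) => // _ /= p q z pq Mp Mq Mz.
have s0 : dot (p - q) (p - q) != 0.
  by apply: contra_not_neq pq => /dot_eq0/subr0_eq ->.
rewrite /sq /met /curv /=; apply: hdtlP; rewrite !hdtlE.
  by rewrite subrr mulr0 subr0.
have -> : q - 2^-1 *: (p + q) = - 2^-1 *: (p - q).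
  by apply/rowP => i; rewrite !mxE; field.
rewrite scalerA; congr (_ - _); congr (_ *: _).
rewrite !(mul0r, addr0, expr0n, subr0, mul1r, mulr1)/=.
have -> : dot (z - 2^-1 *: (p + q)) (- 2^-1 *: (p - q)) =
    - 2^-1 * (dot z (p - q) + 2^-1 * (dot q q - dot p p)).
  by rewrite !dotE (dotC q p); ring.
rewrite dotZl dotZr; move: s0; set s := dot (p - q) (p - q) => s0.
by field.
Qed.

End Reflections.

(** * Germs of the symmetries *)

Section Symmetry.
Context {R : realType}.
Variables (X : geometry) (d : nat).
Local Notation k := (curv X : R).
Local Notation cn := (@gcos R X).
Local Notation sn := (@gsin R X).
Local Notation V := 'rV[R]_d.+3.
Local Notation P := (ambient R X d.+2).
Local Notation gamma := (@axis R X d).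
Local Notation e1 := (@axis_dir R d).
Implicit Types (s t : R) (u v w : V) (A B : set V) (K L M W : set P) (x y z p q a b : P)
  (F G S : 'M[R]_d.+3).

(* [central_sym] stands for the symmetry in (3) and (5), [axial_sym] for the one
   in (4) and (6). *)
Definition central_sym : 'M[R]_d.+3 := diag_mx (mk 1 (const_mx (-1))).
Definition axial_sym : 'M[R]_d.+3 :=
  diag_mx (mk 1 (\row_i (if i == 0 then -1 else 1))).

Lemma hd_diag (r : 'rV[R]_d.+2) w : hd (w *m diag_mx (mk 1 r)) = hd w.
Proof. by rewrite /hd mul_mx_diag mxE -[mk 1 r 0 0]/(hd (mk 1 r)) hd_mk mulr1. Qed.

Lemma tl_diag (r : 'rV[R]_d.+2) w i : tl (w *m diag_mx (mk 1 r)) 0 i = tl w 0 i * r 0 i.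
Proof.
by rewrite mxE mul_mx_diag !mxE liftK.
Qed.

Lemma diag_sym_props (r : 'rV[R]_d.+2) : (forall i, r 0 i * r 0 i = 1) -> r 0 0 = -1 ->
  let S := diag_mx (mk 1 r) in
  [/\ isom X S, S *m S = 1%:M & forall s, gamma s *m S = gamma (- s)].
Proof.
move=> rr r0 S.
have tlS v w : dot (tl (v *m S)) (tl (w *m S)) = dot (tl v) (tl w).
  by apply: eq_bigr => i _; rewrite !tl_diag mulrACA rr mulr1.
have SS : S *m S = 1%:M.
  apply/row_matrixP => i; rewrite row_mul rowE row1; apply: hdtlP; rewrite ?hd_diag//.
  by apply/rowP => j; rewrite !tl_diag -mulrA rr mulr1.
split; [|exact: SS|].
  split.
  - by have /mulmx1_unit[uS _] := SS; exact: uS.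
  - by move=> v w; rewrite /bil !hd_diag tlS.
  - by move=> v w _; rewrite /met !hd_diag tlS.
  - by move=> z [bz hz]; split; rewrite /bil !hd_diag ?tlS.
move=> s; apply: hdtlP; rewrite ?hd_diag ?hd_gamma ?cnN//.
  apply/rowP => i; rewrite tl_diag !tl_gamma !mxE /= snN.
  by case: eqVneq => [->|_]; rewrite ?r0 ?mulr0 ?mul0r// !mulr1 mulrN1.
Qed.

Lemma central_symP : [/\ isom X central_sym, central_sym *m central_sym = 1%:M
  & forall s, gamma s *m central_sym = gamma (- s)].
Proof. by apply: diag_sym_props => [i|]; rewrite !mxE ?mulrNN ?mulr1. Qed.

Lemma axial_symP : [/\ isom X axial_sym, axial_sym *m axial_sym = 1%:M
  & forall s, gamma s *m axial_sym = gamma (- s)].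
Proof.
apply: diag_sym_props => [i|]; rewrite !mxE//.
by case: (i == 0); rewrite ?mulrNN mulr1.
Qed.

Lemma central_symE w : w *m central_sym = (2 * bil X (gamma 0) w) *: gamma 0 - w.
Proof.
rewrite bilC bil_o; apply: hdtlP.
  by rewrite hd_diag !(hd_gamma, hdtlE) cn0; ring.
apply/rowP => i; rewrite tl_diag !(tl_gamma, hdtlE) sn0 scale0r scaler0 add0r !mxE.
by rewrite mulrN1.
Qed.

Lemma axial_swap s w : sn s != 0 -> w *m swap X (gamma (- s)) (gamma s) = w *m axial_sym.
Proof.
move=> s0; have ab : gamma (- s) <> gamma s.
  move=> /(congr1 (fun v : V => dot e1 (tl v))); rewrite !tl_gamma !dotE dot_e1 snN !mulr1.
  move=> /eqP; rewrite eq_sym -addr_eq0 -mulr2n mulrn_eq0.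
  by move=> /eqP; apply/eqP.
rewrite swapE //; try exact: Mod_gamma.
have abE : gamma (- s) - gamma s = mk 0 (- (2 * sn s) *: e1).
  apply: hdtlP; rewrite !(hd_gamma, tl_gamma, hdtlE) ?cnN ?subrr//.
  by rewrite snN -scalerBl; congr (_ *: _); ring.
have sE : sq X (gamma (- s)) (gamma s) = 4 * sn s ^+ 2 by rewrite sqC sq_gamma_opp.
rewrite sE !tl_gamma !dotE snN dot_e1 abE.
have -> : sn s * (sn s * 1) - - sn s * (- sn s * 1) = 0 by ring.
rewrite mulr0 mul0r addr0 /met hd_mk tl_mk mulr0 mulr0 addr0 dotZr.
have -> : 2 * (- (2 * sn s) * dot (tl w) e1) / (4 * sn s ^+ 2) = - (tl w 0 0 / sn s).
  by rewrite /axis_dir dot_delta; field.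
apply: hdtlP; first by rewrite hd_diag !hdtlE mulr0 subr0.
apply/rowP => i; rewrite tl_diag !hdtlE !mxE /=.
case: eqVneq => [->|_] /=; last by rewrite !mulr0 subr0 mulr1.
by field.
Qed.

Lemma form_tangent0 a b z : model R X d.+2 a -> model R X d.+2 b -> model R X d.+2 z ->
  Defs.form (z - a) (tangent a b) = 0 <->
  dot (normal X (homog a) (homog b)) (homog z) = 0.
Proof.
move=> /homogP Ma /homogP Mb /homogP Mz; rewrite dot_normal.
have [E|nE] := pselect (X = Euclidean).
  have bE u v : Mod X u -> Mod X v -> bil X u v = 1.
    by move=> M1 M2; rewrite /bil /curv E mul0r addr0 (Mod_euclid E M1) (Mod_euclid E M2) mulr1.
  rewrite /toward !bE// !scale1r; move: E Ma Mb Mz {bE}.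
  rewrite /homog /tangent /Defs.form /met /curv; move: a b z; case: (X) => // a b z _ Ma Mb Mz.
  rewrite mul0r addr0 !hdtlE; split=> [->|/eqP]; first by rewrite oppr0.
  by rewrite oppr_eq0 => /eqP.
have k0 : k != 0.
  by have := curv2 (R := R) nE; apply: contra_eq_neq => ->; rewrite mul0r eq_sym oner_eq0.
have bt : bil X (homog a) (toward X (homog a) (homog b)) = 0.
  by rewrite bilC bil_toward.
rewrite met_bil// bilDl bilNl bilZl bt mulr0 subr0.
have -> : Defs.form (z - a) (tangent a b) = bil X (homog z) (toward X (homog a) (homog b)).
  have : bil X (homog z) (toward X (homog a) (homog b)) =
    bil X (homog z - homog a) (toward X (homog a) (homog b)).
    by rewrite bilDl bilNl bt subr0.
  move=> ->; move: nE {Ma Mb Mz k0 bt}; rewrite /homog /tangent /Defs.form /toward.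
  move: a b z; case: (X) => a b z nE; [|by case: nE|].
    by rewrite !dot_bil.
  by rewrite !lorentz_bil.
split=> [->|/eqP]; first by rewrite mulr0 oppr0.
by rewrite oppr_eq0 mulf_eq0 (negPf k0) => /eqP.
Qed.

(** Project [w] along [gamma (- t)] to the hyperplane orthogonal to the axis at [gamma t]. The
    projection is close to [gamma t], so it falls in the (d-1)-ball, and on the inner side [w] lies
    between it and [b]. If [A'] is not contained in the region, no convex set qualifies and [hull]
    is everything; hence the intersection with the model. *)
Lemma half_nbhd a b t (e : R) (A' : set P) : model R X d.+2 a -> model R X d.+2 b ->
  homog a = gamma t -> homog b = gamma (- t) -> small X t -> t != 0 -> 0 < e ->
  orthogonal_ball a b e `<=` A' -> A' b ->
  \forall w \near gamma t, dot (normal X (gamma t) (gamma 0)) w <= 0 ->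
     cone (hull (regO (d := d)) A' `&` model R X d.+2) w.
Proof.
move=> Ma Mb ha hb sm t0 e0 OA Ab.
have sns : sn t != 0.
  have := sn_ratio sm t0 ltr01 (lexx 1); rewrite mul1r.
  by apply: contraTneq => ->; rewrite mul0r ltxx.
have c0 : 0 < cn t by exact: cn_gt0.
have D0 : 0 < 2 * sn t ^+ 2 * cn t.
  by rewrite mulr_gt0// mulr_gt0// exprn_even_gt0.
have [e' e'0 e'P] := dist_of_small X e0.
pose n := normal X (gamma t) (gamma 0).
(* The normal [n] takes the value [- (2 * sn t ^+ 2 * cn t)] at [gamma (- t)], so this coefficient
   makes [dot n (f w)] vanish; it is nonnegative exactly on the inner side. *)
pose be w := - dot n w / (2 * sn t ^+ 2 * cn t).
pose f w := w - be w *: gamma (- t).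
have nE w : dot n w = sn t * axial X t w by rewrite normal_gamma subr0.
have ax t' : axial X t (gamma t') = sn t' * cn t - cn t' * sn t.
  by rewrite /axial tl_gamma hd_gamma dotZr dot_e1 mulr1.
have fn w : dot n (f w) = 0.
  rewrite /f dotDr dotNr dotZr nE nE ax snN cnN /be nE; field.
  by rewrite sns gt_eqF.
have f0 : f (gamma t) = gamma t.
  by rewrite /f /be nE ax (mulrC (cn t)) subrr mulr0 oppr0 mul0r scale0r subr0.
have cf : {for gamma t, continuous f}.
  apply: (@continuousB R V V id (fun w => be w *: gamma (- t))); first exact: cvg_id.
  apply: (@continuousZr_tmp R V V be (gamma (- t))).
  apply: (@continuousM R V (fun w => - dot n w) (fun=> (2 * sn t ^+ 2 * cn t)^-1)).
    by apply: (@continuousN R R^o V); exact: dot_continuous.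
  exact: cst_continuous.
have N1 : \forall w \near gamma t, exists (a1 : R) v,
    [/\ 0 < a1, Mod X v, f w = a1 *: v & sq X v (gamma t) < e'].
  apply: (@near_comp _ _ f (gamma t) [set w | exists (a1 : R) v,
    [/\ 0 < a1, Mod X v, w = a1 *: v & sq X v (gamma t) < e']] cf).
  by rewrite f0; apply: Mod_near => //; exact: Mod_gamma.
have N2 := Mod_near (Mod_gamma X d t) e'0.
apply: filterS2 N1 N2 => w [a1 [v [a10 Mv fw vt]]] [a2 [u [a20 Mu wu _]]] nw.
have [z Mz zv] := homog_onto Mv.
have Oz : A' z.
  apply: OA; split.
    split => //; apply/form_tangent0 => //; rewrite ha hb zv normal_gamma.
    have := fn w; rewrite fw dotZr nE => /eqP.
    rewrite !mulf_eq0 (gt_eqF a10) (negPf sns) /= => /eqP ->.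
    by rewrite mulr0.
  split => //; rewrite distE// ha zv; apply/ltW/e'P; last by rewrite sqC.
  by apply: sq_inr => //; exact: Mod_gamma.
have be0 : 0 <= be w by rewrite divr_ge0 ?oppr_ge0// ltW.
have [z' Mz' z'u] := homog_onto Mu.
exists a2, z'; rewrite z'u; split => //; split => //.
move=> Y cY AY YO; apply: (segment_cone cY (AY _ Oz) (AY _ Ab)) => //.
  apply: (region_not_opp (region_regO X d)); apply: YO; exact: AY.
exists (a1 / a2), (be w / a2).
split; [exact: divr_ge0 (ltW a10) (ltW a20) | exact: divr_ge0 be0 (ltW a20) |].
have wE : w = a1 *: v + be w *: gamma (- t) by rewrite -fw subrK.
have uE : u = a2^-1 *: w by rewrite wu scalerA mulVf ?gt_eqF// scale1r.
by rewrite zv hb z'u uE [in LHS]wE scalerDr !scalerA !(mulrC a2^-1).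
Qed.

End Symmetry.

Section Local.
Context {R : realType}.
Variables (X : geometry) (d : nat).
Local Notation cn := (@gcos R X).
Local Notation sn := (@gsin R X).
Local Notation V := 'rV[R]_d.+3.
Local Notation P := (ambient R X d.+2).
Local Notation gamma := (@axis R X d).
Local Notation e1 := (@axis_dir R d).
Implicit Types (s t : R) (u v w : V) (A B : set V) (K L M W : set P) (x y z p q a b c : P)
  (F G S : 'M[R]_d.+3).

Lemma sq_point_reflection c p q : model R X d.+2 c -> model R X d.+2 p -> model R X d.+2 q ->
  model R X d.+2 (point_reflection c p) -> model R X d.+2 (point_reflection c q) ->
  sq X (homog (point_reflection c p)) (homog (point_reflection c q)) =
  sq X (homog p) (homog q).
Proof.
move=> Mc Mp Mq /homogP + /homogP.
rewrite !homog_point_reflection//; move: Mc Mp Mq => /homogP Mc /homogP Mp /homogP Mq.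
have [E|nE] := pselect (X = Euclidean); last first.
  move=> M1 M2; rewrite !sq_bil//; congr (_ * (1 - _)).
  rewrite !bilE Mc.1 (bilC X (homog p) (homog c)); ring.
have bE u v : Mod X u -> Mod X v -> bil X u v = 1.
  by move=> M1 M2; rewrite /bil /curv E mul0r addr0 (Mod_euclid E M1) (Mod_euclid E M2) mulr1.
move=> _ _; rewrite !bE// !mulr1 /sq.
have -> : 2 *: homog c - homog p - (2 *: homog c - homog q) = - (homog p - homog q).
  by apply/rowP => i; rewrite !mxE; ring.
by rewrite -scaleN1r metZl metC metZl mulrA mulrNN !mulr1 mul1r.
Qed.

Lemma round_normal s w : sn s != 0 -> round X s w -> dot (normal X (gamma s) (gamma 0)) w <= 0.
Proof.
move=> s0 [h0 le]; rewrite normal_gamma subr0 /axial mulrBr subr_le0.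
have c1 : (sn s * (dot e1 (tl w) * cn s)) ^+ 2 <= (sn s * (hd w * sn s)) ^+ 2.
  have := dot_CS e1 (tl w); rewrite dot_e1 mul1r => CS.
  have -> : (sn s * (dot e1 (tl w) * cn s)) ^+ 2 =
    sn s ^+ 2 * (dot e1 (tl w) ^+ 2 * cn s ^+ 2) by ring.
  have -> : (sn s * (hd w * sn s)) ^+ 2 = sn s ^+ 2 * (sn s ^+ 2 * hd w ^+ 2) by ring.
  apply: ler_wpM2l; first exact: sqr_ge0.
  by apply: le_trans le; apply: ler_wpM2r => //; exact: sqr_ge0.
have r0 : 0 <= sn s * (hd w * sn s) by rewrite mulrCA mulr_ge0 ?(ltW h0)// -expr2 sqr_ge0.
apply: le_trans (ler_norm _) _; rewrite -(ger0_norm r0) -ler_sqr ?nnegrE//.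
by rewrite !real_normK ?num_real.
Qed.

Section LocalSym.
Variables (K L : set P) (x y : P) (F G : 'M[R]_d.+3) (s : R).
Hypotheses (bK : body K) (bL : body L) (bx : geo_boundary K x) (by_ : geo_boundary L y)
  (cfg : config K L x y F G s).

Local Notation f := (@act R X d.+2 F).
Local Notation g := (@act R X d.+2 G).
Local Notation M := (joint_hull (regO (d := d)) f g K L).
Local Notation A := (img F (cone K)).
Local Notation B := (img G (cone L)).

Let sm := config_small cfg.
Let KM := body_model bK.
Let LM := body_model bL.
Let Kx : K x. Proof. by have [] := (boundaryP x KM (body_closed bK)).1 bx. Qed.
Let Ly : L y. Proof. by have [] := (boundaryP y LM (body_closed bL)).1 by_. Qed.

Lemma config_p : homog (f x) = gamma (- s).
Proof. by have iF := config_isomF cfg; rewrite homog_act// ?(config_x cfg)//; exact: KM. Qed.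

Lemma config_q : homog (g y) = gamma s.
Proof. by have iG := config_isomG cfg; rewrite homog_act// ?(config_y cfg)//; exact: LM. Qed.

Let Mp : M (f x). Proof. by apply: hull_sub; left; exists x. Qed.
Let Mq : M (g y). Proof. by apply: hull_sub; right; exists y. Qed.

Lemma config_sn : sn s != 0.
Proof.
have := sn_ratio sm (config_neq0 cfg) ltr01 (lexx 1); rewrite mul1r.
by apply: contraTneq => ->; rewrite mul0r ltxx.
Qed.

Lemma config_pq : f x <> g y.
Proof.
move=> /(congr1 (@homog R X d.+2)); rewrite config_p config_q.
move=> /(congr1 (fun v : V => dot e1 (tl v))); rewrite !tl_gamma !dotE dot_e1 snN !mulr1.
move=> /eqP; rewrite eq_sym -addr_eq0 -mulr2n mulrn_eq0 /= => e.
by move/negP: config_sn.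
Qed.

(** [W] stands for [M] itself or for its part in D(eps): it is enough that [W] fills [M] near both
    ends. *)
Lemma sym_germ (W : set P) (sigma : P -> P) S : W `<=` M -> sigma @` W = W ->
  (forall z, W z -> homog (sigma z) = homog z *m S) ->
  S *m S = 1%:M -> gamma s *m S = gamma (- s) ->
  (\forall w \near gamma s, cone M w -> cone W w) ->
  (\forall w \near gamma (- s), cone M w -> cone W w) ->
  \forall w \near gamma s, join A B w <-> join A B (w *m S).
Proof.
move=> WM sW sE SS gS N1; rewrite -gS => N2.
have [_ _ cM] := config_hull bK bL cfg.
have cW w : cone W w -> cone W (w *m S).
  move=> [a [z [a0 Wz ->]]]; exists a, (sigma z); split => //.
    by rewrite -sW; exists z.
  by rewrite sE// scalemxAl.
have WMc w : cone W w -> cone M w by move=> [a [z [a0 /WM Mz ->]]]; exists a, z.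
have N2' := near_mulmx N2.
apply: filterS2 N1 N2' => w n1 n2; split=> /cM jw; apply/cM; apply: WMc.
  by apply: cW; exact: n1.
by rewrite -[w]mulmx1 -SS mulmxA; apply: cW; exact: n2.
Qed.

(** A point reflection preserves distances, so it maps the only diametral pair to itself. It cannot
    fix both ends, hence exchanges them, and its centre is [gamma 0] up to sign. *)
Lemma reflection_central (W : set P) c : W `<=` M -> W (f x) -> W (g y) ->
  model R X d.+2 c -> point_reflection c @` W = W ->
  forall z, W z -> homog (point_reflection c z) = homog z *m @central_sym R d.
Proof.
move=> WM Wp Wq Mc cW z Wz.
have MM := config_model bK bL cfg.
have cWW z' : W z' -> W (point_reflection c z') by move=> Wz'; rewrite -cW; exists z'.
have Dm : diametral M (point_reflection c (f x)) (point_reflection c (g y)).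
  have [[_ _ e] _] := config_unique bK bL bx by_ cfg.
  have MW z' : W z' -> model R X d.+2 z' by move=> /WM/MM.
  split; [apply: WM; exact: cWW|apply: WM; exact: cWW|].
  have Mp' := MW _ Wp; have Mq' := MW _ Wq.
  have Mcp := MW _ (cWW _ Wp); have Mcq := MW _ (cWW _ Wq).
  by rewrite -e distE// sq_point_reflection// -distE.
have Hc := (homogP c).1 Mc.
have Mpm := MM _ Mp; have Mqm := MM _ Mq.
case: (config_ends bK bL bx by_ cfg Dm) => -[].
  (* A fixed end is proportional to the centre; two fixed ends would coincide. *)
  move=> /(congr1 (@homog R X d.+2)) ep /(congr1 (@homog R X d.+2)) eq; exfalso.
  move: ep eq; rewrite !homog_point_reflection//.
  set b1 := bil X _ _; set b2 := bil X _ _ => ep eq.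
  have {}ep : (2 * b1) *: homog c = 2 *: homog (f x).
    by rewrite -[LHS](subrK (homog (f x))) ep -mulr2n scaler_nat.
  have {}eq : (2 * b2) *: homog c = 2 *: homog (g y).
    by rewrite -[LHS](subrK (homog (g y))) eq -mulr2n scaler_nat.
  have c0 : 0 < cn s by exact: cn_gt0.
  have h1 := congr1 hd ep; have h2 := congr1 hd eq.
  move: h1 h2; rewrite !hdZ config_p config_q !hd_gamma cnN => h1 h2.
  have hc : hd (homog c) != 0.
    by apply: contra_eq_neq h1 => ->; rewrite mulr0 eq_sym mulf_neq0 ?pnatr_eq0 ?gt_eqF.
  have b12 : 2 * b1 = 2 * b2 by apply: (mulIf hc); rewrite h1 h2.
  apply: config_pq; apply: homog_inj.
  by apply: (@scalerI _ _ (2 : R)); rewrite ?pnatr_eq0// -ep -eq b12.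
move=> /(congr1 (@homog R X d.+2)) ep _.
move: ep; rewrite homog_point_reflection// config_p config_q.
set b := bil X _ _ => ep.
have c0 : 0 < cn s by exact: cn_gt0.
have e0 : (2 * b) *: homog c = (2 * cn s) *: gamma 0.
  rewrite -[LHS](subrK (gamma (- s))) ep; apply: hdtlP.
    by rewrite !(hd_gamma, hdtlE) cnN cn0; ring.
  by rewrite !(tl_gamma, hdtlE) sn0 scale0r scaler0 snN scaleNr subrr.
have b0 : b != 0.
  apply: contra_eq_neq (congr1 hd e0) => ->.
  by rewrite mulr0 scale0r hdZ hd_gamma cn0 mulr1 hd0 eq_sym mulf_neq0 ?pnatr_eq0 ?gt_eqF.
have cE : homog c = (cn s / b) *: gamma 0.
  apply: (@scalerI _ _ (2 * b)); first by rewrite mulf_neq0 ?pnatr_eq0.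
  by rewrite e0 scalerA; congr (_ *: _); field.
have M0 := Mod_gamma X d (0 : R).
(* On the sphere the centre may also be the antipode of [gamma 0]; the reflection only involves the
   square of the coefficient. *)
have bb : (cn s / b) ^+ 2 = 1.
  by have := Hc.1; rewrite cE bilZl bilC bilZl M0.1 mulr1 -expr2.
have Mz : model R X d.+2 z by apply: MM; exact: WM.
rewrite homog_point_reflection// (central_symE X) cE bilZl scalerA; congr (_ *: _ - _).
set t := bil X _ _.
have -> : 2 * (cn s / b * t) * (cn s / b) = (cn s / b) ^+ 2 * (2 * t) by ring.
by rewrite bb mul1r.
Qed.

Lemma reflection_axial z : M z ->
  homog (hyperplane_reflection (Defs.midpoint (f x) (g y))
    (tangent (Defs.midpoint (f x) (g y)) (g y)) z) = homog z *m @axial_sym R d.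
Proof.
move=> Mz; have MM := config_model bK bL cfg.
rewrite homog_reflection ?config_p ?config_q ?axial_swap//; try exact: MM.
- exact: config_sn.
- exact: config_pq.
- have [MO _ _] := config_hull bK bL cfg.
  by apply: (region_not_opp (region_regO X d)); exact: MO.
Qed.

(** [M] is in the ball about [gamma 0], hence on the inner side of both end hyperplanes, where
    D(eps) contains a full half-neighbourhood of the end. *)
Lemma thickening_germ (e : R) : 0 < e ->
  let W := M `&` thickening (regO (d := d)) (f x) (g y) e in
  [/\ W (f x), W (g y),
    \forall w \near gamma s, cone M w -> cone W w
  & \forall w \near gamma (- s), cone M w -> cone W w].
Proof.
move=> e0 W; have MM := config_model bK bL cfg.
have Mpm := MM _ Mp; have Mqm := MM _ Mq.
set O := orthogonal_ball (f x) (g y) e `|` orthogonal_ball (g y) (f x) e.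
have dist0 z : model R X d.+2 z -> dist z z = 0.
  by move=> Mz; rewrite distE// sqxx dist_of0.
have Ob a b : model R X d.+2 a -> orthogonal_ball a b e a.
  move=> Ma; split; split; rewrite ?dist0 ?(ltW e0)//.
  by rewrite subrr -(scale0r (0 : P)) /Defs.form; case: (X) a b Ma => *; rewrite /lorentz /dot ?mxE ?big1 ?subr0 => *; rewrite ?mxE ?mul0r// mul0r.
have HW z : M z -> hull (regO (d := d)) O z -> W z.
  move=> Mz Hz; split => //; split=> [|e' e'0]; first exact: MM.
  by exists z => //; rewrite dist0//; exact: MM.
have cHW w : cone M w -> cone (hull (regO (d := d)) O `&` model R X d.+2) w -> cone W w.
  move=> [a [z [a0 Mz ->]]] [b [z' [b0 [Hz' Mz'] e']]]; exists a, z; split => //.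
  have Mz1 := (homogP z).1 (MM _ Mz).
  have [_ /homog_inj zz'] := Mod_scale_eq Mz1 ((homogP z').1 Mz') a0 b0 e'.
  by apply: HW => //; rewrite zz'.
have Op : O (f x) by left; exact: Ob.
have Oq : O (g y) by right; exact: Ob.
have snz := config_sn.
have [_ _ cM] := config_hull bK bL cfg.
have jr := join_round sm (config_neq0 cfg) (config_tightF cfg) (config_tightG cfg).
split; [exact: HW (hull_sub Op)|exact: HW (hull_sub Oq)| |].
- have N : \forall w \near gamma s, dot (normal X (gamma s) (gamma 0)) w <= 0 ->
      cone (hull (regO (d := d)) O `&` model R X d.+2) w.
    apply: (half_nbhd Mqm Mpm config_q config_p sm (config_neq0 cfg) e0) => //.
    by move=> z Oz; right.
  apply: filterS N => w nw Mw; apply: cHW => //; apply: nw.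
  by apply: round_normal => //; have [] := jr w ((cM w).1 Mw).
- have sm' : small X (- s) by move=> /sm; rewrite normrN.
  have N : \forall w \near gamma (- s), dot (normal X (gamma (- s)) (gamma 0)) w <= 0 ->
      cone (hull (regO (d := d)) O `&` model R X d.+2) w.
    apply: (half_nbhd Mpm Mqm config_p _ sm' _ e0) => //.
    + by rewrite opprK config_q.
    + by rewrite oppr_eq0 (config_neq0 cfg).
    + by move=> z Oz; left.
  apply: filterS N => w nw Mw; apply: cHW => //; apply: nw.
  apply: round_normal; first by rewrite snN oppr_eq0.
  by have [] := jr w ((cM w).1 Mw); rewrite /round snN cnN sqrrN.
Qed.

End LocalSym.
End Local.

Section Germs.
Context {R : realType} {n : nat}.
Local Notation V := 'rV[R]_n.
Implicit Types (A B C D : set V) (e h p q u v w z : V).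

Lemma smooth_scale C a p : good_cone C -> 0 < a -> smooth_at C p -> smooth_at C (a *: p).
Proof.
move=> gC a0 [m m0 sm]; exists m; [exact: m0|]; move=> z /sm[t t0 ti]; exists (a * t); first exact: mulr_gt0.
by rewrite -scalerA -scalerDr; exact: (inner_scale gC a0 ti).
Qed.

(** The step into the interior may be shortened by convexity until it falls where the two cones
    agree. *)
Lemma smooth_local C D q : good_cone C -> C q -> smooth_at C q ->
  (\forall w \near q, C w <-> D w) -> smooth_at D q.
Proof.
move=> gC Cq [m m0 sm] CD; exists m => // z /sm[t t0 ti].
have N : \forall w \near q, \forall v \near w, C v <-> D v by exact: nbhs_interior CD.
have [e e0 eP] := near_line z N.
pose b := Num.min (e / 2) (t / 2).
have b0 : 0 < b by rewrite lt_min !divr_gt0.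
have bt : b < t by rewrite gt_min; apply/orP; right; rewrite ltr_pdivrMr// ltr_pMr// ltr1n.
have be : b < e by rewrite gt_min; apply/orP; left; rewrite ltr_pdivrMr// ltr_pMr// ltr1n.
exists b => //.
have ib : inner C (q + b *: z).
  have -> : q + b *: z = (b / t) *: (q + t *: z) + (1 - b / t) *: q.
    rewrite scalerDr scalerA divfK ?gt_eqF// addrAC -scalerDl addrCA subrr addr0.
    by rewrite scale1r.
  have bt0 : 0 < b / t by exact: divr_gt0.
  have bt1 : 0 < 1 - b / t by rewrite subr_gt0 ltr_pdivrMr// mul1r.
  exact: inner_add gC (inner_scale gC bt0 ti) (cone_scale gC bt1 Cq).
have := eP b; rewrite gtr0_norm// => /(_ be).
by move: ib; apply: filterS2 => v Cv [/(_ Cv)].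
Qed.

Lemma supports_scale C e w (a : R) : supports e C w -> supports e C (a *: w).
Proof. by move=> [e0 ew eC]; split; rewrite ?dotZr ?ew ?mulr0. Qed.

Lemma near_scale C D w (a : R) : good_cone C -> good_cone D -> 0 < a ->
  (\forall v \near w, C v <-> D v) -> \forall v \near a *: w, C v <-> D v.
Proof.
move=> gC gD a0 H; have ca : {for a *: w, continuous (fun v : V => a^-1 *: v)}.
  by apply: scaler_continuous.
have : \forall v \near a *: w, C (a^-1 *: v) <-> D (a^-1 *: v).
  apply: (@near_comp _ _ _ _ [set v | C v <-> D v] ca).
  by rewrite scalerA mulVf ?gt_eqF// scale1r.
have ai : 0 < a^-1 by rewrite invr_gt0.
apply: filterS => v [CD DC]; have vE : v = a *: (a^-1 *: v).
  by rewrite scalerA mulfV ?gt_eqF// scale1r.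
split=> Cv; rewrite vE.
  by apply: (cone_scale gD a0); apply: CD; exact: (cone_scale gC ai).
by apply: (cone_scale gC a0); apply: DC; exact: (cone_scale gD ai).
Qed.

End Germs.

Section Core.
Context {R : realType}.
Variables (X : geometry) (d : nat).
Local Notation k := (curv X : R).
Local Notation cn := (@gcos R X).
Local Notation sn := (@gsin R X).
Local Notation V := 'rV[R]_d.+3.
Local Notation P := (ambient R X d.+2).
Local Notation gamma := (@axis R X d).
Local Notation e1 := (@axis_dir R d).
Implicit Types (s t : R) (u v w z : V) (A B : set V) (K L M W : set P) (x y p q : P)
  (F G S : 'M[R]_d.+3).

Lemma small_sn s : small X s -> s != 0 -> sn s != 0.
Proof.
move=> sm s0; have := sn_ratio sm s0 ltr01 (lexx 1); rewrite mul1r.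
by apply: contraTneq => ->; rewrite mul0r ltxx.
Qed.

Lemma tight_supports A s : small X s -> s != 0 -> tight X A s ->
  supports (normal X (gamma s) (gamma 0)) A (gamma s).
Proof.
move=> sm s0 [_ tA]; have sns := small_sn sm s0.
have Ms := Mod_gamma X d s; have M0 := Mod_gamma X d (0 : R); split.
- apply: normal_neq0 => //; apply: toward_neq0 => //.
    move=> /(congr1 (fun v : V => dot e1 (tl v))); rewrite !tl_gamma !dotE dot_e1 sn0 !mulr1.
    by move=> e; move: sns; rewrite e eqxx.
  move=> E; have c0 : 0 < cn s by exact: cn_gt0.
  have bE : bil X (gamma s) (gamma 0) = cn s by rewrite bil_gamma subr0.
  rewrite sq_bil//; last by rewrite E.
  have k1 : k = 1 by rewrite /curv E.
  rewrite bE k1; move: c0; set c := cn s; clear -X d; lra.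
- exact: dot_normal0.
- by move=> w /tA[h0 le _]; exact: round_normal.
Qed.

(** The ball lies on the inner side of its tangent hyperplane at [gamma s] and meets it only there,
    whereas [A] touches the sphere only at [gamma (- s)]. *)
Lemma tight_opp_neg A s w : small X s -> s != 0 -> tight X A (- s) -> A w ->
  dot (normal X (gamma s) (gamma 0)) w < 0.
Proof.
move=> sm s0 [_ tA] Aw; have sns := small_sn sm s0; have [h0] := tA _ Aw.
rewrite snN cnN sqrrN => le eq.
rewrite lt_neqAle round_normal// andbT normal_gamma subr0 mulf_neq0//; apply/eqP => ax.
have E : dot e1 (tl w) * cn s = hd w * sn s by apply/eqP; rewrite -subr_eq0; apply/eqP.
have [a wE] : exists a : R, w = a *: gamma (- s).
  apply: eq; apply: le_anti; rewrite le/=.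
  have -> : sn s ^+ 2 * hd w ^+ 2 = (dot e1 (tl w)) ^+ 2 * cn s ^+ 2.
    by rewrite -!exprMn E mulrC.
  apply: ler_wpM2r; first exact: sqr_ge0.
  by have := dot_CS e1 (tl w); rewrite dot_e1 mul1r.
move: E h0; rewrite wE tlZ hdZ tl_gamma hd_gamma !dotE dot_e1 snN cnN => /eqP.
have c0 : 0 < cn s by exact: cn_gt0.
rewrite -subr_eq0.
have -> : a * (- sn s * 1) * cn s - a * cn s * sn s = - (2 * (a * (cn s * sn s))) by ring.
rewrite oppr_eq0 !mulf_eq0 pnatr_eq0 (negPf sns) (gt_eqF c0) !orbF /= => /eqP ->.
by rewrite mul0r ltxx.
Qed.

Lemma tight_opp_notin A s : small X s -> s != 0 -> tight X A (- s) -> ~ A (gamma s).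
Proof.
move=> sm s0 tA /(tight_opp_neg sm s0 tA).
by rewrite dot_normal0 ?ltxx//; exact: Mod_gamma.
Qed.

(** A direction tangent to the sphere at [gamma s] and transverse to the axis; it plays the role of
    [h] in [join_germ_strict]. *)
Definition lateral : V := mk 0 (delta_mx 0 ord_max).

Lemma lateral_neq0 : lateral != 0.
Proof.
apply/eqP => /(congr1 (fun v : V => tl v 0 ord_max)); rewrite tl_mk tl0 !mxE !eqxx /= => /eqP.
by rewrite oner_eq0.
Qed.

Lemma dot_two_le (u : 'rV[R]_d.+2) : u 0 0 ^+ 2 + u 0 ord_max ^+ 2 <= dot u u.
Proof.
rewrite /dot (bigD1 0)//= (bigD1 ord_max)//= addrA !expr2 lerDl.
by apply: sumr_ge0 => i _; rewrite -expr2 sqr_ge0.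
Qed.

(** A direction tangent to a strictly curved surface meets it in short chords near the point of
    contact. Here [rho z] bounds [cn s ^+ 2] times the square of the last coordinate along the
    chord, and it tends to 0 at [gamma s]. *)
Lemma round_chord A s : small X s -> (forall w, A w -> round X s w) ->
  forall e : R, 0 < e -> \forall z \near gamma s,
    forall t : R, A z -> A (z + t *: lateral) -> `|t| <= e.
Proof.
move=> sm Ar e e0; have c0 : 0 < cn s by exact: cn_gt0.
pose rho (z : V) := sn s ^+ 2 * hd z ^+ 2 - cn s ^+ 2 * tl z 0 0 ^+ 2.
have tlc i : continuous (fun z : V => tl z 0 i).
  move=> z; have -> : (fun z : V => tl z 0 i) = (fun z : V => z 0 (lift ord0 i)).
    by apply/funext => v; rewrite mxE.
  exact: coord_continuous.
have sqc (f : V -> R) : continuous f -> continuous (fun z => f z ^+ 2).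
  move=> cf z; have -> : (fun z : V => f z ^+ 2) = (fun z : V => f z * f z).
    by apply/funext => v; rewrite expr2.
  apply: (@continuousM R V f f); exact: cf.
have tail_gamma : tl (gamma s) 0 ord_max = 0 by rewrite tl_gamma !mxE /= mulr0.
have N1 : \forall z \near gamma s, 0 < (e / 2) ^+ 2 * cn s ^+ 2 - rho z.
  apply: near_pos.
    apply: (@continuousB R R^o V (fun=> (e / 2) ^+ 2 * cn s ^+ 2) rho).
      exact: cst_continuous.
    apply: (@continuousB R R^o V (fun z : V => sn s ^+ 2 * hd z ^+ 2) (fun z : V => cn s ^+ 2 * tl z 0 0 ^+ 2)).
      apply: (@continuousM R V (fun=> sn s ^+ 2) (fun z : V => hd z ^+ 2)).
        exact: cst_continuous.
      by apply: sqc; exact: hd_continuous.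
    apply: (@continuousM R V (fun=> cn s ^+ 2) (fun z : V => tl z 0 0 ^+ 2)).
      exact: cst_continuous.
    by apply: sqc; exact: tlc.
  rewrite /rho hd_gamma tl_gamma !mxE /= mulr1 [cn s ^+ 2 * _]mulrC subrr subr0.
  by rewrite mulr_gt0 ?exprn_gt0 ?divr_gt0.
have N2 : \forall z \near gamma s, 0 < (e / 2) ^+ 2 - tl z 0 ord_max ^+ 2.
  apply: near_pos.
    apply: (@continuousB R R^o V (fun=> (e / 2) ^+ 2) (fun z : V => tl z 0 ord_max ^+ 2)).
      exact: cst_continuous.
    by apply: sqc; exact: tlc.
  by rewrite tail_gamma expr0n subr0 exprn_gt0 ?divr_gt0.
apply: filterS2 N1 N2 => z n1 n2 t _ /Ar[_].
have -> : hd (z + t *: lateral) = hd z by rewrite !hdtlE mulr0 addr0.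
have e20 : 0 <= e / 2 by rewrite divr_ge0 ?ltW.
move=> le; have tE : tl (z + t *: lateral) = tl z + t *: delta_mx 0 ord_max by rewrite !hdtlE.
have := dot_two_le (tl (z + t *: lateral)).
have -> : tl (z + t *: lateral) 0 0 = tl z 0 0 by rewrite tE !mxE /= mulr0 addr0.
have -> : tl (z + t *: lateral) 0 ord_max = tl z 0 ord_max + t.
  by rewrite tE mxE [X in _ + X]mxE [delta_mx _ _ _ _]mxE !eqxx /= mulr1.
move=> two.
have l1 : `|tl z 0 ord_max + t| <= e / 2.
  rewrite -(ger0_norm e20) -ler_sqr ?nnegrE// !real_normK ?num_real//.
  have c20 : 0 < cn s ^+ 2 by rewrite exprn_gt0.
  rewrite -(ler_pM2r c20); apply/ltW; rewrite -subr_gt0.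
  apply: lt_le_trans n1 _; rewrite lerD2l lerN2 /rho lerBrDr.
  apply: le_trans le; rewrite addrC mulrC -mulrDl; apply: ler_wpM2r => //; exact: ltW.
have l2 : `|tl z 0 ord_max| <= e / 2.
  rewrite -(ger0_norm e20) -ler_sqr ?nnegrE// !real_normK ?num_real//.
  by rewrite -subr_ge0 ltW.
have -> : t = (tl z 0 ord_max + t) - tl z 0 ord_max by rewrite addrC addKr.
by apply: le_trans (ler_normB _ _) _; rewrite [leRHS]splitr lerD.
Qed.

End Core.

Section Core.
Context {R : realType}.
Variables (X : geometry) (d : nat).
Local Notation V := 'rV[R]_d.+3.
Local Notation P := (ambient R X d.+2).
Local Notation gamma := (@axis R X d).
Implicit Types (s t : R) (u v w : V) (A B : set V) (K L : set P) (x y z p q : P)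
  (F G S : 'M[R]_d.+3).

(** The only consequence of the far symmetry hypotheses used to reach balls; [2 * |s|] is the
    diameter of the hull. *)
Definition germ_sym S T K L : Prop := forall x y F G s,
  geo_boundary K x -> geo_boundary L y -> config K L x y F G s -> T < 2 * `|s| ->
  \forall w \near gamma s, join (img F (cone K)) (img G (cone L)) w <->
    join (img F (cone K)) (img G (cone L)) (w *m S).

(** What the central and the axial symmetry have in common; from here on they are not
    distinguished. *)
Definition axis_sym S : Prop :=
  [/\ isom X S, S *m S = 1%:M & forall s, gamma s *m S = gamma (- s)].

Lemma config_swap K L x y F G s : config K L x y F G s -> config L K y x G F (- s).
Proof.
move=> [sm s0 iF iG dF dG xF yG tF tG]; split; rewrite ?opprK ?oppr_eq0//.
by move=> /sm; rewrite normrN.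
Qed.

(** Reversing the axis exchanges the two bodies, and [S] brings the germ at the other end back. *)
Lemma germ_symC S T K L : axis_sym S -> germ_sym S T K L -> germ_sym S T L K.
Proof.
move=> [_ SS gS] gKL x y F G s bx by_ cfg Ts.
have := gKL _ _ _ _ _ by_ bx (config_swap cfg); rewrite normrN => /(_ Ts).
rewrite -gS => /near_mulmx; apply: filterS => w.
by rewrite -mulmxA SS mulmx1 => H; rewrite join_sym; split=> /H.
Qed.

Lemma exists_far (r1 r2 T : R) : (X = Spherical -> r1 < pi / 2) ->
  (X = Spherical -> r2 < pi / 2) -> (X = Spherical -> T < pi) ->
  exists s, [/\ 0 < s, small X s, r1 < s, r2 < s & T < 2 * s].
Proof.
move=> h1 h2 h3; pose m := Num.max (Num.max 0 (T / 2)) (Num.max r1 r2).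
have m0 : 0 <= m by rewrite !le_max lexx.
have mr1 : r1 <= m by rewrite !le_max lexx !orbT.
have mr2 : r2 <= m by rewrite !le_max lexx !orbT.
have mT : T / 2 <= m by rewrite !le_max lexx !orbT.
have [s [ms sS]] : exists s, m < s /\ (X = Spherical -> s < pi / 2).
  have [E|nE] := pselect (X = Spherical); last by exists (m + 1); rewrite ltrDl.
  have mp : m < pi / 2.
    rewrite !gt_max h1// h2// ltr_pM2r ?invr_gt0// h3// !andbT.
    by rewrite divr_gt0 ?pi_gt0.
  by exists ((m + pi / 2) / 2); split=> [|_]; [exact: (midf_lt mp).1|exact: (midf_lt mp).2].
have s0 : 0 < s by exact: le_lt_trans ms.
exists s; split; [by []|by move=> /sS; rewrite gtr0_norm|exact: le_lt_trans ms|
  exact: le_lt_trans ms|].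
by rewrite mulrC -ltr_pdivrMr//; exact: le_lt_trans ms.
Qed.

Lemma exists_config K L x y (T : R) : body K -> body L -> geo_boundary K x -> geo_boundary L y ->
  (X = Spherical -> T < pi) -> exists F G s, config K L x y F G s /\ T < 2 * `|s|.
Proof.
move=> bK bL bx by_ TS; have [r1 [m1 [r10 r1S _ P1]]] := placement bK bx.
have [r2 [m2 [r20 r2S _ P2]]] := placement bL by_.
have [s [s0 sm sr1 sr2 sT]] := exists_far r1S r2S TS.
have sm' : small X (- s) by move=> /sm; rewrite normrN.
have n1 : r1 < `|- s| by rewrite normrN gtr0_norm.
have n2 : r2 < `|s| by rewrite gtr0_norm.
have [[F [iF dF xF tF]] _] := P1 _ n1 sm'; have [[G [iG dG yG tG]] _] := P2 _ n2 sm.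
exists F, G, s; split; last by rewrite gtr0_norm.
by split => //; rewrite gt_eqF.
Qed.

Section OneConfig.
Variables (K L : set P) (x y : P) (F G : 'M[R]_d.+3) (s : R).
Hypotheses (bK : body K) (bL : body L) (cfg : config K L x y F G s).
Local Notation A := (img F (cone K)).
Local Notation B := (img G (cone L)).

Let sm := config_small cfg.
Let s0 := config_neq0 cfg.
Let tA := config_tightF cfg.
Let tB := config_tightG cfg.
Let uF : F \in unitmx. Proof. by have [] := config_isomF cfg. Qed.
Let uG : G \in unitmx. Proof. by have [] := config_isomG cfg. Qed.
Let gA : good_cone A. Proof. exact: good_img uF (cone_good bK). Qed.
Let gB : good_cone B. Proof. exact: good_img uG (cone_good bL). Qed.

Lemma config_smooth_right : smooth_at (cone L) (homog y) ->
  \forall w \near gamma s, join A B w <-> B w.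
Proof.
move=> smL; have sB : smooth_at B (gamma s) by rewrite -(config_y cfg); exact: smooth_img.
have N : \forall w \near gamma s, join B A w -> B w.
  apply: (join_germ_smooth gB gA tB.1 sB (tight_supports sm s0 tB)) => w Aw.
  exact: tight_opp_neg sm s0 tA Aw.
by apply: filterS N => w; rewrite join_sym => jB; split; [exact: jB|exact: Or32].
Qed.

Lemma config_strict_right S : axis_sym S ->
  (\forall w \near gamma s, join A B w <-> A (w *m S)) ->
  \forall w \near gamma s, join A B w <-> B w.
Proof.
move=> [iS SS gS] H; have strA : strict_cone A by exact: strict_img uF (cone_strict bK).
pose h : V := mk 1 0; have hE w : dot h w = hd w by rewrite dot_hdtl hd_mk tl_mk dot0l mul1r addr0.
have jr := join_round sm s0 tA tB.
have N : \forall w \near gamma s, join A B w -> B w.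
  apply: (@join_germ_strict R _ A B (gamma s) (lateral d) h S) => //.
  - exact: Mod_neq0 (Mod_gamma X d s).
  - exact: tight_opp_notin sm s0 tA.
  - by move=> w Aw; rewrite hE; have [] := tA.2 _ Aw.
  - by move=> w Bw; rewrite hE; have [] := tB.2 _ Bw.
  - exact: lateral_neq0.
  - by apply: (round_chord sm) => w /jr[].
by apply: filterS N => w jB; split; [exact: jB|exact: Or32].
Qed.

End OneConfig.

Lemma config_smooth_left K L x y F G s S : body K -> body L -> config K L x y F G s ->
  axis_sym S -> smooth_at (cone K) (homog x) ->
  \forall w \near gamma s, join (img F (cone K)) (img G (cone L)) (w *m S) <->
    img F (cone K) (w *m S).
Proof.
move=> bK bL cfg [_ _ gS] smK; have := config_smooth_right bL bK (config_swap cfg) smK.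
by rewrite join_sym -gS => /near_mulmx.
Qed.

(** A single smooth point of [K] is enough, as it can be paired with every boundary point of [L]. *)
Lemma smooth_transfer S T K L : axis_sym S -> (X = Spherical -> T < pi) ->
  body K -> body L -> germ_sym S T K L ->
  forall y, geo_boundary L y -> smooth_at (cone L) (homog y).
Proof.
move=> aS TS bK bL gKL y by_; have KM := body_model bK; have gK := cone_good bK.
have [w0 fw0 sw0] := exists_smooth (isT : (2 <= d.+3)%N) gK.
have [a [x [a0 bx wE]]] := frontier_coneP KM (body_closed bK) fw0.
have smx : smooth_at (cone K) (homog x).
  have ai : 0 < a^-1 by rewrite invr_gt0.
  have -> : homog x = a^-1 *: w0 by rewrite wE scalerA mulVf ?gt_eqF// scale1r.
  exact: smooth_scale gK ai sw0.
have [F [G [s [cfg Ts]]]] := exists_config bK bL bx by_ TS.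
have [iS SS gS] := aS; have uS : S \in unitmx by have [] := iS.
have N1 := gKL _ _ _ _ _ bx by_ cfg Ts.
have N2 := config_smooth_left bK bL cfg aS smx.
have N3 : \forall w \near gamma s, join (img F (cone K)) (img G (cone L)) w <->
    img F (cone K) (w *m S).
  by apply: filterS2 N1 N2 => w [h1 h2] [h3 h4]; split=> [/h1/h3|/h4/h2].
have N4 := config_strict_right bK bL cfg aS N3.
have uF : F \in unitmx by have [] := config_isomF cfg.
have uG : G \in unitmx by have [] := config_isomG cfg.
have gA := good_img uF gK.
have invS : invmx S = S by rewrite -[LHS]mulmx1 -SS mulmxA mulVmx// mul1mx.
have smA : smooth_at (img S (img F (cone K))) (gamma s).
  rewrite -[s]opprK -gS; apply: (smooth_img uS).
  by rewrite -(config_x cfg); exact: smooth_img.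
have smB : smooth_at (img G (cone L)) (gamma s).
  apply: (smooth_local (good_img uS gA)) smA _.
    rewrite -[s]opprK -gS; apply/(img_mul _ _ uS); exact: (config_tightF cfg).1.
  apply: filterS2 N3 N4 => w [h1 h2] [h3 h4]; rewrite /img invS.
  by split=> [/h2/h3|/h4/h1].
have uGi : invmx G \in unitmx by rewrite unitmx_inv.
have := smooth_img uGi smB.
by rewrite imgM// mulmxV// -(config_y cfg) mulmxK// /img; under eq_fun do rewrite invmx1 mulmx1.
Qed.

End Core.

(** * Congruence of the two bodies *)

Section Congruence.
Context {R : realType}.
Variables (X : geometry) (d : nat).
Local Notation V := 'rV[R]_d.+3.
Local Notation P := (ambient R X d.+2).
Local Notation gamma := (@axis R X d).
Variables (S : 'M[R]_d.+3) (T : R).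
Hypotheses (aS : axis_sym X S) (TS : X = Spherical -> T < pi).
Implicit Types (s t : R) (u v w : V) (A B : set V) (K L : set P) (x y z p q : P)
  (F G H : 'M[R]_d.+3).

Let iS : isom X S. Proof. by have [] := aS. Qed.
Let SS : S *m S = 1%:M. Proof. by have [] := aS. Qed.
Let gS s : gamma s *m S = gamma (- s). Proof. by have [] := aS. Qed.
Let uS : S \in unitmx. Proof. by have [] := iS. Qed.
Let invS : invmx S = S.
Proof. by rewrite -[LHS]mulmx1 -SS mulmxA mulVmx// mul1mx. Qed.

(** In the coordinates of the bodies this is [S]: it sends [y] to [x] and the germ of [L] to that of
    [K]. *)
Definition transfer F G : 'M[R]_d.+3 := G *m S *m invmx F.

Lemma germ_pair K L x y F G s : body K -> body L -> germ_sym S T K L ->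
  geo_boundary K x -> geo_boundary L y -> config K L x y F G s -> T < 2 * `|s| ->
  \forall v \near homog y, cone L v <-> cone K (v *m transfer F G).
Proof.
move=> bK bL gKL bx by_ cfg Ts.
have smy := smooth_transfer aS TS bK bL gKL by_.
have smx := smooth_transfer aS TS bL bK (germ_symC aS gKL) bx.
have N1 := gKL _ _ _ _ _ bx by_ cfg Ts.
have N2 := config_smooth_left bK bL cfg aS smx.
have N3 := config_smooth_right bK bL cfg smy.
have uG : G \in unitmx by have [] := config_isomG cfg.
have N : \forall w \near homog y *m G, img G (cone L) w <-> img F (cone K) (w *m S).
  rewrite (config_y cfg); apply: filterS3 N1 N2 N3 => w [h1 h2] [h3 h4] [h5 h6].
  by split=> [/h6/h1/h3|/h4/h2/h5].
by have := near_mulmx N; apply: filterS => v; rewrite /img /= mulmxK// /transfer !mulmxA.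
Qed.

Section Inclusion.
Variables (K L : set P) (x y : P) (F G : 'M[R]_d.+3) (s : R).
Hypotheses (bK : body K) (bL : body L) (gKL : germ_sym S T K L)
  (bx : geo_boundary K x) (by_ : geo_boundary L y) (cfg : config K L x y F G s)
  (Ts : T < 2 * `|s|).

Local Notation H := (transfer F G).
Local Notation C := (cone L).
Local Notation D := (img (invmx H) (cone K)).

Let KM := body_model bK.
Let LM := body_model bL.
Let iF := config_isomF cfg.
Let iG := config_isomG cfg.
Let iH : isom X H.
Proof. by apply: isomM; [exact: isomM|exact: isomV]. Qed.
Let uF : F \in unitmx. Proof. by have [] := iF. Qed.
Let uG : G \in unitmx. Proof. by have [] := iG. Qed.
Let uH : H \in unitmx. Proof. by have [] := iH. Qed.
Let uHi : invmx H \in unitmx. Proof. by rewrite unitmx_inv. Qed.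
Let gC : good_cone C := cone_good bL.
Let gD : good_cone D. Proof. exact: good_img uHi (cone_good bK). Qed.
Let DE w : D w = cone K (w *m H). Proof. by rewrite /img /= invmxK. Qed.
Let smL := smooth_transfer aS TS bK bL gKL.
Let smK := smooth_transfer aS TS bL bK (germ_symC aS gKL).

Let agree w : Prop := \forall v \near w, C v <-> D v.

Lemma agree_start : agree (homog y).
Proof.
by have := germ_pair bK bL gKL bx by_ cfg Ts; apply: filterS => v; rewrite DE.
Qed.

(* At a limit of agreement points the two smooth bodies share the normal, hence
   the pair can be placed in a far configuration there as well. *)
Lemma agree_limit w : frontier C w ->
  (forall Q : set V, (\forall v \near w, Q v) -> exists2 v, Q v & frontier C v /\ agree v) ->
  agree w.
Proof.
move=> fw lim; have [a [z [a0 bz wE]]] := frontier_coneP LM (body_closed bL) fw.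
have w0 : w != 0 by have [Cw _] := fw; exact: cone_neq0 gC Cw.
have Dw : D w.
  apply: (cone_limit gD w0) => Q /lim[v Qv [[Cv _] av]]; exists v => //.
  by have [CD _] : C v <-> D v := nbhs_singleton av; exact: CD.
have fDw : frontier D w.
  split => // iw; have [v iv [[_ nv] av]] := lim _ (inner_inner iw).
  by apply: nv; move: av iv; apply: filterS2 => u [_ DC] /DC.
have fKw' : frontier (cone K) (w *m H).
  by have := (frontier_img (cone K) w uHi).1 fDw; rewrite invmxK.
have [b [z' [b0 bz' wE']]] := frontier_coneP KM (body_closed bK) fKw'.
have Lz : L z by have [] := (boundaryP z LM (body_closed bL)).1 bz.
have Kz' : K z' by have [] := (boundaryP z' KM (body_closed bK)).1 bz'.
have Mz := (homogP z).1 (LM Lz); have Mz' := (homogP z').1 (KM Kz').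
have [_ _ _ MH] := iH.
have zz' : homog z *m H = homog z'.
  have e : a *: (homog z *m H) = b *: homog z' by rewrite -wE' wE scalemxAl.
  by have [] := Mod_scale_eq (MH _ Mz) Mz' a0 b0 e.
have [r2 [mL [r20 r2S supL PL]]] := placement bL bz.
have [r1 [mK [r10 r1S supK PK]]] := placement bK bz'.
have smC : smooth_at C w by rewrite wE; exact: smooth_scale gC a0 (smL bz).
have wH : b *: homog z' *m invmx H = w by rewrite -wE' mulmxK.
have smD : smooth_at D w.
  rewrite -wH; apply: (smooth_img uHi).
  exact: smooth_scale (cone_good bK) b0 (smK bz').
have supC : supports mL C w by rewrite wE; exact: supports_scale.
have supD : supports (mK *m H^T) D w.
  by have := supports_img uHi (supports_scale b supK); rewrite invmxK wH.
have frC v : frontier C v -> exists u, supports u C v.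
  move=> /(frontier_coneP LM (body_closed bL))[c [q [c0 bq ->]]].
  by have [_ [m [_ _ sm _]]] := placement bL bq; exists m; exact: supports_scale.
have [c c0 mE] := common_normal gD smC smD supC supD frC lim.
have [s' [s'0 sm sr1 sr2 sT]] := exists_far r1S r2S TS.
have sm' : small X (- s') by move=> /sm; rewrite normrN.
have n1 : r1 < `|- s'| by rewrite normrN gtr0_norm.
have n2 : r2 < `|s'| by rewrite gtr0_norm.
have sn0 : s' != 0 by rewrite gt_eqF.
have [[G0 [iG0 dG0 zG0 tG0]] _] := PL _ n2 sm.
have [_ PK2] := PK _ n1 sm'.
have uG0 : G0 \in unitmx by have [] := iG0.
have uG0i : invmx G0 \in unitmx by rewrite unitmx_inv.
(* The placement of [K] forced by [transfer F0 G0 = H]. *)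
pose F0 := invmx H *m G0 *m S.
have iF0 : isom X F0 by apply: isomM => //; apply: isomM => //; exact: isomV.
have zF0 : homog z' *m F0 = gamma (- s').
  have e : homog z' *m invmx H = homog z by rewrite -zz' mulmxK.
  by rewrite /F0 -[X in _ *m X]mulmxA (mulmxA _ (invmx H)) e (mulmxA _ G0) zG0 gS.
(* [S] occurs once in [H] and once more in [F0], so the sign of its determinant cancels. *)
have dF0 : 0 < \det F0.
  rewrite /F0 /transfer !det_mulmx det_inv !det_mulmx det_inv.
  have dF := config_detF cfg; have dG := config_detG cfg.
  have dS : \det S * \det S = 1 by rewrite -det_mulmx SS det1.
  have dS0 : \det S != 0 by apply: contra_eq_neq dS => ->; rewrite mul0r eq_sym oner_eq0.
  have -> : (\det G * \det S / \det F)^-1 * \det G0 * \det S =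
      \det F * \det G0 / \det G.
    by field; rewrite dS0 !gt_eqF.
  by rewrite divr_gt0// mulr_gt0.
have supn : supports (normal X (gamma s') (gamma 0) *m G0^T) C (homog z).
  have := supports_img uG0i (tight_supports sm sn0 tG0).
  have -> : gamma s' *m invmx G0 = homog z by rewrite -zG0 mulmxK.
  rewrite invmxK imgM// mulmxV//.
  have -> : img 1%:M C = C by apply/funext => v; rewrite /img /= invmx1 mulmx1.
  by [].
(* Smoothness of [L] at [z] identifies the normal of its supporting sphere with the axis normal
   pulled back by [G0]; with [mE] this shows that [F0] carries the normal of [K] to the axis
   normal. *)
have [c1 c10 mLE] : exists2 c1, 0 < c1 &
    mL = c1 *: (normal X (gamma s') (gamma 0) *m G0^T).
  have [n nn0 sn] := smL bz.
  have [b1 b10 e1] := smooth_supports_unique nn0 sn supL.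
  have [b2 b20 e2] := smooth_supports_unique nn0 sn supn.
  exists (b1 / b2); first exact: divr_gt0.
  by rewrite e1 e2 scalerA divfK// gt_eqF.
have tF0 : tight X (img F0 (cone K)) (- s').
  apply: PK2 => //; exists (c * c1); first exact: mulr_gt0.
  move=> v.
  have -> : dot mK v = dot (mK *m H^T) (v *m invmx H).
    by rewrite -dot_mulmx mulmxKV.
  rewrite mE mLE !dotZl mulrA; congr (_ * _).
  have g0 : gamma 0 = gamma 0 *m S by rewrite gS oppr0.
  rewrite -dot_mulmx -gS [gamma 0 in RHS]g0 /F0 (mulmxA v) (mulmxA v) normal_isom//.
    exact: Mod_gamma.
  exact: Mod_gamma.
have cfg0 : config K L z' z F0 G0 s' by split.
have := germ_pair bK bL gKL bz' bz cfg0; rewrite gtr0_norm// => /(_ sT) N.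
rewrite wE; apply: (near_scale gC gD a0); apply: filterS N => v.
rewrite DE; have -> // : transfer F0 G0 = H.
have uF0 : F0 \in unitmx by have [] := iF0.
apply: (can_inj (mulmxK uF0)); rewrite [in LHS]/transfer mulmxKV//.
by rewrite /F0 (mulmxA H) (mulmxA H) mulmxV// mul1mx.
Qed.

(** Agreement holds on the whole frontier by connectedness, and agreement along the frontier gives
    inclusion by [cone_incl]. The other inclusion is this one with the bodies exchanged. *)
Lemma transfer_incl w : cone K (w *m H) -> cone L w.
Proof.
rewrite -DE; move: w.
have start := agree_start.
have fy : frontier C (homog y).
  by have [Ly ny] := (boundaryP y LM (body_closed bL)).1 by_; split => //; exists 1, y; rewrite scale1r.
have all w : frontier C w -> agree w.
  move=> fw; apply: (frontier_connected (isT : (3 <= d.+3)%N) gC fy fw _ _ _ start).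
  - by move=> a v a0 av; exact: near_scale.
  - by move=> v fv av; apply: filterS (nbhs_interior av) => u uu _.
  - move=> v fv nav; apply: contrapT => nn; apply: nav; apply: agree_limit => // Q NQ.
    apply: contrapT => nQ; apply: nn; apply: filterS NQ => u Qu fu au.
    by apply: nQ; exists u.
have [c ic] := cone_inner gC.
have Cy := fy.1; have Dy : D (homog y) by have [h _] : C (homog y) <-> D (homog y) := nbhs_singleton start; exact: h.
apply: (@cone_incl _ _ D C (homog y) gD gC Dy Cy) => w fw _.
by apply: filterS (all _ fw) => v [_ h].
Qed.

End Inclusion.

Lemma transfer_cone K L x y F G s : body K -> body L -> germ_sym S T K L ->
  geo_boundary K x -> geo_boundary L y -> config K L x y F G s -> T < 2 * `|s| ->
  forall w, cone L w <-> cone K (w *m transfer F G).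
Proof.
move=> bK bL gKL bx by_ cfg Ts w; split; last exact: (transfer_incl bK bL gKL bx by_ cfg Ts).
have uF : F \in unitmx by have [] := config_isomF cfg.
have uG : G \in unitmx by have [] := config_isomG cfg.
move=> Lw; apply: (transfer_incl bL bK (germ_symC aS gKL) by_ bx (config_swap cfg)).
  by rewrite normrN.
rewrite /transfer !mulmxA mulmxKV// -(mulmxA _ S S) SS mulmx1.
by rewrite mulmxK.
Qed.

Lemma transfer_isom K L x y F G s : config K L x y F G s -> isom X (transfer F G).
Proof.
move=> cfg; apply: isomM; last exact: isomV (config_isomF cfg).
by apply: isomM => //; exact: config_isomG cfg.
Qed.

Lemma transfer_point K L x y F G s : config K L x y F G s ->
  homog y *m transfer F G = homog x.
Proof.
move=> cfg; have uF : F \in unitmx by have [] := config_isomF cfg.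
by rewrite /transfer !mulmxA (config_y cfg) gS -(config_x cfg) mulmxK.
Qed.

End Congruence.

(** * Boundary points and the circumcentre *)

Section Balls.
Context {R : realType}.
Variables (X : geometry) (d : nat).
Local Notation k := (curv X : R).
Local Notation V := 'rV[R]_d.+3.
Local Notation P := (ambient R X d.+2).
Implicit Types (s t : R) (u v w c : V) (K L : set P) (x y z p q : P) (E H : 'M[R]_d.+3).

Lemma closure_near (A : set P) z (Q : set V) : A `<=` model R X d.+2 -> geo_closure A z ->
  (\forall v \near homog z, Q v) -> exists2 y, A y & Q (homog y).
Proof.
move=> AM [Mz clz] NQ; have Hz := (homogP z).1 Mz.
have [e e0 eP] := near_Mod Hz NQ.
pose e' := Num.min e 1; have e'0 : 0 < e' by rewrite lt_min e0 ltr01.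
have e'1 : e' <= 1 by rewrite ge_min lexx orbT.
have re' : sq_range X e' by split=> [|_]; [exact: ltW|apply: (le_trans e'1); rewrite ler1n].
have r0 : sq_range X (0 : R) by split=> [|_] //; rewrite ler0n.
have d0 : 0 < dist_of X e' by rewrite -(@dist_of0 R X) dist_of_ltE.
have [y Ay] := clz _ d0; have Hy := (homogP y).1 (AM _ Ay).
rewrite distE//; last exact: AM.
rewrite dist_of_ltE//; last exact: sq_inr.
move=> ye; exists y => //; apply: eP => //; rewrite sqC; apply: lt_le_trans ye _.
by rewrite ge_min lexx.
Qed.

Lemma sublevel_closed w (M : R) :
  geo_closed [set z | model R X d.+2 z /\ sq X (homog z) w <= M].
Proof.
move=> z clz; split; first by have [] := clz.
rewrite leNgt; apply/negP => lt.
have N : \forall v \near homog z, 0 < sq X w v - M.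
  apply: near_pos; last by rewrite subr_gt0 sqC.
  apply: (@continuousB R R^o V (sq X w) (fun=> M)); first exact: sq_continuous.
  exact: cst_continuous.
have [y [_ yM]] := closure_near (fun y (Ay : _ /\ _) => Ay.1) clz N.
by rewrite subr_gt0 sqC ltNge yM.
Qed.

(** Closedness of the cone without a compact base, for the stage at which [K] is not yet known to be
    bounded. *)
Lemma cone_closure K (a : R) u : K `<=` model R X d.+2 -> geo_closed K -> Mod X u -> 0 < a ->
  (forall Q : set V, (\forall v \near a *: u, Q v) -> exists2 v, Q v & cone K v) ->
  cone K (a *: u).
Proof.
move=> KM cK Mu a0 lim; have [z Mz zu] := homog_onto Mu.
exists a, z; rewrite zu; split => //; apply: cK; apply: closureP => // Q; rewrite zu => NQ.
have [e e0 eP] := near_Mod Mu NQ.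
have ca : {for a *: u, continuous (fun v : V => a^-1 *: v)} by apply: scaler_continuous.
pose T : set V := [set w | exists (b : R) v, [/\ 0 < b, Mod X v, w = b *: v & sq X v u < e]].
have NT : \forall w \near u, T w by exact: Mod_near.
have NT' : \forall v \near a *: u, T (a^-1 *: v).
  apply: (@near_comp _ _ _ _ T ca).
  by rewrite scalerA mulVf ?gt_eqF// scale1r.
have [v [b [v' [b0 Mv' vE sv']]] [b1 [y [b10 Ky vE']]]] := lim _ NT'.
exists y => //; have My := (homogP y).1 (KM _ Ky).
have e1 : (a^-1 * b1) *: homog y = b *: v' by rewrite -vE vE' scalerA.
have ab : 0 < a^-1 * b1 by rewrite mulr_gt0 ?invr_gt0.
have [_ yv] := Mod_scale_eq My Mv' ab b0 e1.
by rewrite yv; exact: eP.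
Qed.

Lemma exists_boundary K : X <> Spherical -> K `<` model R X d.+2 -> geo_closed K ->
  geo_interior K !=set0 -> exists x, geo_boundary K x.
Proof.
move=> nS [KM nKM] cK [i [Mi [e e0 iP]]].
have [w Mw nKw] : exists2 w, model R X d.+2 w & ~ K w.
  apply: contrapT => H; apply: nKM => w Mw; apply: contrapT => nKw.
  by apply: H; exists w.
have Hi := (homogP i).1 Mi; have Hw := (homogP w).1 Mw.
have Ki : K i by apply: iP => //; rewrite distE// sqxx dist_of0.
have Di : cone K (homog i) by exists 1, i; rewrite scale1r.
have nDw : ~ cone K (homog w) by move=> /(cone_homog KM Mw).
have fM t : 0 <= t -> t <= 1 -> exists (a : R) u, [/\ 0 < a, Mod X u &
    homog i + t *: (homog w - homog i) = a *: u].
  move=> t0 t1; have := @Mod_sum R X _ (1 - t) t _ _ Hi Hw.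
  rewrite subr_ge0 t0 t1 subrK ltr01 => /(_ isT isT isT)[//|a [u [a0 Mu uE]]].
  exists a, u; split => //; rewrite -uE.
  by apply/rowP => j; rewrite !mxE; ring.
have [t t0 t1|s [s0 s1 Ds ex]] := exit_point Di nDw.
  by have [a [u [a0 Mu ->]]] := fM _ t0 t1; exact: cone_closure.
have fD : frontier (cone K) (homog i + s *: (homog w - homog i)).
  by split => // /ex[t [_ _ Dt]]; apply.
by have [_ [x [_ bx _]]] := frontier_coneP KM cK fD; exists x.
Qed.

Lemma body_boundary L : body L -> exists y, geo_boundary L y.
Proof.
move=> bL; have [w fw _] := exists_smooth (isT : (2 <= d.+3)%N) (cone_good bL).
by have [_ [y [_ by_ _]]] := frontier_coneP (body_model bL) (body_closed bL) fw; exists y.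
Qed.

Definition encloses L c (r : R) : Prop :=
  Mod X c /\ forall z, L z -> sq X (homog z) c <= r.

(** Nearly optimal centres stay in a bounded set and cluster at an optimal one. For two optimal
    centres the midpoint would be strictly closer to every point of [L], and by compactness this
    would beat the infimum. A supporting ball shows that the optimal radius is below pi/2 on the
    sphere. *)
Lemma circumcenter L : body L -> exists c (r : R),
  [/\ encloses L c r, X = Spherical -> r < 2 & forall c', encloses L c' r -> c' = c].
Proof.
move=> bL; have LM := body_model bL; have [y by_] := body_boundary bL.
have Ly : L y by have [] := (boundaryP y LM (body_closed bL)).1 by_.
have [c1 [Mc1 _ c1S c1L]] := body_supp bL by_.
set r1 := sq X (homog y) (homog c1) in c1S c1L.
have Hy := (homogP y).1 (LM _ Ly).
have en1 : encloses L (homog c1) r1 by split => //; exact/homogP.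
pose T := [set r : R | exists c, encloses L c r].
have T1 : T r1 by exists (homog c1).
have Tlb : lbound T 0.
  move=> r [c [Mc cL]]; apply: le_trans (cL _ Ly); exact: sq_ge0.
have Tinf : has_inf T by split; [exists r1|exists 0].
set r := inf T.
have rr1 : r <= r1 by apply: ge_inf => //; exists 0.
have rS : X = Spherical -> r < 2 by move=> /c1S; exact: le_lt_trans.
pose C := [set z | model R X d.+2 z /\ sq X (homog z) (homog y) <= r + 1].
have cC : compact (@homog R X d.+2 @` C).
  apply: homog_compact; [exact: sublevel_closed|by move=> z []|].
  by move=> _; exists y; [exact: LM|exists (r + 1) => z []].
have /boolp.choice[f fP] n : exists c, encloses L c (r + n.+1%:R^-1).
  have n0 : 0 < n.+1%:R^-1 :> R by rewrite invr_gt0.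
  have [r' [c [Mc cL]] lt] := inf_adherent n0 Tinf.
  by exists c; split => // z /cL; move=> H; apply: le_trans H _; exact: ltW.
have fC n : (@homog R X d.+2 @` C) (f n).
  have [Mf fL] := fP n; have [z Mz zf] := homog_onto Mf; exists z => //; split => //.
  rewrite zf sqC; apply: le_trans (fL _ Ly) _.
  by rewrite lerD2l invf_le1// ler1n.
have [_ [c0 [Mc0 _] <-] clus] := cluster_point cC fC.
have Hc0 := (homogP c0).1 Mc0.
have en0 : encloses L (homog c0) r.
  split => // z Lz; rewrite leNgt; apply/negP => /ltr_add_invr[m lt].
  have N : \forall v \near (homog c0 : V), 0 < sq X (homog z) v - (r + m.+1%:R^-1).
    apply: near_pos; last by rewrite subr_gt0.
    apply: (@continuousB R R^o V (sq X (homog z)) (fun=> r + m.+1%:R^-1)).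
      exact: sq_continuous.
    exact: cst_continuous.
  have [n mn] := clus _ N m; rewrite subr_gt0 => lt'.
  have [_ /(_ _ Lz)] := fP n; apply/negP; rewrite -ltNge.
  by apply: le_lt_trans lt'; rewrite lerD2l lef_pV2 ?posrE// ler_nat ltnS.
exists (homog c0), r; split => // c [Mc cL]; apply: contrapT => cc0.
have bilS z : X = Spherical -> L z -> 0 < bil X c (homog z) /\ 0 < bil X (homog c0) (homog z).
  move=> S Lz; have Mz := (homogP z).1 (LM _ Lz).
  have pos c' : Mod X c' -> sq X (homog z) c' <= r -> 0 < bil X c' (homog z).
    move=> Mc' le; have := le_lt_trans le (rS S).
    have k1 : k = 1 by rewrite /curv S.
    have nE : X <> Euclidean by rewrite S.
    rewrite sq_bil// k1 (bilC X c'); set b := bil X _ _; clear -X d; lra.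
  by split; apply: pos => //; [exact: cL|exact: en0.2].
have [a [m [a0 Mm mE]]] : exists (a : R) m, [/\ 0 < a, Mod X m & 1 *: c + 1 *: homog c0 = a *: m].
  apply: Mod_sum => // S /(congr1 (fun v => bil X v (homog y))).
  have [p1 p2] := bilS _ S Ly; rewrite bilNl => e; move: p2; rewrite e oppr_gt0 => p2.
  by have := lt_trans p1 p2; rewrite ltxx.
have mE' : m = a^-1 *: c + a^-1 *: homog c0.
  by rewrite -scalerDr -(scale1r c) -(scale1r (homog c0)) mE scalerA mulVf ?gt_eqF// scale1r.
have ai : 0 < a^-1 by rewrite invr_gt0.
(* [ball_strict] with roles reversed: the ball is centred at [z], and [c] and [c0] are the points in
   it. *)
have mlt z : L z -> sq X m (homog z) < r.
  move=> Lz; have Mz := (homogP z).1 (LM _ Lz); rewrite ltNge; apply/negP => le.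
  apply: cc0; apply: (ball_strict Mc Hc0 Mm Mz ai ai mE').
  - by rewrite sqC; apply: le_trans le; exact: cL.
  - by rewrite sqC; apply: le_trans le; exact: en0.2.
  move=> S; have [p1 p2] := bilS _ S Lz.
  have : 0 < bil X m (homog z) by rewrite mE' !bilE addr_gt0// mulr_gt0.
  have k1 : k = 1 by rewrite /curv S.
  have nE : X <> Euclidean by rewrite S.
  by rewrite sq_bil// k1; set b := bil X _ _; clear -X d; lra.
have cL' := homog_compact (body_closed bL) LM (body_bounded bL).
have [||m' + zmax] := @compact_EVT_max V R (sq X m) (@homog R X d.+2 @` L) _ cL'.
- by exists (homog y), y.
- by apply: continuous_subspaceT; exact: sq_continuous.
move=> /set_mem[zm Lzm zmE].
have : T (sq X m (homog zm)).
  exists m; split => // z Lz; rewrite sqC zmE; apply: zmax.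
  by apply/mem_set; exists z.
have Tl : has_lbound T by exists 0.
by move=> /(ge_inf Tl); rewrite -/r leNgt mlt.
Qed.

End Balls.

(** * Homogeneous bodies are balls *)

Section HomogeneousBall.
Context {R : realType}.
Variables (X : geometry) (d : nat).
Local Notation k := (curv X : R).
Local Notation V := 'rV[R]_d.+3.
Local Notation P := (ambient R X d.+2).
Implicit Types (s t : R) (u v w c : V) (K L : set P) (x y z p q : P) (E H F G S : 'M[R]_d.+3).

Lemma encloses_isom L c r E : body L -> isom X E ->
  (forall w, cone L w <-> cone L (w *m E)) -> encloses L c r -> encloses L (c *m E) r.
Proof.
move=> bL iE LE [Mc cL]; have [uE _ _ ME] := iE; split; first exact: ME.
have LM := body_model bL; move=> z Lz; have Mz := (homogP z).1 (LM _ Lz).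
have [_ _ _ MEi] := isomV iE.
have [z' Mz' zE'] := homog_onto (MEi _ Mz).
have zE : homog z = homog z' *m E by rewrite zE' mulmxKV.
have Lz' : L z'.
  apply/(cone_homog LM Mz')/LE; rewrite -zE; by exists 1, z; rewrite scale1r.
by rewrite zE isom_sq//; [exact: cL|exact/homogP].
Qed.

(** By uniqueness the circumcentre [c] is fixed by every self-congruence, so all boundary points are
    at one distance from [c], and the farthest point is among them. A point of that ball off [L]
    would put a boundary point strictly inside a segment of the ball, at maximal distance from [c],
    against strict convexity. *)
Lemma homogeneous_ball L : body L ->
  (forall y y', geo_boundary L y -> geo_boundary L y' -> exists E, [/\ isom X E,
     forall w, cone L w <-> cone L (w *m E) & homog y *m E = homog y']) ->
  is_geo_ball L.
Proof.
move=> bL hom; have LM := body_model bL; have cL := body_closed bL.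
have [c [r [[Mc cr] rS cuniq]]] := circumcenter bL.
have [y0 by0] := body_boundary bL.
have Ly0 : L y0 by have [] := (boundaryP y0 LM cL).1 by0.
have H0 := (homogP y0).1 (LM _ Ly0).
set rho := sq X (homog y0) c.
have rhoS : X = Spherical -> rho < 2 by move=> /rS; exact: le_lt_trans (cr _ Ly0).
have bnd y : geo_boundary L y -> sq X (homog y) c = rho.
  move=> by_; have [E [iE LE yE]] := hom _ _ by0 by_.
  have cE : c *m E = c by apply: cuniq; exact: encloses_isom.
  by rewrite -yE -{1}cE isom_sq.
have cL' := homog_compact cL LM (body_bounded bL).
have [||m' + zmax] := @compact_EVT_max V R (sq X c) (@homog R X d.+2 @` L) _ cL'.
- by exists (homog y0), y0.
- by apply: continuous_subspaceT; exact: sq_continuous.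
move=> /set_mem[zm Lzm zmE]; have Mzm := (homogP zm).1 (LM _ Lzm).
have {}zmax z : L z -> sq X (homog z) c <= sq X (homog zm) c.
  move=> Lz; rewrite !(sqC X _ c) zmE; apply: zmax; apply/mem_set; by exists z.
(* An interior farthest point could be passed on the line from [y0]; it would then lie between two
   points of [L] no farther from [c], and strict convexity identifies it with the boundary point
   [y0]. *)
have bzm : geo_boundary L zm.
  apply/boundaryP => //; split => // izm.
  have [e e0 eP] := near_line (homog y0) izm.
  have e20 : 0 < e / 2 by rewrite divr_gt0.
  have [|a [u [a0 Lu uE]]] := eP (- (e / 2)).
    by rewrite normrN gtr0_norm// ltr_pdivrMr// ltr_pMr// ltr1n.
  have Mu := (homogP u).1 (LM _ Lu).
  have zmE' : homog zm = a *: homog u + (e / 2) *: homog y0 by rewrite -uE scaleNr subrK.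
  have zmS : X = Spherical -> sq X (homog zm) c < 2 by move=> /rS; exact: le_lt_trans (cr _ Lzm).
  have uy := ball_strict Mu H0 Mzm Mc a0 e20 zmE' (zmax _ Lu) (zmax _ Ly0) zmS.
  have zy : homog zm = homog y0.
    have e1 : 1 *: homog zm = (a + e / 2) *: homog y0 by rewrite scale1r zmE' uy scalerDl.
    by have [] := Mod_scale_eq Mzm H0 ltr01 (addr_gt0 a0 e20) e1.
  have [_] := (boundaryP y0 LM cL).1 by0; apply; by rewrite -zy.
have rho_max z : L z -> sq X (homog z) c <= rho by move=> /zmax; rewrite (bnd _ bzm).
have [i [Mi ii]] := body_inner bL.
have Ii : inner (cone L) (homog i) by apply/inner_coneP.
have Li : L i by apply/(cone_homog LM Mi); exact: innerW Ii.
have Hi := (homogP i).1 Mi.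
have rho0 : 0 < rho.
  have y0i : homog i <> homog y0.
    by move=> e; have [_] := (boundaryP y0 LM cL).1 by0; apply; rewrite -e.
  rewrite lt_neqAle sq_ge0// andbT; apply/eqP => /esym e; apply: y0i.
  have := rho_max _ Li; rewrite e => le0.
  rewrite (sq_eq0 H0 Mc e); apply: (sq_eq0 Hi Mc).
  by apply: le_anti; rewrite le0 sq_ge0.
have all (w : P) : model R X d.+2 w -> sq X (homog w) c <= rho -> L w.
  move=> Mw le; apply: contrapT => nLw; have Hw := (homogP w).1 Mw.
  have Di : cone L (homog i) by exact: innerW.
  have nDw : ~ cone L (homog w) by move=> /(cone_homog LM Mw).
  have fM t : 0 <= t -> t <= 1 -> exists (a : R) u, [/\ 0 < a, Mod X u &
      homog i + t *: (homog w - homog i) = a *: u].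
    move=> t0 t1; have [||||a [u [a0 Mu uE]]] := @Mod_sum R X _ (1 - t) t _ _ Hi Hw.
    - by rewrite subr_ge0.
    - by [].
    - by rewrite subrK ltr01.
    - move=> S /(congr1 (fun v => bil X v c)); rewrite bilNl => e.
      have nE : X <> Euclidean by rewrite S.
      have k1 : k = 1 by rewrite /curv S.
      have := le_lt_trans le (rhoS S); have := le_lt_trans (rho_max _ Li) (rhoS S).
      rewrite !sq_bil// k1 e; set b := bil X _ _; clear -X d; lra.
    exists a, u; split => //; rewrite -uE.
    by apply/rowP => j; rewrite !mxE; ring.
  have [t t0 t1|s [s0 s1 Ds ex]] := exit_point Di nDw.
    by have [a [u [a0 Mu ->]]] := fM _ t0 t1; exact: cone_closure.
  have fD : frontier (cone L) (homog i + s *: (homog w - homog i)).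
    by split => // /ex[t [_ _ Dt]]; apply.
  have [a [y [a0 by_ yE]]] := frontier_coneP LM cL fD.
  have s00 : 0 < s.
    rewrite lt_neqAle s0 andbT; apply/eqP => e.
    by have [_] := fD; rewrite -e scale0r addr0.
  have ai : 0 < a^-1 by rewrite invr_gt0.
  have Ly : L y by have [] := (boundaryP y LM cL).1 by_.
  have My := (homogP y).1 (LM _ Ly).
  have yE' : homog y = (a^-1 * (1 - s)) *: homog i + (a^-1 * s) *: homog w.
    rewrite -!scalerA -scalerDr.
    have -> : (1 - s) *: homog i + s *: homog w = a *: homog y.
      by rewrite -yE; apply/rowP => j; rewrite !mxE; ring.
    by rewrite scalerA mulVf ?gt_eqF// scale1r.
  have p1 : 0 < a^-1 * (1 - s) by rewrite mulr_gt0// subr_gt0.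
  have p2 : 0 < a^-1 * s by rewrite mulr_gt0.
  apply: nLw; have -> // : w = i.
  apply: homog_inj; apply/esym; apply: (ball_strict Hi Hw My Mc p1 p2 yE').
  - by rewrite (bnd _ by_); exact: rho_max.
  - by rewrite (bnd _ by_).
  - by rewrite (bnd _ by_).
have [c0 Mc0 c0E] := homog_onto Mc.
have r0 : sq_range X (0 : R) by split=> [|_] //; rewrite ler0n.
have rrho : sq_range X rho by exact: sq_inr.
exists c0, (dist_of X rho); split => //.
  split; first by rewrite -(@dist_of0 R X) dist_of_ltE.
  move=> S; rewrite -(@dist_of2 R X S) dist_of_ltE//; first exact: rhoS.
  by split => // _; rewrite ler_nat.
apply/seteqP; split=> z.
  move=> Lz; have Mz := LM _ Lz; have Hz := (homogP z).1 Mz; split => //.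
  by rewrite distE// c0E dist_of_leE//; [rewrite sqC; exact: rho_max|exact: sq_inr].
move=> [Mz]; have Hz := (homogP z).1 Mz.
by rewrite distE// c0E dist_of_leE// 1?sqC; [exact: all|exact: sq_inr].
Qed.

(** Pairing [y] and [y'] with the same [x] gives two congruences from [L] to [K]; one followed by
    the inverse of the other preserves [L] and takes [y] to [y']. *)
Lemma ball_of_germ S (T : R) K L : axis_sym X S -> (X = Spherical -> T < pi) -> body K -> body L ->
  germ_sym S T K L -> is_geo_ball L.
Proof.
move=> aS TS bK bL gKL; apply: homogeneous_ball => // y y' by_ by_'.
have [x bx] := body_boundary bK.
have [F [G [s [cfg Ts]]]] := exists_config bK bL bx by_ TS.
have [F' [G' [s' [cfg' Ts']]]] := exists_config bK bL bx by_' TS.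
have H1 := transfer_cone aS TS bK bL gKL bx by_ cfg Ts.
have H2 := transfer_cone aS TS bK bL gKL bx by_' cfg' Ts'.
have i1 := transfer_isom aS cfg; have i2 := transfer_isom aS cfg'.
have u2 : transfer S F' G' \in unitmx by have [] := i2.
exists (transfer S F G *m invmx (transfer S F' G')); split.
- exact: isomM i1 (isomV i2).
- by move=> w; split=> [/H1 h|/H2]; [apply/H2|move=> h; apply/H1]; move: h; rewrite mulmxA mulmxKV.
- by rewrite mulmxA (transfer_point aS cfg) -(transfer_point aS cfg') mulmxK.
Qed.

Lemma congruent_of_germ S (T : R) K L : axis_sym X S -> (X = Spherical -> T < pi) ->
  body K -> body L -> germ_sym S T K L -> congruent K L.
Proof.
move=> aS TS bK bL gKL; have KM := body_model bK; have LM := body_model bL.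
have [x bx] := body_boundary bK; have [y by_] := body_boundary bL.
have [F [G [s [cfg Ts]]]] := exists_config bK bL bx by_ TS.
have H1 := transfer_cone aS TS bK bL gKL bx by_ cfg Ts.
have iH := transfer_isom aS cfg; have iHi := isomV iH; have [uH _ _ MH] := iH.
have cE z : model R X d.+2 z -> L z <-> cone K (homog z *m transfer S F G).
  by move=> Mz; rewrite -H1; exact: iff_sym (cone_homog LM Mz).
exists (@act R X d.+2 (invmx (transfer S F G))); first exact: act_congruence.
apply/seteqP; split=> z.
  move=> [z' Kz' <-]; have Mz' := KM _ Kz'.
  apply/cE; first exact: act_model.
  by rewrite homog_act// mulmxKV//; exists 1, z'; rewrite scale1r.
move=> Lz; have Mz := LM _ Lz; have /(cE _ Mz) := Lz.
rewrite -homog_act// => Kz; have Mz' := act_model iH Mz.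
by exists (act (transfer S F G) z); [exact/(cone_homog KM)|exact: actK].
Qed.

End HomogeneousBall.

(** * From the symmetry statements to symmetric germs *)

Section GermOfSymmetry.
Context {R : realType}.
Variables (X : geometry) (d : nat).
Local Notation V := 'rV[R]_d.+3.
Local Notation P := (ambient R X d.+2).
Local Notation gamma := (@axis R X d).
Local Notation O := (@regO R X d).
Implicit Types (s t : R) (u v w : V) (K L W : set P) (x y z p q : P) (F G S : 'M[R]_d.+3).

Lemma body_of_supports K : K `<` model R X d.+2 -> geo_closed K -> geo_convex K ->
  geo_interior K !=set0 -> (exists2 S, region S & K `<=` S) ->
  (forall x, geo_boundary K x -> has_supporting_sphere K x) -> body K.
Proof.
move=> pK cK vK iK rK sK; have [KM _] := pK.
have supp x : geo_boundary K x -> exists c, supp_center K x c.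
  move=> bx; have [Kx _] := (boundaryP x KM cK).1 bx.
  exact: supp_centerP KM (KM _ Kx) (sK _ bx).
split => // nS; have [x bx] := exists_boundary nS pK cK iK.
have [c [Mc _ _ Kc]] := supp _ bx; exists c => //.
by exists (sq X (homog x) (homog c)).
Qed.

Section OneConfig.
Variables (K L : set P) (x y : P) (F G : 'M[R]_d.+3) (s : R).
Hypotheses (bK : body K) (bL : body L) (bx : geo_boundary K x) (by_ : geo_boundary L y)
  (cfg : config K L x y F G s).

Local Notation f := (@act R X d.+2 F).
Local Notation g := (@act R X d.+2 G).
Local Notation M := (joint_hull O f g K L).
Local Notation A := (img F (cone K)).
Local Notation B := (img G (cone L)).

Definition fills W : Prop :=
  [/\ W (f x), W (g y), \forall w \near gamma s, cone M w -> cone W w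
    & \forall w \near gamma (- s), cone M w -> cone W w].

Lemma hull_fills : fills M.
Proof.
split; [| |exact: filterE|exact: filterE].
  apply: hull_sub; left; exists x => //.
  by have [] := (boundaryP x (body_model bK) (body_closed bK)).1 bx.
apply: hull_sub; right; exists y => //.
by have [] := (boundaryP y (body_model bL) (body_closed bL)).1 by_.
Qed.

Lemma central_germ W : W `<=` M -> fills W -> centrally_symmetric W ->
  \forall w \near gamma s, join A B w <-> join A B (w *m @central_sym R d).
Proof.
move=> WM [Wp Wq N1 N2] [c Mc cW]; have [iS SS gS] := central_symP X d (R := R).
apply: (sym_germ bK bL cfg WM cW _ SS (gS s) N1 N2).
exact: (reflection_central bK bL bx by_ cfg WM Wp Wq Mc cW).
Qed.

Lemma axial_germ W : W `<=` M -> fills W -> bisector_symmetric (f x) (g y) W ->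
  \forall w \near gamma s, join A B w <-> join A B (w *m @axial_sym R d).
Proof.
move=> WM [Wp Wq N1 N2] sW; have [iS SS gS] := axial_symP X d (R := R).
apply: (sym_germ bK bL cfg WM sW _ SS (gS s) N1 N2) => z Wz.
by apply: (reflection_axial bK bL bx by_ cfg); exact: WM.
Qed.

End OneConfig.

Section Far.
Variables (K L : set P).
Hypotheses (bK : body K) (bL : body L).

Lemma far_germ S (Q : set P -> (P -> P) -> (P -> P) -> P -> P -> Prop) :
  (forall x y F G s, geo_boundary K x -> geo_boundary L y -> config K L x y F G s ->
     Q O (@act R X d.+2 F) (@act R X d.+2 G) x y ->
     \forall w \near gamma s, join (img F (cone K)) (img G (cone L)) w <->
       join (img F (cone K)) (img G (cone L)) (w *m S)) ->
  for_all_far K L Q -> exists2 T, (X = Spherical -> T < pi) & germ_sym S T K L.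
Proof.
move=> QS [T TS TQ]; exists T => // x y F G s bx by_ cfg Ts.
apply: (QS _ _ _ _ _ bx by_ cfg); apply: TQ => //; first exact: (config_admissible bK bL cfg).
  by rewrite (config_diam bK bL bx by_ cfg).
exact: (config_unique bK bL bx by_ cfg).
Qed.

Lemma far_central : for_all_far K L (fun Z f g x y =>
    centrally_symmetric (joint_hull Z f g K L)) ->
  exists2 T, (X = Spherical -> T < pi) & germ_sym (@central_sym R d) T K L.
Proof.
apply: far_germ => x y F G s bx by_ cfg; apply: (central_germ bK bL bx by_ cfg) => //.
exact: hull_fills.
Qed.

Lemma far_axial : for_all_far K L (fun Z f g x y =>
    bisector_symmetric (f x) (g y) (joint_hull Z f g K L)) ->
  exists2 T, (X = Spherical -> T < pi) & germ_sym (@axial_sym R d) T K L.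
Proof.
apply: far_germ => x y F G s bx by_ cfg; apply: (axial_germ bK bL bx by_ cfg) => //.
exact: hull_fills.
Qed.

Lemma far_central_local : for_all_far K L (fun Z f g x y => exists e0 : R,
    [/\ 0 < e0, thickening Z (f x) (g y) e0 `<=` Z & forall e : R, 0 < e -> e < e0 ->
       centrally_symmetric (joint_hull Z f g K L `&` thickening Z (f x) (g y) e)]) ->
  exists2 T, (X = Spherical -> T < pi) & germ_sym (@central_sym R d) T K L.
Proof.
apply: far_germ => x y F G s bx by_ cfg [e0 [e00 _ sym]].
have e20 : 0 < e0 / 2 by rewrite divr_gt0.
have e2 : e0 / 2 < e0 by rewrite ltr_pdivrMr// ltr_pMr// ltr1n.
apply: (central_germ bK bL bx by_ cfg _ _ (sym _ e20 e2)); first by move=> z [].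
exact: (thickening_germ bK bL bx by_ cfg e20).
Qed.

Lemma far_axial_local : for_all_far K L (fun Z f g x y => exists e0 : R,
    [/\ 0 < e0, thickening Z (f x) (g y) e0 `<=` Z & forall e : R, 0 < e -> e < e0 ->
       bisector_symmetric (f x) (g y)
         (joint_hull Z f g K L `&` thickening Z (f x) (g y) e)]) ->
  exists2 T, (X = Spherical -> T < pi) & germ_sym (@axial_sym R d) T K L.
Proof.
apply: far_germ => x y F G s bx by_ cfg [e0 [e00 _ sym]].
have e20 : 0 < e0 / 2 by rewrite divr_gt0.
have e2 : e0 / 2 < e0 by rewrite ltr_pdivrMr// ltr_pMr// ltr1n.
apply: (axial_germ bK bL bx by_ cfg _ _ (sym _ e20 e2)); first by move=> z [].
exact: (thickening_germ bK bL bx by_ cfg e20).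
Qed.

End Far.

Lemma balls_of_germ S (T : R) K L : axis_sym X S -> (X = Spherical -> T < pi) ->
  body K -> body L -> germ_sym S T K L ->
  [/\ is_geo_ball K, is_geo_ball L & congruent K L].
Proof.
move=> aS TS bK bL gKL; split; first exact: (ball_of_germ aS TS bL bK (germ_symC aS gKL)).
  exact: (ball_of_germ aS TS bK bL gKL).
exact: (congruent_of_germ aS TS bK bL gKL).
Qed.

End GermOfSymmetry.

(** * Hulls of two congruent balls *)

Section TwoBalls.
Context {R : realType}.
Variables (X : geometry) (d : nat).
Local Notation k := (curv X : R).
Local Notation V := 'rV[R]_d.+3.
Local Notation P := (ambient R X d.+2).
Local Notation gamma := (@axis R X d).
Implicit Types (s t : R) (u v w c : V) (A : set V) (K L W : set P) (x y z p q : P)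
  (F N : 'M[R]_d.+3).

Lemma swap_conj F u v w : isom X F -> Mod X u -> Mod X v -> Mod X w ->
  (w *m F) *m swap X (u *m F) (v *m F) = (w *m swap X u v) *m F.
Proof.
move=> iF Mu Mv Mw; have [_ _ _ MF] := iF.
rewrite (swap_Mod (MF _ Mu) (MF _ Mv) (MF _ Mw)) (swap_Mod Mu Mv Mw).
by rewrite !isom_sq// mulmxBl -scalemxAl mulmxBl.
Qed.

(** If [u] were outside, [u1] and [u2] would both be closer to [c] than [u], and [ball_strict] would
    make the three points coincide. *)
Lemma ball_comb (a b : R) u1 u2 u c (M : R) : Mod X u1 -> Mod X u2 -> Mod X u -> Mod X c ->
  0 <= a -> 0 <= b -> u = a *: u1 + b *: u2 -> sq X u1 c <= M -> sq X u2 c <= M ->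
  (X = Spherical -> M < 2) -> sq X u c <= M.
Proof.
move=> M1 M2 Mu Mc a0 b0 uE s1 s2 M2S.
have one (e : R) w : Mod X w -> 0 <= e -> u = e *: w -> u = w.
  move=> Mw; rewrite le_eqVlt => /predU1P[<-|e0].
    by rewrite scale0r => u0; have := Mod_neq0 Mu; rewrite u0 eqxx.
  move=> uw; have e1 : 1 *: u = e *: w by rewrite scale1r.
  by have [] := Mod_scale_eq Mu Mw ltr01 e0 e1.
move: a0; rewrite le_eqVlt => /predU1P[a0|a0].
  by move: uE; rewrite -a0 scale0r add0r => /(one _ _ M2 b0) ->.
move: b0; rewrite le_eqVlt => /predU1P[b0|b0].
  by move: uE; rewrite -b0 scale0r addr0 => /(one _ _ M1 (ltW a0)) ->.
rewrite leNgt; apply/negP => lt.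
have uS : X = Spherical -> sq X u c < 2.
  move=> S; have nE : X <> Euclidean by rewrite S.
  have k1 : k = 1 by rewrite /curv S.
  have h1 := le_lt_trans s1 (M2S S); have h2 := le_lt_trans s2 (M2S S).
  move: h1 h2; rewrite !sq_bil// k1 uE !bilE; set p := bil X u1 c; set q := bil X u2 c => h1 h2.
  have p0 : 0 < p by move: h1; clear -X d; lra.
  have q0 : 0 < q by move: h2; clear -X d; lra.
  have := addr_gt0 (mulr_gt0 a0 p0) (mulr_gt0 b0 q0).
  by set e := _ + _; clear -X d; lra.
have l1 : sq X u1 c <= sq X u c by apply: le_trans s1 _; exact: ltW.
have l2 : sq X u2 c <= sq X u c by apply: le_trans s2 _; exact: ltW.
have e12 := ball_strict M1 M2 Mu Mc a0 b0 uE l1 l2 uS.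
have uE' : u = (a + b) *: u1 by rewrite uE -e12 scalerDl.
have := one _ _ M1 (ltW (addr_gt0 a0 b0)) uE' => e.
by move: lt; rewrite e ltNge s1.
Qed.

Lemma sq_gammaE s t s' t' : (X = Spherical -> `|s - t| <= pi) -> `|s - t| = `|s' - t'| ->
  sq X (gamma s) (gamma t) = sq X (gamma s') (gamma t').
Proof.
move=> st e; apply: (@dist_of_inj R X); try (apply: sq_inr; exact: Mod_gamma).
by rewrite !dist_of_gamma// -e.
Qed.

Lemma dist_bounds x y : model R X d.+2 x -> model R X d.+2 y ->
  0 <= dist x y /\ (X = Spherical -> dist x y <= pi).
Proof.
move=> Mx My; have Hx := (homogP x).1 Mx; have Hy := (homogP y).1 My; rewrite distE//.
have r0 : sq_range X (0 : R) by split=> [|_] //; rewrite ler0n.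
have rxy : sq_range X (sq X (homog x) (homog y)) by exact: sq_inr.
split; first by rewrite -(@dist_of0 R X) dist_of_leE//; have [] := rxy.
move=> S; have ph : pi / 2 - - (pi / 2) = pi :> R by rewrite opprK -splitr.
have pn : `|pi / 2 - - (pi / 2)| = pi :> R by rewrite ph ger0_norm// pi_ge0.
have <- : dist_of X (sq X (gamma (pi / 2)) (gamma (- (pi / 2)))) = pi.
  by rewrite dist_of_gamma ?pn.
rewrite dist_of_leE//; last by apply: sq_inr; exact: Mod_gamma.
have -> : sq X (gamma (pi / 2)) (gamma (- (pi / 2))) = 4.
  by rewrite sq_gamma_opp /gsin S sin_pihalf expr1n mulr1.
by have [_] := rxy; apply.
Qed.

Lemma congruence_ball f x (r : R) : congruence f -> model R X d.+2 x ->
  f @` geo_ball x r = geo_ball (f x) r.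
Proof.
move=> [[fM _ fS] fd] Mx; apply/seteqP; split=> z.
  by move=> [y [My xy] <-]; split; [exact: fM|rewrite fd].
move=> [Mz xz]; have [y My yz] := fS _ Mz; exists y => //; split => //.
by rewrite -fd// yz.
Qed.

Section Frame.
Variables (a b : P) (r : R) (S : set P).
Hypotheses (Ma : model R X d.+2 a) (Mb : model R X d.+2 b) (r0 : 0 < r) (rS : region S)
  (aS : geo_ball a r `<=` S) (bS : geo_ball b r `<=` S).

(** [t] is half the distance of the centres, and [F] carries the axis to their line. On the sphere,
    if [t + r] reached pi/2, the two balls would contain a pair of antipodal points of that line,
    which no open hemisphere does. *)
Lemma ball_frame : exists F (t : R), [/\ isom X F, 0 <= t, homog a = gamma (- t) *m F,
  homog b = gamma t *m F & small X (t + r)].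
Proof.
have [d0 dS] := dist_bounds Ma Mb.
have Ha := (homogP a).1 Ma; have Hb := (homogP b).1 Mb.
pose t := dist a b / 2; have t0 : 0 <= t by rewrite divr_ge0.
have tt : `|- t - t| = dist a b.
  by rewrite -opprD normrN ger0_norm ?addr_ge0// /t -splitr.
have sE : sq X (gamma (- t)) (gamma t) = sq X (homog a) (homog b).
  apply: (@dist_of_inj R X); try (apply: sq_inr => //; exact: Mod_gamma).
  by rewrite dist_of_gamma ?tt// -distE.
have [F [iF aF bF]] := isom_pair (Mod_gamma X d (- t)) (Mod_gamma X d t) Ha Hb sE.
have [_ _ _ MF] := iF.
exists F, t; split => // E; rewrite ger0_norm; last exact: (addr_ge0 t0 (ltW r0)).
rewrite ltNge; apply/negP => le; have tp : t <= pi / 2 by rewrite ler_pM2r ?invr_gt0// dS.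
have near_end s s' : `|s| = t -> s' - s = pi / 2 - t \/ s' - s = - (pi / 2 - t) ->
    dist_of X (sq X (gamma s) (gamma s')) <= r.
  move=> st ss; have e : `|s - s'| = pi / 2 - t.
    rewrite distrC; have p0 : 0 <= pi / 2 - t by rewrite subr_ge0.
    by case: ss => ->; rewrite ?normrN ger0_norm.
  have pp := @pi_ge0 R.
  rewrite dist_of_gamma e; first by rewrite lerBlDl.
  move=> _; rewrite lerBlDl; apply: (@le_trans _ _ (pi : R)); last by rewrite lerDr.
  by rewrite ler_pdivrMr// ler_peMr// ler1n.
pose x : P := unhomog X (gamma (- (pi / 2)) *m F); pose y : P := unhomog X (gamma (pi / 2) *m F).
have M1 := MF _ (Mod_gamma X d (- (pi / 2))); have M2 := MF _ (Mod_gamma X d (pi / 2)).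
have Mx : model R X d.+2 x by exact: unhomog_model.
have My : model R X d.+2 y by exact: unhomog_model.
have Sx : S x.
  apply: aS; split => //; rewrite distE// unhomogK// -aF isom_sq; try exact: Mod_gamma; last by [].
  by apply: near_end; rewrite ?normrN ?ger0_norm//; right; ring.
have Sy : S y.
  apply: bS; split => //; rewrite distE// unhomogK// -bF isom_sq; try exact: Mod_gamma; last by [].
  by apply: near_end; rewrite ?ger0_norm//; left.
apply: (region_not_opp rS Sx Sy E); apply: homog_inj; rewrite homogN// !unhomogK// -mulNmx.
congr (_ *m F); apply: hdtlP; rewrite !(hd_gamma, tl_gamma, hdtlE) ?cnN ?snN.
  by rewrite /gcos E cos_pihalf oppr0.
by rewrite scaleNr opprK.
Qed.

End Frame.
End TwoBalls.

(** * Invariance of hulls and thickenings *)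

Section Invariance.
Context {R : realType}.
Variables (X : geometry) (d : nat).
Local Notation k := (curv X : R).
Local Notation cn := (@gcos R X).
Local Notation V := 'rV[R]_d.+3.
Local Notation P := (ambient R X d.+2).
Local Notation gamma := (@axis R X d).
Implicit Types (s t : R) (u v w c : V) (A : set V) (K L W S : set P) (x y z p q : P)
  (F N : 'M[R]_d.+3).

Lemma small_norm s : small X s -> 0 <= s -> X = Spherical -> s < pi / 2.
Proof. by move=> sm s0 E; have := sm E; rewrite ger0_norm. Qed.

Lemma sq_gamma_lt2 s : small X s -> X = Spherical -> sq X (gamma s) (gamma 0) < 2.
Proof.
move=> sm E; have nE : X <> Euclidean by rewrite E.
have k1 : k = 1 by rewrite /curv E.
have c0 : 0 < cn s by exact: cn_gt0.
rewrite sq_bil//; try exact: Mod_gamma.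
by rewrite bil_gamma subr0 k1; move: c0; set c := gcos X s; clear -X d; lra.
Qed.

Lemma ball_sq x (r : R) z : model R X d.+2 x -> small X r -> 0 <= r ->
  geo_ball x r z <-> model R X d.+2 z /\
    sq X (homog z) (homog x) <= sq X (gamma r) (gamma 0).
Proof.
move=> Mx sm r0; have Hx := (homogP x).1 Mx.
have rE : dist_of X (sq X (gamma r) (gamma 0)) = r.
  rewrite dist_of_gamma subr0 ger0_norm// => E; apply/ltW.
  apply: lt_le_trans (small_norm sm r0 E) _.
  by rewrite ler_pdivrMr// ler_peMr ?ler1n// pi_ge0.
have key : model R X d.+2 z ->
    (dist x z <= r) = (sq X (homog z) (homog x) <= sq X (gamma r) (gamma 0)).
  move=> Mz; have Hz := (homogP z).1 Mz; rewrite distE// -[X in _ <= X]rE dist_of_leE 1?sqC//.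
    exact: sq_inr.
  by apply: sq_inr; exact: Mod_gamma.
by split=> -[Mz]; [rewrite key|rewrite -key].
Qed.

Lemma ball_convex x (r : R) : model R X d.+2 x -> small X r -> 0 <= r ->
  geo_convex (geo_ball x r).
Proof.
move=> Mx sm r0; have Hx := (homogP x).1 Mx; split=> [z []//|y z].
move=> /(ball_sq _ Mx sm r0)[My yx] /(ball_sq _ Mx sm r0)[Mz zx] _ w.
move=> /(segmentP _ My Mz)[Mw [a [b [a0 b0 wE]]]]; apply/ball_sq => //; split => //.
apply: (ball_comb ((homogP y).1 My) ((homogP z).1 Mz) ((homogP w).1 Mw) Hx a0 b0 wE yx zx).
by move=> E; exact: sq_gamma_lt2.
Qed.

(** Relational, because the reflections of the statement are prescribed on the model only. *)
Definition preserves N W : Prop := forall z z', W z -> model R X d.+2 z' ->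
  homog z' = homog z *m N -> W z'.

Lemma image_invariant N W (sigma : P -> P) : W `<=` model R X d.+2 -> isom X N ->
  N *m N = 1%:M -> preserves N W ->
  (forall z, model R X d.+2 z -> homog (sigma z) = homog z *m N) -> sigma @` W = W.
Proof.
move=> WM iN NN WN sN; have [_ _ _ MN] := iN.
have Ms z : model R X d.+2 z -> model R X d.+2 (sigma z).
  by move=> Mz; apply/homogP; rewrite sN//; apply: MN; exact/homogP.
have Ws z : W z -> W (sigma z) by move=> Wz; apply: (WN z) => //; [exact/Ms/WM|exact/sN/WM].
apply/seteqP; split=> [_ [z Wz <-]|z Wz]; first exact: Ws.
exists (sigma z); first exact: Ws.
have Mz := WM _ Wz; apply: homog_inj; rewrite sN; last exact: Ms.
by rewrite sN// -mulmxA NN mulmx1.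
Qed.

Lemma invariantI N W W' : preserves N W -> preserves N W' -> preserves N (W `&` W').
Proof. by move=> i i' z z' [Wz Wz'] Mz' e; split; [exact: i e|exact: i' e]. Qed.

Lemma invariant_closure N W : W `<=` model R X d.+2 -> isom X N -> preserves N W ->
  preserves N (geo_closure W).
Proof.
move=> WM iN WN z z' [Mz clz] Mz' zE; split => // e /clz[y Wy zy].
have [_ _ _ MN] := iN; have My := WM _ Wy; have Hy := (homogP y).1 My.
have [y' My' yE] := homog_onto (MN _ Hy).
exists y'; first exact: (WN y).
by rewrite distE// zE yE isom_sq//; [rewrite -distE|exact/homogP].
Qed.

Lemma invariant_hull N S K L : region S -> K `<=` S -> L `<=` S -> geo_convex K ->
  geo_convex L -> isom X N ->
  (forall z z', K z -> model R X d.+2 z' -> homog z' = homog z *m N -> L z') ->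
  (forall z z', L z -> model R X d.+2 z' -> homog z' = homog z *m N -> K z') ->
  preserves N (hull S (K `|` L)).
Proof.
move=> rS KS LS vK vL iN KL LK z z' Hz Mz' zE; have [_ _ _ MN] := iN.
have [HS _ cH] := hull_cone rS KS LS (cone_addP rS KS vK) (cone_addP rS LS vL).
have HM : hull S (K `|` L) `<=` model R X d.+2 by move=> y /HS/(region_model rS).
have tr (A B : set P) : A `<=` S ->
    (forall z z', A z -> model R X d.+2 z' -> homog z' = homog z *m N -> B z') ->
    forall w, cone A w -> cone B (w *m N).
  move=> AS AB _ [a [y [a0 Ay ->]]].
  have Hy := (homogP y).1 (region_model rS (AS _ Ay)).
  have [y' My' yE] := homog_onto (MN _ Hy).
  by exists a, y'; split => //; [exact: AB yE|rewrite yE scalemxAl].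
have Mz := HM _ Hz; apply/(cone_homog HM Mz')/cH; rewrite zE.
have /cH[Kz|Lz|[u [v [Ku Lv ->]]]] := (cone_homog HM Mz).2 Hz.
- by apply: Or32; exact: tr Kz.
- by apply: Or31; exact: tr Lz.
- apply: Or33; exists (v *m N), (u *m N); split; [exact: tr Lv|exact: tr Ku|].
  by rewrite mulmxDl addrC.
Qed.

Lemma region_nonspherical S : region S -> X <> Spherical -> S = model R X d.+2.
Proof. by rewrite /region; case: (X) S => // S ->. Qed.

(** With [m] half the smaller value of the form [h] at the two ends, small balls stay in the part
    where [h] is at least [m]. That part is convex and closed, so the closed hull cannot reach the
    boundary of the hemisphere. The bound 1/2 on [e0] keeps the balls convex on the sphere. *)
Lemma exists_thin S p q : region S -> S p -> S q -> exists e0 : R,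
  [/\ 0 < e0, small X e0, orthogonal_ball p q e0 `<=` S, orthogonal_ball q p e0 `<=` S
    & thickening S p q e0 `<=` S].
Proof.
move=> rS Sp Sq; have [h hS] := region_formP rS.
have [[Mp hp] [Mq hq]] := ((hS p).1 Sp, (hS q).1 Sq).
pose m := Num.min (dot h (homog p)) (dot h (homog q)) / 2.
have m00 : 0 < Num.min (dot h (homog p)) (dot h (homog q)) by rewrite lt_min hp.
have m0 : 0 < m by rewrite divr_gt0.
have mm : m < Num.min (dot h (homog p)) (dot h (homog q)).
  by rewrite ltr_pdivrMr// ltr_pMr// ltr1n.
have near_end x : model R X d.+2 x -> m < dot h (homog x) -> exists2 e : R, 0 < e &
    forall e', e' <= e -> forall z, geo_ball x e' z -> m <= dot h (homog z).
  move=> Mx mx; have Hx := (homogP x).1 Mx.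
  have N : \forall v \near homog x, 0 < dot h v - m.
    apply: near_pos; last by rewrite subr_gt0.
    apply: (@continuousB R R^o V (dot h) (fun=> m)); first exact: dot_continuous.
    exact: cst_continuous.
  have [e e0 eP] := near_Mod Hx N.
  pose e1 := Num.min e 1; have e10 : 0 < e1 by rewrite lt_min e0 ltr01.
  have e11 : e1 <= 1 by rewrite ge_min lexx orbT.
  have re1 : sq_range X e1 by split=> [|_]; [exact: ltW|apply: (le_trans e11); rewrite ler1n].
  have r0 : sq_range X (0 : R) by split=> [|_] //; rewrite ler0n.
  have d0 : 0 < dist_of X e1 by rewrite -(@dist_of0 R X) dist_of_ltE.
  exists (dist_of X e1 / 2); first by rewrite divr_gt0.
  move=> e' le z [Mz xz]; have Hz := (homogP z).1 Mz.
  have lt : dist x z < dist_of X e1.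
    by apply: le_lt_trans xz (le_lt_trans le _); rewrite ltr_pdivrMr// ltr_pMr// ltr1n.
  move: lt; rewrite distE// dist_of_ltE//; last exact: sq_inr.
  move=> lt; apply/ltW; rewrite -subr_gt0; apply: eP => //; rewrite sqC.
  by apply: lt_le_trans lt _; rewrite ge_min lexx.
move: mm; rewrite lt_min => /andP[mp mq].
have [e1 e10 e1P] := near_end _ Mp mp; have [e2 e20 e2P] := near_end _ Mq mq.
pose e0 := Num.min (Num.min e1 e2) 2^-1.
have e00 : 0 < e0 by rewrite !lt_min e10 e20 invr_gt0 ltr0n.
have [le1 le2] : e0 <= e1 /\ e0 <= e2 by rewrite /e0 !ge_min !lexx ?orbT.
have O1 z : orthogonal_ball p q e0 z -> model R X d.+2 z /\ m <= dot h (homog z).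
  by move=> [[Mz _] bz]; split => //; exact: e1P bz.
have O2 z : orthogonal_ball q p e0 z -> model R X d.+2 z /\ m <= dot h (homog z).
  by move=> [[Mz _] bz]; split => //; exact: e2P bz.
have up z : model R X d.+2 z /\ m <= dot h (homog z) -> S z.
  by move=> [Mz le]; apply/hS; split => //; exact: lt_le_trans le.
have se0 : small X e0.
  move=> _; rewrite gtr0_norm//; apply: (@le_lt_trans _ _ 2^-1); first by rewrite ge_min lexx orbT.
  by apply: lt_le_trans (pihalf_ge1 R); rewrite invf_lt1// ltr1n.
exists e0; split => //; [by move=> z /O1/up|by move=> z /O2/up|].
have [E|nS] := pselect (X = Spherical); last first.
  by move=> z [Mz _]; rewrite (region_nonspherical rS nS).
pose Y := [set z | model R X d.+2 z /\ m <= dot h (homog z)].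
have cY : geo_convex Y.
  split=> [z []//|x y [Mx hx] [My hy] _ z /(segmentP _ Mx My)[Mz [a [b [a0 b0 zE]]]]].
  split => //; have Hx := (homogP x).1 Mx; have Hy := (homogP y).1 My.
  have zz := ((homogP z).1 Mz).1; have xy := sq_ge0 Hx Hy.
  have nE : X <> Euclidean by rewrite E.
  have k1 : k = 1 by rewrite /curv E.
  (* [bil] of the two unit vectors is at most 1, so [bil X z z = 1] is at most [(a + b) ^+ 2]. *)
  have ab : 1 <= a + b.
    move: zz xy; rewrite zE sq_bil// !bilE Hx.1 Hy.1 (bilC X (homog y)) k1.
    have := mulr_ge0 a0 b0; have := addr_ge0 a0 b0.
    set g := bil X _ _; move: a0 b0; clear -X d; nra.
  rewrite zE dotDr !dotZr.
  have h1 := ler_wpM2l a0 hx; have h2 := ler_wpM2l b0 hy.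
  apply: le_trans (lerD h1 h2); rewrite -mulrDl; exact: (ler_peMl (ltW m0) ab).
have HY z : hull S (orthogonal_ball p q e0 `|` orthogonal_ball q p e0) z -> Y z.
  by apply; [exact: cY|move=> y [/O1|/O2]|move=> y /up].
move=> z clz; have [Mz _] := clz; apply/hS; split => //.
rewrite ltNge; apply/negP => le.
have N : \forall v \near homog z, 0 < m - dot h v.
  apply: near_pos; last by rewrite subr_gt0; exact: le_lt_trans le m0.
  apply: (@continuousB R R^o V (fun=> m) (dot h)); first exact: cst_continuous.
  exact: dot_continuous.
have [y /HY[_ my]] := closure_near (fun y (Hy : hull _ _ y) => (HY y Hy).1) clz N.
by rewrite subr_gt0 ltNge my.
Qed.

End Invariance.

Section TwoBallsHull.
Context {R : realType}.
Variables (X : geometry) (d : nat).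
Local Notation sn := (@gsin R X).
Local Notation V := 'rV[R]_d.+3.
Local Notation P := (ambient R X d.+2).
Local Notation gamma := (@axis R X d).
Variables (a b : P) (r : R) (S : set P) (F : 'M[R]_d.+3) (t : R).
Hypotheses (Ma : model R X d.+2 a) (Mb : model R X d.+2 b) (r0 : 0 < r) (rS : region S)
  (aS : geo_ball a r `<=` S) (bS : geo_ball b r `<=` S) (iF : isom X F) (t0 : 0 <= t)
  (aF : homog a = gamma (- t) *m F) (bF : homog b = gamma t *m F) (sm : small X (t + r)).
Implicit Types (u v w : V) (K L W : set P) (x y z p q : P) (Sg N : 'M[R]_d.+3).

Local Notation M := (hull S (geo_ball a r `|` geo_ball b r)).
Local Notation rho := (t + r).

Let uF : F \in unitmx. Proof. by have [] := iF. Qed.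
Let MF w : Mod X w -> Mod X (w *m F). Proof. by have [_ _ _] := iF; exact. Qed.
Let rho0 : 0 < rho. Proof. exact: ltr_wpDl. Qed.
Let smr : small X r.
Proof. by apply: (small_le sm); rewrite (ger0_norm (ltW r0)) (ger0_norm (ltW rho0)) lerDr. Qed.
Let rhopi : X = Spherical -> rho <= pi.
Proof.
move=> E; apply/ltW; apply: lt_le_trans (small_norm sm (ltW rho0) E) _.
by rewrite ler_pdivrMr// ler_peMr ?ler1n// pi_ge0.
Qed.
Let rpi : X = Spherical -> `|r| <= pi.
Proof. by move=> E; rewrite (ger0_norm (ltW r0)); apply: le_trans (rhopi E); rewrite lerDr. Qed.
Let vA : geo_convex (geo_ball a r). Proof. exact: ball_convex Ma smr (ltW r0). Qed.
Let vB : geo_convex (geo_ball b r). Proof. exact: ball_convex Mb smr (ltW r0). Qed.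

Let hullP := hull_cone rS aS bS (cone_addP rS aS vA) (cone_addP rS bS vB).

Let MM : M `<=` model R X d.+2.
Proof. by have [MS _ _] := hullP => z /MS/(region_model rS). Qed.

Definition center : P := unhomog X (gamma 0 *m F).
Definition end1 : P := unhomog X (gamma (- rho) *m F).
Definition end2 : P := unhomog X (gamma rho *m F).

Lemma homog_center : homog center = gamma 0 *m F.
Proof. by rewrite unhomogK//; apply: MF; exact: Mod_gamma. Qed.
Lemma homog_end1 : homog end1 = gamma (- rho) *m F.
Proof. by rewrite unhomogK//; apply: MF; exact: Mod_gamma. Qed.
Lemma homog_end2 : homog end2 = gamma rho *m F.
Proof. by rewrite unhomogK//; apply: MF; exact: Mod_gamma. Qed.

Let Mc : model R X d.+2 center. Proof. by apply/homogP; rewrite homog_center; apply: MF; exact: Mod_gamma. Qed.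
Let M1 : model R X d.+2 end1. Proof. by apply/homogP; rewrite homog_end1; apply: MF; exact: Mod_gamma. Qed.
Let M2 : model R X d.+2 end2. Proof. by apply/homogP; rewrite homog_end2; apply: MF; exact: Mod_gamma. Qed.

Let snrho : sn rho != 0. Proof. by apply: small_sn => //; rewrite gt_eqF. Qed.

Let end1M : M end1.
Proof.
apply: hull_sub; left; apply/ball_sq => //; first exact: ltW.
split => //; rewrite homog_end1 aF isom_sq//; try exact: Mod_gamma.
have e : - rho - - t = - r by ring.
rewrite (@sq_gammaE R X d (- rho) (- t) r 0) ?e ?subr0 ?normrN//.
Qed.

Let end2M : M end2.
Proof.
apply: hull_sub; right; apply/ball_sq => //; first exact: ltW.
split => //; rewrite homog_end2 bF isom_sq//; try exact: Mod_gamma.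
have e : rho - t = r by ring.
rewrite (@sq_gammaE R X d rho t r 0) ?e ?subr0//.
Qed.

Let ball_bound x z (s : R) : model R X d.+2 x -> homog x = gamma s *m F -> `|s| = t ->
  geo_ball x r z -> sq X (homog z) (homog center) <= sq X (gamma rho) (gamma 0).
Proof.
move=> Mx xF st /(ball_sq _ Mx smr (ltW r0))[Mz].
have [iuF _ _ MFi] := isomV iF; have Hz := (homogP z).1 Mz.
rewrite homog_center xF; set u := homog z *m invmx F.
have -> : homog z = u *m F by rewrite mulmxKV.
have Mu : Mod X u by exact: MFi.
rewrite !isom_sq//; try exact: Mod_gamma.
have [s0|sn0] := eqVneq s 0.
  by have t00 : t = 0; rewrite ?s0 ?t00 ?add0r// -st s0 normr0.
have tp : 0 < t by rewrite -st normr_gt0.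
have tn : t != 0 by rewrite gt_eqF.
have rn : rho != 0 by rewrite gt_eqF.
(* [gamma s'] is the point of the large sphere beyond the centre [gamma s = gamma (t' * s')], so the
   small ball touches the large one there and [ball_sub] applies. *)
pose s' := s * (rho / t); pose t' := t / rho.
have t'0 : 0 < t' by exact: divr_gt0.
have t'1 : t' < 1 by rewrite ltr_pdivrMr// mul1r ltrDl.
have s'n : `|s'| = rho by rewrite normrM st (ger0_norm (divr_ge0 (ltW rho0) t0)) mulrC divfK.
have s'0 : s' != 0 by rewrite -normr_gt0 s'n.
have sm' : small X s' by move=> E; rewrite s'n; exact: small_norm sm (ltW rho0) E.
have ts : t' * s' = s by rewrite /t' /s'; field; rewrite tn rn.
have ss : `|s' - s| = r.
  have -> : s' - s = s * (r / t) by rewrite /s'; field.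
  by rewrite normrM st (ger0_norm (divr_ge0 (ltW r0) t0)) mulrC divfK.
move=> us; have us' : sq X u (gamma (t' * s')) <= sq X (gamma s') (gamma (t' * s')).
  rewrite ts; apply: le_trans us _; rewrite (@sq_gammaE R X d s' s r 0) ?ss ?subr0 ?(ger0_norm (ltW r0))// => E.
  by rewrite -(ger0_norm (ltW r0)); exact: rpi.
have [h _] := ball_sub Mu sm' s'0 t'0 t'1 us'.
apply: le_trans h _; by rewrite (@sq_gammaE R X d s' 0 rho 0) ?subr0 ?s'n ?(ger0_norm (ltW rho0)).
Qed.

Lemma hull_bound z : M z -> sq X (homog z) (homog center) <= sq X (gamma rho) (gamma 0).
Proof.
have nt : `|- t| = t by rewrite normrN ger0_norm.
have nt' : `|t| = t by rewrite ger0_norm.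
have [_ _ cM] := hullP => Hz; have Mz := MM Hz; have Hz' := (homogP z).1 Mz.
have AM : geo_ball a r `<=` model R X d.+2 by move=> ? [].
have BM : geo_ball b r `<=` model R X d.+2 by move=> ? [].
have /cM[/(cone_homog AM Mz)|/(cone_homog BM Mz)|] := (cone_homog MM Mz).2 Hz.
- exact: ball_bound aF nt.
- exact: ball_bound bF nt'.
- move=> [_ [_ [[e [x [e0 Ax ->]]] [e' [y [e'0 By ->]]] zE]]].
  have Hx := (homogP x).1 (AM _ Ax); have Hy := (homogP y).1 (BM _ By).
  apply: (ball_comb Hx Hy Hz' ((homogP _).1 Mc) (ltW e0) (ltW e'0) zE).
  + exact: ball_bound aF nt Ax.
  + exact: ball_bound bF nt' By.
  + exact: sq_gamma_lt2.
Qed.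

Let sq_ends : sq X (homog end1) (homog end2) = 4 * sn rho ^+ 2.
Proof. by rewrite homog_end1 homog_end2 isom_sq ?sq_gamma_opp 1?sqC ?sq_gamma_opp//; exact: Mod_gamma. Qed.

Let end12 : end1 <> end2.
Proof.
move=> e; have := sq_ends; rewrite e sqxx => /esym/eqP.
by rewrite mulf_eq0 pnatr_eq0 expf_eq0 (negPf snrho).
Qed.

Lemma hull_diametral : diametral M end1 end2.
Proof.
split => //; apply/esym/diam_max => // p q Mp Mq.
have Hp := (homogP p).1 (MM Mp); have Hq := (homogP q).1 (MM Mq).
have [iuF _ _ MFi] := isomV iF.
rewrite !distE//; [|exact: MM|exact: MM].
rewrite dist_of_leE; [|exact: sq_inr|apply: sq_inr; exact/homogP].
rewrite sq_ends; have := hull_bound Mp; have := hull_bound Mq; rewrite homog_center.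
have key w : Mod X w -> sq X w (gamma 0 *m F) = sq X (w *m invmx F) (gamma 0).
  by move=> Mz; rewrite -{1}(mulmxKV uF w) isom_sq//; [exact: MFi|exact: Mod_gamma].
rewrite !key// => bq bp.
have -> : sq X (homog p) (homog q) = sq X (homog p *m invmx F) (homog q *m invmx F).
  by rewrite isom_sq//; exact: isomV.
by have [] := sq_pair (MFi _ Hp) (MFi _ Hq) sm bp bq.
Qed.

(** Uniqueness compares segments as sets, so the endpoints must be recovered: [end1] and [end2] lie
    on the segment from [p] to [q] and on the sphere around the hull, hence cannot be interior
    points of that segment. *)
Lemma hull_ends p q : unique_diametral M p q ->
  p = end1 /\ q = end2 \/ p = end2 /\ q = end1.
Proof.
move=> [[Mp Mq dpq] uniq]; have sE := uniq _ _ hull_diametral.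
have Hp := (homogP p).1 (MM Mp); have Hq := (homogP q).1 (MM Mq).
have H1 := (homogP _).1 M1; have H2 := (homogP _).1 M2; have Hc := (homogP _).1 Mc.
have pq : homog p <> homog q.
  move=> /homog_inj e; have [_ _ de] := hull_diametral.
  have : dist end1 end2 = dist p q by rewrite de.
  rewrite e !distE ?sqxx//; try exact: MM.
  move/dist_of_inj => h; apply: end12; apply: homog_inj; apply: (sq_eq0 H1 H2).
  by apply: h; [exact: sq_inr|split=> [|_] //; rewrite ler0n].
have on z s : model R X d.+2 z -> homog z = gamma s *m F -> `|s| = rho -> segment p q z ->
    z = p \/ z = q.
  move=> Mz zF sr /(segmentP _ (MM Mp) (MM Mq))[_ [e [e' [e0 e'0 zE]]]].
  have Hz := (homogP z).1 Mz.
  have zc : sq X (homog z) (homog center) = sq X (gamma rho) (gamma 0).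
    rewrite zF homog_center isom_sq//; try exact: Mod_gamma.
    by apply: sq_gammaE; rewrite ?subr0 sr ?(ger0_norm (ltW rho0)).
  have one (c : R) w : Mod X w -> 0 <= c -> homog z = c *: w -> homog z = w.
    move=> Mw; rewrite le_eqVlt => /predU1P[<-|c0].
      by rewrite scale0r => z0; have := Mod_neq0 Hz; rewrite z0 eqxx.
    move=> zw; have e1 : 1 *: homog z = c *: w by rewrite scale1r.
    by have [] := Mod_scale_eq Hz Mw ltr01 c0 e1.
  move: e0; rewrite le_eqVlt => /predU1P[e0|e0].
    by right; apply: homog_inj; apply: (one e') => //; rewrite zE -e0 scale0r add0r.
  move: e'0; rewrite le_eqVlt => /predU1P[e'0|e'0].
    by left; apply: homog_inj; apply: (one e) => //; [exact: ltW|rewrite zE -e'0 scale0r addr0].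
  exfalso; apply: pq; apply: (ball_strict Hp Hq Hz Hc e0 e'0 zE); rewrite zc; try exact: hull_bound.
  by move=> E; exact: sq_gamma_lt2.
have seg z : z = end1 \/ z = end2 -> segment p q z.
  rewrite -sE => h; apply/segmentP => //; case: h => ->; split => //.
    by exists 1, 0; rewrite ler01 lexx scale1r scale0r addr0.
  by exists 0, 1; rewrite ler01 lexx scale1r scale0r add0r.
have n1 : `|- rho| = rho by rewrite normrN (ger0_norm (ltW rho0)).
have n2 : `|rho| = rho by rewrite (ger0_norm (ltW rho0)).
have := on _ _ M1 homog_end1 n1 (seg _ (or_introl erefl)).
have := on _ _ M2 homog_end2 n2 (seg _ (or_intror erefl)).
by case=> e2 [] e1; [case: end12; rewrite e1 e2|right|left|case: end12; rewrite e1 e2].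
Qed.

Section Conjugate.
Variable Sg : 'M[R]_d.+3.
Hypothesis aSg : axis_sym X Sg.

(** The axial or central matrix, moved to the line of the two centres. *)
Definition conj_sym : 'M[R]_d.+3 := invmx F *m Sg *m F.

Lemma conj_gamma s : gamma s *m F *m conj_sym = gamma (- s) *m F.
Proof. by have [_ _ gS] := aSg; rewrite /conj_sym !mulmxA mulmxK// gS. Qed.

Lemma conj_isom : isom X conj_sym.
Proof.
by have [iS _ _] := aSg; apply: isomM => //; apply: isomM => //; exact: isomV.
Qed.

Lemma conj_invol : conj_sym *m conj_sym = 1%:M.
Proof.
have [_ SS _] := aSg; rewrite /conj_sym !mulmxA mulmxK//.
by rewrite -(mulmxA (invmx F)) SS mulmx1 mulVmx.
Qed.

Let ball_sym x y z z' : model R X d.+2 x -> model R X d.+2 y ->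
  homog y = homog x *m conj_sym -> geo_ball x r z ->
  model R X d.+2 z' -> homog z' = homog z *m conj_sym -> geo_ball y r z'.
Proof.
move=> Mx My yE [Mz xz] Mz' zE; split => //.
rewrite distE// yE zE isom_sq; [by rewrite -distE|exact: conj_isom|exact/homogP|exact/homogP].
Qed.

Lemma hull_invariant : preserves conj_sym M.
Proof.
have ab : homog b = homog a *m conj_sym by rewrite aF bF conj_gamma opprK.
have ba : homog a = homog b *m conj_sym by rewrite aF bF conj_gamma.
apply: (invariant_hull rS aS bS vA vB conj_isom) => z z'.
  exact: ball_sym Ma Mb ab.
exact: ball_sym Mb Ma ba.
Qed.

Lemma thickening_invariant (e : R) p q : small X e -> 0 <= e ->
  model R X d.+2 p -> model R X d.+2 q -> p <> q ->
  orthogonal_ball p q e `<=` S -> orthogonal_ball q p e `<=` S ->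
  homog q = homog p *m conj_sym -> homog p = homog q *m conj_sym ->
  preserves conj_sym (thickening S p q e).
Proof.
move=> sme e0 Mp Mq pq O1 O2 qE pE.
have cO x y : model R X d.+2 x -> model R X d.+2 y -> geo_convex (orthogonal_ball x y e).
  move=> Mx My; have [_ cb] := ball_convex Mx sme e0.
  split=> [z [[]]//|z1 z2 [[Mz1 h1] b1] [[Mz2 h2] b2] nz z sz]; split; last exact: cb sz.
  have [Mz [e1 [e2 [_ _ zE]]]] := (segmentP z Mz1 Mz2).1 sz; split => //.
  apply/form_tangent0 => //; rewrite zE dotDr !dotZr.
  by rewrite ((form_tangent0 Mx My Mz1).1 h1) ((form_tangent0 Mx My Mz2).1 h2) !mulr0 addr0.
have iN := conj_isom.
have tr x y z z' : model R X d.+2 x -> model R X d.+2 y ->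
    homog y = homog x *m conj_sym -> homog x = homog y *m conj_sym ->
    orthogonal_ball x y e z -> model R X d.+2 z' -> homog z' = homog z *m conj_sym ->
    orthogonal_ball y x e z'.
  move=> Mx My yE xE [[Mz hz] [_ bz]] Mz' zE.
  have Hx := (homogP x).1 Mx; have Hy := (homogP y).1 My.
  split; split => //.
    apply/form_tangent0 => //; rewrite zE yE {2}xE normal_isom//.
    exact/(form_tangent0 Mx My Mz).
  by rewrite distE// yE zE isom_sq; [rewrite -distE|exact: conj_isom|exact/homogP|exact/homogP].
have iH : preserves conj_sym (hull S (orthogonal_ball p q e `|` orthogonal_ball q p e)).
  apply: (invariant_hull rS O1 O2 (cO _ _ Mp Mq) (cO _ _ Mq Mp) iN) => z z'.
    exact: tr Mp Mq qE pE.
  exact: tr Mq Mp pE qE.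
suff HM : hull S (orthogonal_ball p q e `|` orthogonal_ball q p e) `<=` model R X d.+2.
  exact: invariant_closure HM iN iH.
have [HS _ _] := hull_cone rS O1 O2 (cone_addP rS O1 (cO _ _ Mp Mq)) (cone_addP rS O2 (cO _ _ Mq Mp)).
by move=> z /HS/(region_model rS).
Qed.

End Conjugate.

Lemma center_reflection z : model R X d.+2 z ->
  homog (point_reflection center z) = homog z *m conj_sym (@central_sym R d).
Proof.
move=> Mz; rewrite homog_point_reflection// /conj_sym !mulmxA (central_symE X).
rewrite mulmxBl -scalemxAl mulmxKV// homog_center.
have [_ bF' _ _] := iF.
by rewrite -[homog z in LHS](mulmxKV uF) bF' mulmxKV.
Qed.

Lemma bisector_reflection p q z : p = end1 /\ q = end2 \/ p = end2 /\ q = end1 ->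
  model R X d.+2 z ->
  homog (hyperplane_reflection (Defs.midpoint p q) (tangent (Defs.midpoint p q) q) z) =
  homog z *m conj_sym (@axial_sym R d).
Proof.
move=> pq Mz; have Hz := (homogP z).1 Mz; have [MS _ _] := hullP.
have [_ _ _ MFi] := isomV iF.
have key (s : R) p' q' : sn s != 0 -> M p' -> M q' -> p' <> q' ->
    homog p' = gamma (- s) *m F -> homog q' = gamma s *m F ->
    homog (hyperplane_reflection (Defs.midpoint p' q') (tangent (Defs.midpoint p' q') q') z) =
    homog z *m conj_sym (@axial_sym R d).
  move=> s0 Mp' Mq' pq' pF qF.
  rewrite homog_reflection//; [|exact: MM|exact: MM|].
    rewrite pF qF -{1}(mulmxKV uF (homog z)) swap_conj//; try exact: Mod_gamma; last exact: MFi.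
    by rewrite axial_swap// /conj_sym !mulmxA.
  by apply: (region_not_opp rS); exact: MS.
case: pq => -[-> ->].
  by apply: (key rho) => //; [exact: homog_end1|exact: homog_end2].
apply: (key (- rho)) => //; rewrite ?snN ?oppr_eq0// ?opprK; [exact/nesym|exact: homog_end2|exact: homog_end1].
Qed.

Lemma hull_central : centrally_symmetric M.
Proof.
exists center => //; have aS' := central_symP X d (R := R).
apply: image_invariant (conj_isom aS') (conj_invol aS') (hull_invariant aS') center_reflection.
exact: MM.
Qed.

Lemma hull_bisector p q : unique_diametral M p q -> bisector_symmetric p q M.
Proof.
move=> /hull_ends pq; have aS' := axial_symP X d (R := R).
apply: image_invariant (conj_isom aS') (conj_invol aS') (hull_invariant aS') _.
  exact: MM.
by move=> z Mz; exact: bisector_reflection.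
Qed.

Lemma hull_thickening p q : unique_diametral M p q -> exists e0 : R,
  [/\ 0 < e0, thickening S p q e0 `<=` S & forall e : R, 0 < e -> e < e0 ->
    centrally_symmetric (M `&` thickening S p q e) /\
    bisector_symmetric p q (M `&` thickening S p q e)].
Proof.
move=> /hull_ends pq; have [MS _ _] := hullP.
have [Mp Mq pq'] : [/\ M p, M q & p <> q].
  by case: pq => -[-> ->]; split => //; exact/nesym.
have [e0 [e00 sm0 O1 O2 TS]] := exists_thin rS (MS _ Mp) (MS _ Mq).
exists e0; split => // e ep ee0.
have sme : small X e by apply: (small_le sm0); rewrite !gtr0_norm// ltW.
have sub x y : orthogonal_ball x y e `<=` orthogonal_ball x y e0.
  by move=> z [hz [Mz bz]]; split => //; split => //; apply: le_trans bz _; exact: ltW.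
have swp Sg : axis_sym X Sg -> homog q = homog p *m conj_sym Sg /\
    homog p = homog q *m conj_sym Sg.
  by move=> aSg; case: pq => -[-> ->]; rewrite homog_end1 homog_end2 !conj_gamma// opprK.
have inv Sg : axis_sym X Sg -> preserves (conj_sym Sg) (M `&` thickening S p q e).
  move=> aSg; have [qE pE] := swp _ aSg.
  apply: invariantI; first exact: hull_invariant.
  apply: thickening_invariant => //; [exact: ltW|exact: MM|exact: MM| |].
    by move=> z /sub/O1.
  by move=> z /sub/O2.
have sub' : M `&` thickening S p q e `<=` model R X d.+2 by move=> z [/MM].
have aS1 := central_symP X d (R := R); have aS2 := axial_symP X d (R := R); split.
  exists center => //.
  by apply: image_invariant (conj_isom aS1) (conj_invol aS1) (inv _ aS1) center_reflection.
apply: image_invariant (conj_isom aS2) (conj_invol aS2) (inv _ aS2) _ => //.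
by move=> z Mz; exact: bisector_reflection.
Qed.

End TwoBallsHull.

Section Balls.
Context {R : realType}.
Variables (X : geometry) (d : nat).
Local Notation P := (ambient R X d.+2).
Implicit Types (K L S : set P) (p q : P) (f g : P -> P).

Lemma joint_hull_balls K L S f g : is_geo_ball K -> congruent K L -> admissible S f g K L ->
  let M := joint_hull S f g K L in
  centrally_symmetric M /\ forall p q, unique_diametral M p q ->
    bisector_symmetric p q M /\ exists e0 : R,
      [/\ 0 < e0, thickening S p q e0 `<=` S & forall e : R, 0 < e -> e < e0 ->
        centrally_symmetric (M `&` thickening S p q e) /\
        bisector_symmetric p q (M `&` thickening S p q e)].
Proof.
move=> [c [r [Mc [r0 _] KE]]] [h ch hL] [[cf _] [cg _] rS KLS] M.
have [[hM _ _] _] := ch; have [[fM _ _] _] := cf; have [[gM _ _] _] := cg.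
have Mhc := hM _ Mc; have Ma := fM _ Mc; have Mb := gM _ Mhc.
have ME : M = hull S (geo_ball (f c) r `|` geo_ball (g (h c)) r).
  by rewrite /M /joint_hull -hL KE !congruence_ball.
move: KLS; rewrite -hL KE !congruence_ball// => KLS.
have aS : geo_ball (f c) r `<=` S by move=> z Hz; apply: KLS; left.
have bS : geo_ball (g (h c)) r `<=` S by move=> z Hz; apply: KLS; right.
have [F [t [iF t0 aF bF sm]]] := ball_frame Ma Mb r0 rS aS bS.
rewrite ME; split; first exact: (hull_central Ma Mb r0 rS aS bS iF t0 aF bF sm).
move=> p q ud; split; first exact: (hull_bisector Ma Mb r0 rS aS bS iF t0 aF bF sm ud).
exact: (hull_thickening Ma Mb r0 rS aS bS iF t0 aF bF sm ud).
Qed.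

Lemma far_all K L (Q : set P -> (P -> P) -> (P -> P) -> P -> P -> Prop) :
  (forall S f g x y, admissible S f g K L ->
     unique_diametral (joint_hull S f g K L) (f x) (g y) -> Q S f g x y) ->
  for_all_far K L Q.
Proof.
by move=> H; exists 0 => [_|S f g x y ad _ _ _ ud]; [exact: pi_gt0|exact: H].
Qed.

End Balls.

Theorem theorem7 (R : realType) (X : geometry) (d : nat) (d_ge2 : (2 <= d)%N)
  (K L : set (ambient R X d))
  (K_proper : K `<` model R X d) (L_proper : L `<` model R X d)
  (K_closed : geo_closed K) (L_closed : geo_closed L)
  (K_convex : geo_convex K) (L_convex : geo_convex L)
  (K_inter : geo_interior K !=set0) (L_inter : geo_interior L !=set0)
  (K_region : exists2 S, region S & K `<=` S)
  (L_region : exists2 S, region S & L `<=` S)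
  (K_supp : forall x, geo_boundary K x -> has_supporting_sphere K x)
  (L_supp : forall y, geo_boundary L y -> has_supporting_sphere L y) :
  [<->
    (* (1) *)
    forall S f g, admissible S f g K L ->
      centrally_symmetric (joint_hull S f g K L);
    (* (2) *)
    forall S f g, admissible S f g K L ->
      forall p q, unique_diametral (joint_hull S f g K L) p q ->
        bisector_symmetric p q (joint_hull S f g K L);
    (* (3) *)
    for_all_far K L (fun S f g x y =>
      centrally_symmetric (joint_hull S f g K L));
    (* (4) *)
    for_all_far K L (fun S f g x y =>
      bisector_symmetric (f x) (g y) (joint_hull S f g K L));
    (* (5) *)
    for_all_far K L (fun S f g x y =>
      exists e0 : R,
        [/\ 0 < e0, thickening S (f x) (g y) e0 `<=` S
          & forall e : R, 0 < e -> e < e0 ->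
              centrally_symmetric
                (joint_hull S f g K L `&` thickening S (f x) (g y) e)]);
    (* (6) *)
    for_all_far K L (fun S f g x y =>
      exists e0 : R,
        [/\ 0 < e0, thickening S (f x) (g y) e0 `<=` S
          & forall e : R, 0 < e -> e < e0 ->
              bisector_symmetric (f x) (g y)
                (joint_hull S f g K L `&` thickening S (f x) (g y) e)]);
    (* (7) *)
    [/\ is_geo_ball K, is_geo_ball L & congruent K L]
  ].
Proof.
move: X K L K_proper L_proper K_closed L_closed K_convex L_convex K_inter L_inter
  K_region L_region K_supp L_supp.
(* Writing the dimension as [n.+2] gives the shape in which the axis and a transverse coordinate
   exist. *)
case: d d_ge2 => [|[|n]] // _ X K L pK pL cK cL vK vL iK iL rK rL sK sL.
have bK := body_of_supports pK cK vK iK rK sK.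
have bL := body_of_supports pL cL vL iL rL sL.
pose B := [/\ is_geo_ball K, is_geo_ball L & congruent K L].
have central (H : exists2 T, (X = Spherical -> T < pi) & germ_sym (@central_sym R n) T K L) : B.
  by have [T TS gKL] := H; exact: balls_of_germ (central_symP X n) TS bK bL gKL.
have axial (H : exists2 T, (X = Spherical -> T < pi) & germ_sym (@axial_sym R n) T K L) : B.
  by have [T TS gKL] := H; exact: balls_of_germ (axial_symP X n) TS bK bL gKL.
have all (H : B) := let: And3 bK' _ cKL := H in
  fun S f g ad => @joint_hull_balls R X n K L S f g bK' cKL ad.
tfae.
(* The unconditional statements are far statements with threshold 0, so each implication can pass
   through [B] and read its conclusion off the hull of two balls. *)
- move=> H1; have /all sym : B.
    by apply/central/far_central => //; apply: far_all => S f g x y ad _; exact: H1.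
  by move=> S f g ad p q ud; have [_ /(_ _ _ ud)[]] := sym S f g ad.
- move=> H2; have /all sym : B.
    by apply/axial/far_axial => //; apply: far_all => S f g x y ad ud; exact: H2.
  by apply: far_all => S f g x y ad _; have [] := sym S f g ad.
- move=> /(far_central bK bL)/central/all sym.
  by apply: far_all => S f g x y ad ud; have [_ /(_ _ _ ud)[]] := sym S f g ad.
- move=> /(far_axial bK bL)/axial/all sym; apply: far_all => S f g x y ad ud.
  have [_ /(_ _ _ ud)[_ [e0 [e00 TS H]]]] := sym S f g ad.
  by exists e0; split => // e ep ee0; have [] := H e ep ee0.
- move=> /(far_central_local bK bL)/central/all sym; apply: far_all => S f g x y ad ud.
  have [_ /(_ _ _ ud)[_ [e0 [e00 TS H]]]] := sym S f g ad.
  by exists e0; split => // e ep ee0; have [] := H e ep ee0.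
- by move=> /(far_axial_local bK bL)/axial.
- by move=> /all sym S f g ad; have [] := sym S f g ad.
Qed.
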